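(* Let $T>0$. For any $0\le\alpha<1$ and any exponents $1\le q\le \infty$, $1\le p<\infty$ satisfying $$[(3-\alpha)p-2]\,q<2 ,$$ there exists a force $f\in L^q(0,T;L^p(D))$ such that the corresponding unique solution $v$ (with pressure $P$) of the Navier-Stokes equations $$\Delta v-v\cdot\nabla v-\nabla P-\partial_t v=f,\qquad \nabla\cdot v=0\qquad\text{in } D\times[0,T),$$ satisfying the no slip boundary condition $v=0$ on the vertical boundary of $D$ and the Navier total slip boundary condition on the horizontal boundary of $D$, satisfies the blow up condition $$\lim_{t\to T}\|v(\cdot,t)\|_{L^\infty(D)}=+\infty .$$ Moreover $v\in L^{\tilde q}(0,T;L^{\tilde p}(D))$ for all pairs $\tilde p\in[1,\infty)$, $\tilde q\in[1,\infty]$ such that $[(1-\alpha)\tilde p-2]\,\tilde q<2$. The force $f$ and the solution $v$ are smooth in $D\times[0,T)$ (so blow up occurs only at time $T$).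
   Context: $D=B_2(0,1)\times[0,1]\subset\mathbb{R}^3$ is the cylinder, where $B_2(0,1)$ is the unit ball of $\mathbb{R}^2$ centred at the origin. Its vertical boundary is the lateral surface $\{x_1^2+x_2^2=1,\ 0\le x_3\le 1\}$ and its horizontal boundary consists of the top and bottom faces $x_3\in\{0,1\}$. With cylindrical components $v_r=v\cdot e_r$, $v_\theta=v\cdot e_\theta$, $v_3=v\cdot e_3$, the Navier total slip boundary condition on the horizontal boundary is $\partial_{x_3}v_r=\partial_{x_3}v_\theta=0$, $v_3=0$. The velocity $v$ and force $f$ are $\mathbb{R}^3$-valued and $P$ is scalar; the Navier-Stokes problem carries an initial condition $v(x,0)=v_0(x)$, where $v_0$ is the value of $v$ at $t=0$ (the existence statement includes the existence of such an initial value). ''Unique'' means that $v$ is the only velocity field, among solutions smooth for $t<T$, solving the problem with the given $f$, initial value and boundary conditions. The hypothesis $[(3-\alpha)p-2]q<2$ forces $q<\infty$ here. When $\tilde q=\infty$, the inequality $[(1-\alpha)\tilde p-2]\tilde q<2$ is read as $(1-\alpha)\tilde p-2<0$. *)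

(* Defs.v *)
From HB Require Import structures.
From mathcomp Require Import all_boot all_order all_algebra.
From mathcomp Require Import all_classical all_reals all_analysis.

Set Implicit Arguments.
Unset Strict Implicit.
Unset Printing Implicit Defensive.

Import Order.TTheory GRing.Theory Num.Theory.
Import numFieldNormedType.Exports.

Local Open Scope classical_set_scope.
Local Open Scope ring_scope.

Notation vec3 R := (R * R * R)%type.

(* R * R * R carries the sup norm, topologically equivalent to this one. *)
Definition enorm (R : realType) (x : vec3 R) : R :=
  Num.sqrt (x.1.1 ^+ 2 + x.1.2 ^+ 2 + x.2 ^+ 2).

Definition e1 (R : realType) : vec3 R := (1, 0, 0).
Definition e2 (R : realType) : vec3 R := (0, 1, 0).
Definition e3 (R : realType) : vec3 R := (0, 0, 1).

Section Smooth.
Context {R : realType} {V W : normedModType R}.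

Definition iter_derive (s : seq V) (g : V -> W) : V -> W :=
  foldr (fun e h => 'D_e h) g s.

(* For finite-dimensional V (the only case used), this is C^oo regularity on
   the open set U. *)
Definition smooth_open (U : set V) (g : V -> W) : Prop :=
  forall (s : seq V) (x : V), U x -> differentiable (iter_derive s g) x.

(* Smoothness up to the boundary on a set A which need not be open: g is
   defined and C^oo on a neighbourhood of A, so that the derivatives of g at
   boundary points of A are meaningful. *)
Definition smooth_on (A : set V) (g : V -> W) : Prop :=
  exists U : set V, [/\ open U, A `<=` U & smooth_open U g].

End Smooth.

Section Cylinder.
Context (R : realType).

Definition rad (x : vec3 R) : R := Num.sqrt (x.1.1 ^+ 2 + x.1.2 ^+ 2).

Definition cylinder : set (vec3 R) :=
  [set x | rad x <= 1 /\ 0 <= x.2 <= 1].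

Definition vertical_boundary : set (vec3 R) :=
  [set x | rad x = 1 /\ 0 <= x.2 <= 1].

Definition horizontal_boundary : set (vec3 R) :=
  [set x | rad x <= 1 /\ (x.2 = 0 \/ x.2 = 1)].

(* Cylindrical components: e_r = (x1 / r, x2 / r, 0) and
   e_theta = (- x2 / r, x1 / r, 0), off the axis r = 0. *)
Definition radial_comp (u : vec3 R -> vec3 R) (x : vec3 R) : R :=
  (u x).1.1 * (x.1.1 / rad x) + (u x).1.2 * (x.1.2 / rad x).

Definition angular_comp (u : vec3 R -> vec3 R) (x : vec3 R) : R :=
  (u x).1.1 * (- x.1.2 / rad x) + (u x).1.2 * (x.1.1 / rad x).

Definition no_slip (u : vec3 R -> vec3 R) : Prop :=
  forall x, vertical_boundary x -> u x = 0.

(* e_r and e_theta are undefined on the axis, hence the condition rad x != 0;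
   for smooth u the condition passes to the axis by continuity. *)
Definition navier_total_slip (u : vec3 R -> vec3 R) : Prop :=
  forall x, horizontal_boundary x ->
    (u x).2 = 0 /\
    (rad x != 0 -> 'D_(e3 R) (radial_comp u) x = 0 /\
                   'D_(e3 R) (angular_comp u) x = 0).

Definition laplacian (u : vec3 R -> vec3 R) (x : vec3 R) : vec3 R :=
  'D_(e1 R) ('D_(e1 R) u) x + 'D_(e2 R) ('D_(e2 R) u) x
  + 'D_(e3 R) ('D_(e3 R) u) x.

Definition convection (u : vec3 R -> vec3 R) (x : vec3 R) : vec3 R :=
  (u x).1.1 *: 'D_(e1 R) u x + (u x).1.2 *: 'D_(e2 R) u x
  + (u x).2 *: 'D_(e3 R) u x.

Definition gradient (P : vec3 R -> R) (x : vec3 R) : vec3 R :=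
  ('D_(e1 R) P x, 'D_(e2 R) P x, 'D_(e3 R) P x).

Definition divergence (u : vec3 R -> vec3 R) (x : vec3 R) : R :=
  ('D_(e1 R) u x).1.1 + ('D_(e2 R) u x).1.2 + ('D_(e3 R) u x).2.

Definition spacetime (T : R) : set (R * vec3 R) := `[0, T[ `*` cylinder.

Definition navier_stokes (T : R) (f v : R -> vec3 R -> vec3 R)
    (P : R -> vec3 R -> R) : Prop :=
  forall t x, spacetime T (t, x) ->
    laplacian (v t) x - convection (v t) x - gradient (P t) x
      - derive1 (fun s => v s x) t = f t x
    /\ divergence (v t) x = 0.

Definition smooth_solution (T : R) (f : R -> vec3 R -> vec3 R)
    (v0 : vec3 R -> vec3 R) (v : R -> vec3 R -> vec3 R)
    (P : R -> vec3 R -> R) : Prop :=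
  [/\ smooth_on (spacetime T) (fun z => v z.1 z.2),
      smooth_on (spacetime T) (fun z => P z.1 z.2),
      navier_stokes T f v P,
      (forall t, 0 <= t < T -> no_slip (v t) /\ navier_total_slip (v t)) &
      (forall x, cylinder x -> v 0 x = v0 x)].

Definition leb3 :
    {measure set (measurableTypeR R * measurableTypeR R * measurableTypeR R)
       -> \bar R} :=
  (@lebesgue_measure R \x @lebesgue_measure R \x @lebesgue_measure R)%E.

(* Outside the cylinder, the restriction _ \_ cylinder is 0. *)
Definition Lp_cylinder (p : \bar R) (u : vec3 R -> vec3 R) : \bar R :=
  ('N[leb3]_p [(fun x => (enorm (u x))%:E) \_ cylinder])%E.

(* Joint measurability on ]0, T[ x D together with a finite mixed norm; for
   p < +oo this is membership in the Bochner space L^q(0, T; L^p(D)). *)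
Definition LqLp (T : R) (q : \bar R) (p : R) (g : R -> vec3 R -> vec3 R)
    : Prop :=
  measurable_fun (`]0, T[ `*` cylinder) (fun z : R * vec3 R => g z.1 z.2) /\
  ('N[@lebesgue_measure R]_q
     [(fun t => Lp_cylinder p%:E (g t)) \_ `]0%R, T[] < +oo)%E.

(* [a p - 2] q < 2, read as a p - 2 < 0 when q = +oo. *)
Definition exponent_condition (a p : R) (q : \bar R) : Prop :=
  match q with
  | r%:E => (a * p - 2) * r < 2
  | +oo%E => a * p - 2 < 0
  | -oo%E => False
  end.

End Cylinder.

(* Main.v *)
Require Import Defs.
From HB Require Import structures.
From mathcomp Require Import all_boot all_order all_algebra.
From mathcomp Require Import all_classical all_reals all_analysis.
From mathcomp Require Import measurable_realfun ess_sup_inf ring lra.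
Set Implicit Arguments.
Unset Strict Implicit.
Unset Printing Implicit Defensive.
Import Order.TTheory GRing.Theory Num.Theory.
Import numFieldNormedType.Exports.
Local Open Scope classical_set_scope.
Local Open Scope ring_scope.

(** The solution is explicit. Write e = T - t for the time left, rho for the
squared distance to the axis and s = (1 - alpha) / 2. The velocity is a swirl
B (-x2, x1, 0) around the axis, of angular speed

  B = e^(3/2 - s) ((e + rho)^-2 - (e + 1)^-2).

Such a field is divergence free; it is independent of x3, hence satisfies the
total slip condition on the horizontal faces, and the subtracted constant
makes it vanish on the lateral surface rho = 1. Its convection term
- B^2 (x1, x2, 0) is a gradient, which the pressure cancels, so that the force
is the Laplacian minus the time derivative of the velocity, again a swirl.
Away from e = 0 everything is built from coordinates by field operations and
powers of positive quantities, hence smooth (elementary_smooth).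

Sizes. Since the product of the square roots of e and rho is at most e + rho,

  |v| <= e^(-s) (e / (e + rho))  and  |f| <= 46 e^(-(s + 1)) (e / (e + rho)).

A field of size e^(-s) concentrated in this way on a tube of radius sqrt e has
L^p norm of order e^(1/p - s), up to an arbitrarily small loss in the exponent,
and lies in L^q(0, T) in time when (s - 1/p) q < 1. The exponent condition
(2 s p - 2) q < 2 says (s - 1/p) q < 1/p, which is stronger because p >= 1.
This is LqLp_concentrated, used with s for the velocity (2 s = 1 - alpha) and
with s + 1 for the force (2 (s + 1) = 3 - alpha).

Blow up. On the circle rho = e the speed is at least e^(-s) / 8 for small e.
As the velocity is continuous, its values bound the essential supremum from
below (le_Lp_cylinder_oo), and s > 0 because alpha < 1.

Uniqueness (navier_stokes_unique) is the energy method. The difference w of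
two solutions u, v with the same data satisfies

  d_t w = Delta w - (u . grad) w - (w . grad) v - grad pi,   div w = 0.

Multiplied by w, this is a sum of the divergence of a flux vanishing on the
boundary in the relevant directions, of the nonpositive term - |grad w|^2, and
of - ((w . grad) v) . w, which is at most K |w|^2 on each [0, b] with b < T.
Integration over the cylinder gives an energy with E' <= 2 K E and E = 0 at
time 0, so E = 0 by a Gronwall argument. The divergence theorem that this uses
is elementary on the cylinder: each component of the flux is integrated along
the chords parallel to its axis, then Fubini's theorem is applied. *)

Local Notation rad := Defs.rad.

(** * Measure theory on the cylinder *)

Section CountableBase.

(** The base is asked to lie in a family M, meant to be a sigma-algebra: open
sets, as countable unions of base sets, are then in M, and the property passes
from two families to the rectangles over them. *)
Definition has_countable_base (T : topologicalType) (M : set (set T)) : Prop :=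
  exists B : nat -> set T, (forall n, M (B n)) /\
    forall x U, nbhs x U -> exists n, B n x /\ B n `<=` U.

Lemma has_countable_base_prod (S T : topologicalType) (MS : set (set S))
    (MT : set (set T)) :
  has_countable_base MS -> has_countable_base MT ->
  has_countable_base [set A : set (S * T) |
    exists X Y, [/\ MS X, MT Y & A = X `*` Y]].
Proof.
move=> [B [MB hB]] [C [MC hC]].
pose d n := if unpickle n is Some (i, j) then (i, j) else (0, 0)%N.
exists (fun n => B (d n).1 `*` C (d n).2); split.
  by move=> n; exists (B (d n).1), (C (d n).2).
move=> [x y] U [[X Y] /= [xX yY] XYU].
have [i [Bix BiX]] := hB _ _ xX; have [j [Cjy CjY]] := hC _ _ yY.
exists (pickle (i, j)); rewrite /d pickleK /=; split=> //.
by move=> [a b] [/= /BiX ? /CjY ?]; apply: XYU.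
Qed.

Lemma sub_has_countable_base (T : topologicalType) (M N : set (set T)) :
  M `<=` N -> has_countable_base M -> has_countable_base N.
Proof. by move=> MN [B [MB hB]]; exists B; split=> // n; exact/MN/MB. Qed.

Lemma open_mem_countable_base (T : topologicalType) (M : set (set T)) U :
  has_countable_base M -> M set0 ->
  (forall F : nat -> set T, (forall n, M (F n)) -> M (\bigcup_n F n)) ->
  open U -> M U.
Proof.
move=> [B [MB hB]] M0 MU oU.
rewrite (_ : U = \bigcup_n (if `[< B n `<=` U >] then B n else set0)).
  by apply: MU => n; case: ifP.
apply/seteqP; split=> [x Ux|x [n _]].
  have [n [Bnx BnU]] := hB x U (open_nbhs_nbhs (conj oU Ux)).
  by exists n => //; case: asboolP.
case: asboolP => // BU; exact: BU.
Qed.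

(** Open intervals with rational endpoints. *)
Lemma real_has_countable_base (R : realType) :
  has_countable_base (measurable : set (set R)).
Proof.
pose d n : R * R := if unpickle n is Some (a, b)
  then (ratr (a : rat), ratr (b : rat)) else (0, 0).
exists (fun n => `](d n).1, (d n).2[%classic); split.
  by move=> n; exact: measurable_itv.
move=> x U /nbhs_ballP[e /= e0 xeU].
have [a] := @rat_in_itvoo R (x - e) x ltac:(by rewrite ltrBlDr ltrDl).
rewrite in_itv/= => /andP[a1 a2].
have [b] := @rat_in_itvoo R x (x + e) ltac:(by rewrite ltrDl).
rewrite in_itv/= => /andP[b1 b2].
exists (pickle (a, b)); rewrite /d pickleK /=; split; first by rewrite in_itv/= a2.
move=> y /=; rewrite in_itv/= => /andP[ya yb]; apply: xeU.
by rewrite /ball/= ltr_distlC; apply/andP; split; lra.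
Qed.

Lemma vec3_has_countable_base (R : realType) :
  has_countable_base (measurable : set (set (vec3 R))).
Proof.
have h1 := @real_has_countable_base R.
have h2 := has_countable_base_prod h1 h1.
have {}h2 : has_countable_base (measurable : set (set (R * R))).
  by apply: sub_has_countable_base h2 => A [X [Y [mX mY ->]]]; exact: measurableX.
have h3 := has_countable_base_prod h2 h1.
by apply: sub_has_countable_base h3 => A [X [Y [mX mY ->]]]; exact: measurableX.
Qed.

Lemma time_vec3_has_countable_base (R : realType) :
  has_countable_base (measurable : set (set (R * vec3 R))).
Proof.
have := has_countable_base_prod (@real_has_countable_base R)
  (@vec3_has_countable_base R).
by apply: sub_has_countable_base => A [X [Y [mX mY ->]]]; exact: measurableX.
Qed.

Lemma open_measurable_vec3 (R : realType) (U : set (vec3 R)) :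
  open U -> measurable U.
Proof.
apply: open_mem_countable_base (@vec3_has_countable_base R) _ _ => //.
by move=> F mF; exact: bigcupT_measurable.
Qed.

Lemma open_measurable_time_vec3 (R : realType) (U : set (R * vec3 R)) :
  open U -> measurable U.
Proof.
apply: open_mem_countable_base (@time_vec3_has_countable_base R) _ _ => //.
by move=> F mF; exact: bigcupT_measurable.
Qed.

(** Continuity at the points of D, for a function arbitrary elsewhere, makes
the preimage of an open set open only up to its trace on D. *)
Lemma preimage_interior (T S : topologicalType) (D : set T) (F : T -> S) V :
  (forall x, D x -> {for x, continuous F}) -> open V ->
  D `&` F @^-1` V = D `&` (F @^-1` V)^°.
Proof.
move=> cF oV; apply/seteqP; split=> x [Dx Fx]; split=> //.
  by apply: (cF x Dx); exact: open_nbhs_nbhs.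
exact: interior_subset Fx.
Qed.

Lemma continuous_measurable_vec3 (R : realType) (D : set (vec3 R))
    (F : vec3 R -> R) :
  measurable D -> (forall x, D x -> {for x, continuous F}) -> measurable_fun D F.
Proof.
move=> mD cF; apply: (measurability _ (measurable_realfun.RGenOpens.measurableE R)).
move=> _ [_ [a [b ->] <-]]; rewrite (preimage_interior cF); last exact: interval_open.
by apply: measurableI => //; apply: open_measurable_vec3; exact: open_interior.
Qed.

Lemma continuous_measurable_time_vec3 (R : realType) (D : set (R * vec3 R))
    (F : R * vec3 R -> R) :
  measurable D -> (forall x, D x -> {for x, continuous F}) -> measurable_fun D F.
Proof.
move=> mD cF; apply: (measurability _ (measurable_realfun.RGenOpens.measurableE R)).
move=> _ [_ [a [b ->] <-]]; rewrite (preimage_interior cF); last exact: interval_open.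
by apply: measurableI => //; apply: open_measurable_time_vec3; exact: open_interior.
Qed.

End CountableBase.

Lemma measurable_fun_pair_on d d1 d2 (S : measurableType d) (T1 : measurableType d1)
    (T2 : measurableType d2) (D : set S) (f : S -> T1) (g : S -> T2) :
  measurable_fun D f -> measurable_fun D g -> measurable_fun D (fun x => (f x, g x)).
Proof.
move=> mf mg mD.
apply: (@measurability _ _ S (T1 * T2)%type D (fun x => (f x, g x))
  (preimage_set_system [set: T1 * T2] fst measurable
    `|` preimage_set_system [set: T1 * T2] snd measurable)) => //.
move=> _ [_ [[A mA <-]|[A mA <-]] <-]; rewrite setTI; [exact: mf|exact: mg].
Qed.

Section SigmaFiniteProduct.
Context d1 d2 (T1 : measurableType d1) (T2 : measurableType d2) (R : realType).
Variables (m1 : {sigma_finite_measure set T1 -> \bar R})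
          (m2 : {sigma_finite_measure set T2 -> \bar R}).

Lemma product_measure_sigma_finite : sigma_finite setT (m1 \x m2)%E.
Proof.
have [F TF mF] := sigma_finiteT m1; have [G TG mG] := sigma_finiteT m2.
pose d n := if unpickle n is Some (i, j) then (i, j) else (0, 0)%N.
exists (fun n => F (d n).1 `*` G (d n).2); last first.
  move=> n; have [mF1 mF2] := mF (d n).1; have [mG1 mG2] := mG (d n).2.
  split; first exact: measurableX.
  by rewrite product_measure1E// lte_mul_pinfty// ge0_fin_numE.
rewrite eqEsubset; split=> // -[x y] _.
have [i _ Fx] : (\bigcup_i F i) x by rewrite -TF.
have [j _ Gy] : (\bigcup_i G i) y by rewrite -TG.
by exists (pickle (i, j)) => //; rewrite /d pickleK.
Qed.

End SigmaFiniteProduct.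

(** The plane Lebesgue measure with its sigma-finite structure, which
Fubini's theorem asks for when the three-dimensional measure is read as the
product of this measure with the line. *)
Definition leb2 (R : realType) :
    {sigma_finite_measure set (measurableTypeR R * measurableTypeR R)%type -> \bar R} :=
  HB.pack (@lebesgue_measure R \x @lebesgue_measure R)%E
    (Measure_isSigmaFinite.Build _ _ _ (@lebesgue_measure R \x @lebesgue_measure R)%E
      (product_measure_sigma_finite (@lebesgue_measure R) (@lebesgue_measure R))).

Section CylinderMeasure.
Context (R : realType).
Local Notation MV :=
  (measurableTypeR R * measurableTypeR R * measurableTypeR R)%type.

Lemma coord1_continuous (x : vec3 R) :
  {for x, continuous (fun y : vec3 R => y.1.1)}.
Proof. by apply: cvg_comp; [exact: cvg_fst|exact: cvg_fst]. Qed.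

Lemma coord2_continuous (x : vec3 R) :
  {for x, continuous (fun y : vec3 R => y.1.2)}.
Proof. by apply: cvg_comp; [exact: cvg_fst|exact: cvg_snd]. Qed.

Lemma coord3_continuous (x : vec3 R) :
  {for x, continuous (fun y : vec3 R => y.2)}.
Proof. exact: cvg_snd. Qed.

Lemma rad_le1 (x : vec3 R) : (rad x <= 1) = (x.1.1 ^+ 2 + x.1.2 ^+ 2 <= 1).
Proof.
by rewrite /rad -{1}sqrtr1 ler_sqrt.
Qed.

Lemma cylinder_closed : closed (@cylinder R).
Proof.
have -> : @cylinder R =
    [set x : vec3 R | x.1.1 ^+ 2 + x.1.2 ^+ 2 <= 1] `&`
    ([set x : vec3 R | 0 <= x.2] `&` [set x : vec3 R | x.2 <= 1]).
  by apply/seteqP; split=> x /=; rewrite /cylinder/= rad_le1 => -[?];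
    [move=> /andP[]|move=> [-> ->]].
apply: closedI; last apply: closedI.
- apply: (@closed_comp _ _ (fun x : vec3 R => x.1.1 ^+ 2 + x.1.2 ^+ 2) [set y | y <= 1]);
    last exact: closed_le.
  move=> x _; apply: cvgD; apply: (@cvg_comp _ _ _ _ (fun z : R => z ^+ 2));
    [exact: coord1_continuous|exact: exprn_continuous|
     exact: coord2_continuous|exact: exprn_continuous].
- apply: (@closed_comp _ _ (fun x : vec3 R => x.2) [set y | 0 <= y]);
    [by move=> x _; exact: coord3_continuous|exact: closed_ge].
- apply: (@closed_comp _ _ (fun x : vec3 R => x.2) [set y | y <= 1]);
    [by move=> x _; exact: coord3_continuous|exact: closed_le].
Qed.

Lemma cylinder_bounds (x : vec3 R) : cylinder x ->
  [/\ -1 <= x.1.1 <= 1, -1 <= x.1.2 <= 1 & 0 <= x.2 <= 1].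
Proof.
rewrite /cylinder/= rad_le1 => -[h ->]; split=> //; apply/andP; split; nra.
Qed.

Lemma cylinder_compact : compact (@cylinder R).
Proof.
apply: (@subclosed_compact _ _ (((`[-1, 1] : set R) `*` (`[-1, 1] : set R)) `*` (`[0, 1] : set R))).
- exact: cylinder_closed.
- by apply: compact_setX; [apply: compact_setX|]; exact: segment_compact.
- by move=> x /cylinder_bounds[h1 h2 h3]; split; [split|]; rewrite /= in_itv.
Qed.

Lemma measurable_cylinder : measurable (@cylinder R : set MV).
Proof.
rewrite -[X in measurable X]setCK; apply: measurableC.
by apply: open_measurable_vec3; apply: closed_openC; exact: cylinder_closed.
Qed.

Lemma leb3_box (a b c d e f : R) :
  leb3 R ((`]a, b[ `*` `]c, d[) `*` `]e, f[) =
  (lebesgue_measure `]a, b[ * lebesgue_measure `]c, d[ *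
    lebesgue_measure `]e, f[)%E.
Proof.
have m1 : measurable (`]a, b[ `*` `]c, d[ : set (measurableTypeR R * measurableTypeR R)).
  exact: measurableX.
have m2 : measurable (`]e, f[ : set (measurableTypeR R)) by [].
apply: (eq_trans (product_measure1E (@lebesgue_measure R \x @lebesgue_measure R)%E
  (@lebesgue_measure R) m1 m2)).
by congr (_ * _)%E; exact: product_measure1E.
Qed.

Lemma leb3_cylinder_lty : (leb3 R (@cylinder R) < +oo)%E.
Proof.
apply: (@le_lt_trans _ _ (leb3 R ((`]-2, 2[ `*` `]-2, 2[) `*` `]-1, 2[))).
  apply: le_measure; rewrite ?inE.
  - exact: measurable_cylinder.
  - by apply: measurableX => //; apply: measurableX.
  - move=> x /cylinder_bounds[h1 h2 h3]; split; [split|]; rewrite /= in_itv/=; lra.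
rewrite leb3_box !lebesgue_measure_itv/= !lte_fin.
by rewrite !ifT; [rewrite -!EFinD -!EFinM ltry|lra..].
Qed.

Lemma continuous_cylinder_bounded (F : vec3 R -> R) :
  (forall x, cylinder x -> {for x, continuous F}) ->
  exists2 M, 0 <= M & forall x, cylinder x -> `|F x| <= M.
Proof.
move=> cF.
have : bounded_set (F @` @cylinder R).
  apply: compact_bounded; apply: continuous_compact; last exact: cylinder_compact.
  by apply/subspace_continuousP => x Dx; apply: cvg_within_filter; exact: cF.
move=> [M [_ hM]]; exists (`|M| + 1); first by rewrite addr_ge0.
move=> x Dx; apply: hM; last by exists x.
by rewrite (le_lt_trans (ler_norm M))// ltrDl.
Qed.

Lemma continuous_integrable (F : vec3 R -> R) :
  (forall x, cylinder x -> {for x, continuous F}) ->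
  (leb3 R).-integrable (@cylinder R) (EFin \o F).
Proof.
move=> cF; have [M M0 hM] := continuous_cylinder_bounded cF.
apply: measurable_bounded_integrable; first exact: measurable_cylinder.
- exact: leb3_cylinder_lty.
- by apply: continuous_measurable_vec3 => //; exact: measurable_cylinder.
- exists M; split; first exact: num_real.
  by move=> y My x Dx; apply: (le_trans (hM _ Dx)); exact: ltW.
Qed.

End CylinderMeasure.

Section Boxes.
Context (R : realType).

Definition box (y : vec3 R) (d : R) : set (vec3 R) :=
  (`](y.1.1 - d), (y.1.1 + d)[ `*` `](y.1.2 - d), (y.1.2 + d)[) `*`
    `](y.2 - d), (y.2 + d)[.

Lemma measurable_box y d : measurable (box y d : set (vec3 R)).
Proof. by apply: measurableX => //; apply: measurableX. Qed.

Lemma leb3_box_gt0 y d : 0 < d -> (0 < leb3 R (box y d))%E.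
Proof.
move=> d0; rewrite /box leb3_box !lebesgue_measure_itv/= !lte_fin.
rewrite !ifT; [|lra..].
by rewrite -!EFinB -!EFinM lte_fin; rewrite !mulr_gt0//; lra.
Qed.

(** Every neighbourhood of a point of the cylinder, boundary points included,
meets the cylinder in a set of positive measure: pulling the point slightly
towards the centre (0, 0, 1/2) leaves room for a small box. *)
Lemma cylinder_box (x : vec3 R) (A : set (vec3 R)) :
  cylinder x -> nbhs x A ->
  exists y d, [/\ 0 < d, box y d `<=` @cylinder R & box y d `<=` A].
Proof.
move=> Dx /nbhs_ballP[e /= e0 xA].
have := cylinder_bounds Dx; case: Dx; rewrite rad_le1.
move: x xA => [[a b] c] /= xA ab1 _ [/andP[a1 a2] /andP[b1 b2] /andP[c1 c2]].
pose d := Num.min (1 / 2) (e / 3).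
have d0 : 0 < d by rewrite lt_min !divr_gt0.
have d2 : d <= 1 / 2 by rewrite ge_min lexx.
have d3 : d <= e / 3 by rewrite ge_min lexx orbT.
clearbody d.
(* The homothety of ratio 1 - d centred at (0, 0, 1/2). *)
exists ((1 - d) * a, (1 - d) * b, (1 - d) * c + d / 2), (d / 4); split.
- by rewrite divr_gt0.
- move=> [[z1 z2] z3] [[]] /=; rewrite !in_itv/= => /andP[h1 h2] /andP[h3 h4] /andP[h5 h6].
  split; last by apply/andP; split => /=; nra.
  rewrite rad_le1/=.
  pose p := z1 - (1 - d) * a; pose r := z2 - (1 - d) * b.
  have -> : z1 = (1 - d) * a + p by rewrite /p; ring.
  have -> : z2 = (1 - d) * b + r by rewrite /r; ring.
  have p1 : - (d / 4) < p by rewrite /p; lra.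
  have p2 : p < d / 4 by rewrite /p; lra.
  have r1 : - (d / 4) < r by rewrite /r; lra.
  have r2 : r < d / 4 by rewrite /r; lra.
  clearbody p r.
  have ap : a * p <= d / 4 by nra.
  have br : b * r <= d / 4 by nra.
  have pp : p ^+ 2 <= (d / 4) ^+ 2 by nra.
  have rr : r ^+ 2 <= (d / 4) ^+ 2 by nra.
  have h : (1 - d) * (a * p + b * r) <= (1 - d) * (d / 2).
    by apply: ler_wpM2l; lra.
  have h' : (1 - d) ^+ 2 * (a ^+ 2 + b ^+ 2) <= (1 - d) ^+ 2.
    by rewrite ler_piMr// sqr_ge0.
  nra.
- move=> [[z1 z2] z3] [[]] /=; rewrite !in_itv/= => /andP[h1 h2] /andP[h3 h4] /andP[h5 h6].
  apply: xA; split; [split|]; rewrite /ball/= ltr_distlC; apply/andP; split; nra.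
Qed.

(** At a point where F were positive, F would stay above half its value on
some box inside the cylinder, of positive measure by cylinder_box. *)
Lemma integral_cylinder_eq0 (F : vec3 R -> R) :
  (forall x, cylinder x -> {for x, continuous F}) ->
  (forall x, cylinder x -> 0 <= F x) ->
  \int[leb3 R]_(x in @cylinder R) F x = 0 ->
  forall x, cylinder x -> F x = 0.
Proof.
move=> cF F0 IF x Dx; apply/eqP; rewrite eq_le F0// andbT leNgt.
apply/negP => Fx0.
have nA : nbhs x [set y | F x / 2 < F y].
  by apply: (cvgr_gt (F x) (cF x Dx)); lra.
have [y [d [d0 BD BA]]] := cylinder_box Dx nA.
have iF := continuous_integrable cF.
have : (\int[leb3 R]_(z in @cylinder R) (F z)%:E = 0)%E.
  by rewrite -(fineK (integrable_fin_num (@measurable_cylinder R) iF)); congr (_%:E).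
apply/eqP; rewrite gt_eqF//.
apply: (@lt_le_trans _ _ (\int[leb3 R]_(z in box y d) (F x / 2)%:E)%E).
  rewrite integral_cst; last exact: measurable_box.
  by rewrite mule_gt0 ?leb3_box_gt0// lte_fin; lra.
have mF : measurable_fun (@cylinder R) F.
  by apply: continuous_measurable_vec3 => //; exact: measurable_cylinder.
apply: (@le_trans _ _ (\int[leb3 R]_(z in box y d) (F z)%:E)%E).
  apply: ge0_le_integral; first exact: measurable_box.
  - by move=> z _; rewrite lee_fin; lra.
  - exact: measurable_cst.
  - apply/measurable_EFinP; apply: measurable_funS mF => //.
    exact: measurable_cylinder.
  - by move=> z Bz; rewrite lee_fin ltW//; exact: BA.
apply: ge0_subset_integral.
- exact: measurable_box.
- exact: measurable_cylinder.
- exact/measurable_EFinP.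
- by move=> z Dz; rewrite lee_fin; exact: F0.
- exact: BD.
Qed.

End Boxes.

Section EssentialSupremum.
Context {R : realType}.

(** A continuous function exceeds any number below one of its values on a
set of positive measure, so the essential supremum dominates every value. *)
Lemma le_Lp_cylinder_oo (u : vec3 R -> vec3 R) x : cylinder x ->
  {for x, continuous (fun y => enorm (u y))} ->
  ((enorm (u x))%:E <= Lp_cylinder +oo u)%E.
Proof.
move=> Dx cu; apply/lee_addgt0Pr => d d0; rewrite leNgt; apply/negP => ltu.
have nA : nbhs x [set y | enorm (u x) - d < enorm (u y)].
  by apply: (cvgr_gt (enorm (u x)) cu); lra.
have [y [r [r0 BD BA]]] := cylinder_box Dx nA.
have mu0 := leb3_box_gt0 y r0.
have muT : (0 < leb3 R setT)%E.
  by apply: (lt_le_trans mu0); apply: le_measure; rewrite ?inE//; exact: measurable_box.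
have : (Lp_cylinder +oo u <= (enorm (u x) - d)%:E)%E.
  by rewrite EFinB leeBrDr//; exact: ltW.
rewrite /Lp_cylinder unlock /Lnorm muT => /ess_supP[N [mN N0 hN]].
have : (leb3 R (box y r) <= leb3 R N)%E.
  apply: le_measure; rewrite ?inE//; first exact: measurable_box.
  move=> z Bz; apply: hN => /=; rewrite patchE mem_set; last exact: BD.
  have := BA z Bz; rewrite /= lee_fin leNgt ger0_norm ?sqrtr_ge0// => ->; exact.
by rewrite N0 leNgt mu0.
Qed.

End EssentialSupremum.

(** * Integrals of derivatives along the chords of the cylinder *)

Section DirectionalIntegrals.
Context (R : realType).
Local Notation lam := (@lebesgue_measure R).
Local Notation MV :=
  (measurableTypeR R * measurableTypeR R * measurableTypeR R)%type.
Local Open Scope ereal_scope.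

Lemma integral_leb3_dir3 (f : MV -> \bar R) :
  (leb3 R).-integrable setT f ->
  (forall a b : R, \int[lam]_s f (a, b, s) = 0) -> \int[leb3 R]_x f x = 0.
Proof.
move=> intf h0.
rewrite -(@integral12_prod_meas1 _ _ _ _ R (leb2 R) lam f intf).
by rewrite integral0_eq// => -[a b] _; exact: h0.
Qed.

(** Fubini's theorem gives integrable slices for almost every c only, which is
why the hypothesis on the slice at c may assume integrability. *)
Lemma integral_leb3_plane (f : MV -> \bar R) :
  (leb3 R).-integrable setT f ->
  (forall c : R, (lam \x lam).-integrable setT (fun z => f (z, c)) ->
    \int[lam \x lam]_z f (z, c) = 0) ->
  \int[leb3 R]_x f x = 0.
Proof.
move=> intf h0.
have h := @integral21_prod_meas1 _ _ _ _ R (leb2 R) lam f intf.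
rewrite -[LHS]h; transitivity (\int[lam]_(c in setT) cst 0 c).
  have mG := @measurable_fubini_G _ _ _ _ R (leb2 R) lam f intf.
  have aeG := @ae_integrable2 _ _ _ _ R (leb2 R) lam f intf.
  apply: ae_eq_integral; [exact: measurableT|exact: mG|exact: measurable_cst|].
  by apply: filterS aeG => c hc _; exact: h0.
by rewrite integral0.
Qed.

Lemma integral_leb3_dir1 (f : MV -> \bar R) :
  (leb3 R).-integrable setT f ->
  (forall b c : R, \int[lam]_s f (s, b, c) = 0) -> \int[leb3 R]_x f x = 0.
Proof.
move=> intf h0; apply: (integral_leb3_plane intf) => c intc.
by rewrite -(integral21_prod_meas1 intc) integral0_eq// => b _; exact: h0.
Qed.

Lemma integral_leb3_dir2 (f : MV -> \bar R) :
  (leb3 R).-integrable setT f ->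
  (forall a c : R, \int[lam]_s f (a, s, c) = 0) -> \int[leb3 R]_x f x = 0.
Proof.
move=> intf h0; apply: (integral_leb3_plane intf) => c intc.
by rewrite -(integral12_prod_meas1 intc) integral0_eq// => b _; exact: h0.
Qed.

Local Close Scope ereal_scope.

Lemma chord_integral0 (G g : R -> R) (a b : R) :
  (forall s, a <= s <= b -> is_derive s 1 G (g s)) ->
  (forall s, a <= s <= b -> {for s, continuous g}) ->
  G a = 0 -> G b = 0 -> (\int[lam]_(s in `[a, b]) (g s)%:E = 0)%E.
Proof.
move=> dG cg Ga Gb; have [ab|ba|<-] := ltgtP a b.
- rewrite (@continuous_FTC2 _ g G a b)// ?Ga ?Gb ?subee//.
  + apply/subspace_continuousP => x /=; rewrite in_itv/= => xab.
    by apply: cvg_within_filter; exact: cg.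
  + split.
    * move=> x; rewrite in_itv/= => /andP[ax xb].
      have := dG x; rewrite !ltW// => /(_ isT) H; exact: ex_derive.
    * have := dG a; rewrite lexx ltW// => /(_ isT) [H _].
      by apply: cvg_at_right_filter; exact/differentiable_continuous/derivable1_diffP.
    * have := dG b; rewrite lexx ltW// => /(_ isT) [H _].
      by apply: cvg_at_left_filter; exact/differentiable_continuous/derivable1_diffP.
  + move=> x; rewrite in_itv/= => /andP[ax xb].
    have := dG x; rewrite !ltW// => /(_ isT) H.
    by rewrite derive1E derive_val.
- by rewrite set_itv_ge ?integral_set0// -leNgt bnd_simp.
- by rewrite set_itv1 integral_set1.
Qed.

(** The curve c meets D in the parameters [a, b]; extended by 0 outside D, the
derivative of G along c integrates to G b - G a = 0. *)
Lemma restrict_chord0 (D : set (vec3 R)) (F : vec3 R -> R) (c : R -> vec3 R)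
    (G : R -> R) (a b : R) :
  (forall s, D (c s) <-> a <= s <= b) ->
  (forall s, a <= s <= b -> is_derive s 1 G (F (c s))) ->
  (forall s, a <= s <= b -> {for s, continuous (F \o c)}) ->
  (a <= b -> G a = 0 /\ G b = 0) ->
  (\int[lam]_s (((EFin \o F) \_ D) (c s)) = 0)%E.
Proof.
move=> Dc dG cF G0.
rewrite (_ : (fun s => _) = (EFin \o (F \o c)) \_ `[a, b]).
  rewrite -integral_mkcond; have [ab|ba] := leP a b.
    by have [Ga Gb] := G0 ab; exact: (chord_integral0 dG).
  by rewrite set_itv_ge ?integral_set0// bnd_simp -ltNge.
apply/funext => s; rewrite /patch.
case: (boolP (s \in `[a, b]%classic)) => h.
  rewrite ifT//; apply/mem_set/Dc.
  by move: h; rewrite inE /= in_itv.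
rewrite ifF//; apply: contraNF h => h; rewrite inE/= in_itv/=.
by apply/Dc; move: h; rewrite inE.
Qed.

Lemma line_continuous1 (b c s : R) :
  {for s, continuous (fun s : R => (s, b, c) : vec3 R)}.
Proof.
have hs : id @ s --> s by exact: cvg_id.
have hb : (fun=> b : R) @ s --> b by exact: cvg_cst.
have hc : (fun=> c : R) @ s --> c by exact: cvg_cst.
exact: (cvg_pair (cvg_pair hs hb) hc).
Qed.

Lemma line_continuous2 (a c s : R) :
  {for s, continuous (fun s : R => (a, s, c) : vec3 R)}.
Proof.
have hs : id @ s --> s by exact: cvg_id.
have ha : (fun=> a : R) @ s --> a by exact: cvg_cst.
have hc : (fun=> c : R) @ s --> c by exact: cvg_cst.
exact: (cvg_pair (cvg_pair ha hs) hc).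
Qed.

Lemma line_continuous3 (a b s : R) :
  {for s, continuous (fun s : R => (a, b, s) : vec3 R)}.
Proof.
have hs : id @ s --> s by exact: cvg_id.
have ha : (fun=> a : R) @ s --> a by exact: cvg_cst.
have hb : (fun=> b : R) @ s --> b by exact: cvg_cst.
exact: (cvg_pair (cvg_pair ha hb) hs).
Qed.

Lemma cylinder_integrable_restrict (F : vec3 R -> R) :
  (forall x, cylinder x -> {for x, continuous F}) ->
  (leb3 R).-integrable setT ((EFin \o F) \_ (@cylinder R)).
Proof.
move=> cF; rewrite -integrable_mkcond; last exact: measurable_cylinder.
exact: continuous_integrable.
Qed.

Lemma sqr_le_sqrt (x y : R) : (x ^+ 2 <= y) = (y >= 0) && (- Num.sqrt y <= x <= Num.sqrt y).
Proof.
have [y0|y0] := leP 0 y; last by rewrite /=; apply/negbTE; rewrite -ltNge (lt_le_trans y0)// sqr_ge0.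
by rewrite /= -ler_norml -sqrtr_sqr ler_sqrt.
Qed.

(** The chords parallel to the third axis end on the horizontal faces, those
parallel to the other two axes, in the next two lemmas, on the lateral
surface; on each chord the integral of F is a difference of boundary values
of G. *)
Lemma divergence_dir3 (F G : vec3 R -> R) :
  (forall x, cylinder x -> {for x, continuous F}) ->
  (forall x, cylinder x -> is_derive x.2 1 (fun s => G (x.1, s)) (F x)) ->
  (forall x, horizontal_boundary x -> G x = 0) ->
  \int[leb3 R]_(x in @cylinder R) F x = 0.
Proof.
move=> cF dG G0; rewrite /Rintegral integral_mkcond integral_leb3_dir3//.
  exact: cylinder_integrable_restrict.
move=> a b.
have [ab1|ab1] := boolP (rad (a, b, 0 : R) <= 1); last first.
  rewrite integral0_eq// => s _; rewrite patchN// notin_setE => -[h _].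
  by move: ab1; rewrite h.
apply: (@restrict_chord0 _ _ _ (fun s => G (a, b, s)) 0 1).
- by move=> s; split=> [[]//|h]; split.
- by move=> s h; exact: (dG (a, b, s)).
- move=> s h; apply: continuous_comp; first exact: line_continuous3.
  exact: cF.
- by move=> _; split; apply: G0; split; rewrite //=; [left|right].
Qed.

Lemma divergence_dir1 (F G : vec3 R -> R) :
  (forall x, cylinder x -> {for x, continuous F}) ->
  (forall x, cylinder x -> is_derive x.1.1 1 (fun s => G (s, x.1.2, x.2)) (F x)) ->
  (forall x, vertical_boundary x -> G x = 0) ->
  \int[leb3 R]_(x in @cylinder R) F x = 0.
Proof.
move=> cF dG G0; rewrite /Rintegral integral_mkcond integral_leb3_dir1//.
  exact: cylinder_integrable_restrict.
move=> b c.
have [hc|hc] := boolP ((0 <= c <= 1) && (0 <= 1 - b ^+ 2)); last first.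
  rewrite integral0_eq// => s _; rewrite patchN// notin_setE => -[/= + h].
  rewrite rad_le1/= => h'; move/negP : hc; apply; rewrite h /=.
  by have := sqr_ge0 s; lra.
have {hc} [c01 b1] := andP hc.
apply: (@restrict_chord0 _ _ _ (fun s => G (s, b, c))
   (- Num.sqrt (1 - b ^+ 2)) (Num.sqrt (1 - b ^+ 2))).
- move=> s; rewrite /cylinder/= rad_le1/= c01 -lerBrDr sqr_le_sqrt b1 /=.
  by split=> [[]|].
- move=> s h; apply: (dG (s, b, c)).
  by split=> //; rewrite rad_le1/= -lerBrDr sqr_le_sqrt b1.
- move=> s h; apply: continuous_comp; first exact: line_continuous1.
  by apply: cF; split=> //; rewrite rad_le1/= -lerBrDr sqr_le_sqrt b1.
- by move=> _; split; apply: G0; split; rewrite //= /rad/= ?sqrrN sqr_sqrtr// subrK sqrtr1.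
Qed.

Lemma divergence_dir2 (F G : vec3 R -> R) :
  (forall x, cylinder x -> {for x, continuous F}) ->
  (forall x, cylinder x -> is_derive x.1.2 1 (fun s => G (x.1.1, s, x.2)) (F x)) ->
  (forall x, vertical_boundary x -> G x = 0) ->
  \int[leb3 R]_(x in @cylinder R) F x = 0.
Proof.
move=> cF dG G0; rewrite /Rintegral integral_mkcond integral_leb3_dir2//.
  exact: cylinder_integrable_restrict.
move=> a c.
have [hc|hc] := boolP ((0 <= c <= 1) && (0 <= 1 - a ^+ 2)); last first.
  rewrite integral0_eq// => s _; rewrite patchN// notin_setE => -[/= + h].
  rewrite rad_le1/= => h'; move/negP : hc; apply; rewrite h /=.
  by have := sqr_ge0 s; lra.
have {hc} [c01 b1] := andP hc.
apply: (@restrict_chord0 _ _ _ (fun s => G (a, s, c))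
   (- Num.sqrt (1 - a ^+ 2)) (Num.sqrt (1 - a ^+ 2))).
- move=> s; rewrite /cylinder/= rad_le1/= c01 -lerBrDl sqr_le_sqrt b1 /=.
  by split=> [[]|].
- move=> s h; apply: (dG (a, s, c)).
  by split=> //; rewrite rad_le1/= -lerBrDl sqr_le_sqrt b1.
- move=> s h; apply: continuous_comp; first exact: line_continuous2.
  by apply: cF; split=> //; rewrite rad_le1/= -lerBrDl sqr_le_sqrt b1.
- by move=> _; split; apply: G0; split; rewrite //= /rad/= ?sqrrN sqr_sqrtr// addrC subrK sqrtr1.
Qed.

End DirectionalIntegrals.

(** * Smooth functions and their slices *)

Section SmoothFunctions.
Context {R : realType}.

(** The expansion of f at x is also one of g; uniqueness of the differential
identifies its linear part. *)
Lemma near_eq_differentiable (V W : normedModType R) (f g : V -> W) (x : V) :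
  {near x, f =1 g} -> differentiable f x -> differentiable g x.
Proof.
move=> fg dfx; have [cdf edf] := (diff_locallyP x f).1 dfx.
have edg : g \o shift x = cst (g x) + 'd f x +o_ (0 : V) id.
  apply/eqaddoP => e e0; have /eqaddoP := edf.
  have sh : \forall h \near (0 : V), f (h + x) = g (h + x).
    by move: fg; rewrite (near_shift 0 x) subr0.
  move=> /(_ _ e0).
  apply: filterS2 sh => h /= fgh.
  by rewrite !fctE /= -fgh -(nbhs_singleton fg).
have dg := diff_unique cdf edg.
by apply/diff_locallyP; rewrite dg.
Qed.

(** A class of functions is smooth on an open set as soon as its members are
differentiable there and their directional derivatives stay, on that set, in
the class: by induction every iterated derivative agrees on the open set with
a member. *)
Lemma smooth_open_class (V W : normedModType R) (U : set V)
    (C : (V -> W) -> Prop) :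
  open U ->
  (forall g, C g -> forall x, U x -> differentiable g x) ->
  (forall g e, C g -> exists2 h, C h & forall x, U x -> 'D_e g x = h x) ->
  forall g, C g -> smooth_open U g.
Proof.
move=> oU Cdiff Cder g Cg.
have iter s : exists2 h, C h & forall x, U x -> iter_derive s g x = h x.
  elim: s => [|e s [h Ch hE]]; first by exists g.
  have [k Ck kE] := Cder h e Ch; exists k => // x Ux /=.
  rewrite -kE//; apply: near_eq_derive.
  by apply: filterS (open_nbhs_nbhs (conj oU Ux)) => y Uy; exact: hE.
move=> s x Ux; have [h Ch hE] := iter s.
apply: (@near_eq_differentiable _ _ h); last exact: Cdiff.
by apply: filterS (open_nbhs_nbhs (conj oU Ux)) => y Uy; rewrite hE.
Qed.

Lemma smooth_open_derive (V W : normedModType R) (U : set V) (g : V -> W) e :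
  smooth_open U g -> smooth_open U ('D_e g).
Proof.
move=> sg s x Ux; have := sg (rcons s e) x Ux.
by rewrite /iter_derive foldr_rcons.
Qed.

Lemma smooth_open_differentiable (V W : normedModType R) (U : set V)
    (g : V -> W) x :
  smooth_open U g -> U x -> differentiable g x.
Proof. by move=> /(_ [::]); apply. Qed.

Lemma smooth_openB (V W : normedModType R) (U : set V) (g h : V -> W) :
  open U -> smooth_open U g -> smooth_open U h ->
  smooth_open U (fun x => g x - h x).
Proof.
move=> oU sg sh.
apply: (@smooth_open_class _ _ U (fun k => exists g h,
  [/\ smooth_open U g, smooth_open U h & k = fun x => g x - h x])) => //.
- move=> _ [a [b [sa sb ->]]] x Ux.
  by apply: differentiableB; exact: smooth_open_differentiable Ux.
- move=> _ e [a [b [sa sb ->]]].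
  exists (fun x => 'D_e a x - 'D_e b x).
    by exists ('D_e a), ('D_e b); split=> //; exact: smooth_open_derive.
  move=> x Ux; apply: deriveB; apply: diff_derivable.
    exact: smooth_open_differentiable sa Ux.
  exact: smooth_open_differentiable sb Ux.
- by exists g, h.
Qed.

Lemma derive_linear_comp (V W X : normedModType R) (L : {linear W -> X})
    (g : V -> W) x e :
  continuous L -> derivable g x e ->
  derivable (L \o g) x e /\ 'D_e (L \o g) x = L ('D_e g x).
Proof.
move=> cL dg.
have h : (fun h : R => h^-1 *: ((L \o g) (h *: e + x) - (L \o g) x)) =
    L \o (fun h : R => h^-1 *: (g (h *: e + x) - g x)).
  by apply/funext => k /=; rewrite -linearB linearZ.
have cvL : (fun h : R => h^-1 *: ((L \o g) (h *: e + x) - (L \o g) x)) @ 0^' -->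
    L ('D_e g x).
  by rewrite h; apply: (@cvg_comp _ _ _ _ L _ _ _ dg); exact: cL.
split; first by apply/cvg_ex; exists (L ('D_e g x)).
exact/cvg_lim.
Qed.

Lemma smooth_open_linear_comp (V W X : normedModType R) (U : set V)
    (L : {linear W -> X}) (g : V -> W) :
  continuous L -> open U -> smooth_open U g -> smooth_open U (L \o g).
Proof.
move=> cL oU sg.
apply: (@smooth_open_class _ _ U (fun k => exists2 g,
  smooth_open U g & k = L \o g)) => //.
- move=> _ [a sa ->] x Ux; apply: differentiable_comp.
    exact: smooth_open_differentiable Ux.
  exact: linear_differentiable.
- move=> _ e [a sa ->]; exists (L \o 'D_e a).
    by exists ('D_e a) => //; exact: smooth_open_derive.
  move=> x Ux; apply: (derive_linear_comp _ _).2 => //.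
  exact/diff_derivable/(smooth_open_differentiable sa Ux).
- by exists g.
Qed.

Lemma is_derive_line (V W : normedModType R) (g : V -> W) (c : R -> V) (s : R) e :
  (forall h, c (h + s) = h *: e + c s) -> derivable g (c s) e ->
  is_derive s 1 (g \o c) ('D_e g (c s)).
Proof.
move=> ce dg.
have h : (fun h : R => h^-1 *: ((g \o c) (h *: 1 + s) - (g \o c) s)) =
    (fun h : R => h^-1 *: (g (h *: e + c s) - g (c s))).
  by apply/funext => k /=; rewrite -ce /GRing.scale/= mulr1.
by apply: DeriveDef; rewrite /derivable/derive h.
Qed.

End SmoothFunctions.

Section SmoothOn.
Context {R : realType}.

Lemma smooth_on_derive (V W : normedModType R) (A : set V) (g : V -> W) e :
  smooth_on A g -> smooth_on A ('D_e g).
Proof.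
by move=> [U [oU AU sg]]; exists U; split=> //; exact: smooth_open_derive.
Qed.

Lemma smooth_on_differentiable (V W : normedModType R) (A : set V)
    (g : V -> W) x :
  smooth_on A g -> A x -> differentiable g x.
Proof. by move=> [U [_ AU sg]] /AU; exact: smooth_open_differentiable. Qed.

Lemma smooth_on_continuous (V W : normedModType R) (A : set V)
    (g : V -> W) x :
  smooth_on A g -> A x -> {for x, continuous g}.
Proof.
move=> sg Ax; apply: differentiable_continuous.
exact: smooth_on_differentiable sg Ax.
Qed.

Lemma smooth_onB (V W : normedModType R) (A : set V) (g h : V -> W) :
  smooth_on A g -> smooth_on A h -> smooth_on A (fun x => g x - h x).
Proof.
move=> [U [oU AU sg]] [U' [oU' AU' sh]]; exists (U `&` U'); split.
- exact: openI.
- by move=> x Ax; split; [exact: AU|exact: AU'].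
- apply: smooth_openB; first exact: openI.
    by move=> s x [Ux _]; exact: sg.
  by move=> s x [_ Ux]; exact: sh.
Qed.

Lemma smooth_on_linear_comp (V W X : normedModType R) (A : set V)
    (L : {linear W -> X}) (g : V -> W) :
  continuous L -> smooth_on A g -> smooth_on A (L \o g).
Proof.
move=> cL [U [oU AU sg]]; exists U; split=> //.
exact: smooth_open_linear_comp.
Qed.

End SmoothOn.

Section ContinuityRules.
Context {R : realType} {X : topologicalType}.
Implicit Types (f g : X -> R) (x : X).

Lemma continuous_addf f g x : continuous_at x f -> continuous_at x g ->
  continuous_at x (fun y => f y + g y).
Proof. by move=> cf cg; exact: cvgD. Qed.

Lemma continuous_oppf f x : continuous_at x f ->
  continuous_at x (fun y => - f y).
Proof. by move=> cf; exact: cvgN. Qed.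

Lemma continuous_mulf f g x : continuous_at x f -> continuous_at x g ->
  continuous_at x (fun y => f y * g y).
Proof. by move=> cf cg; exact: cvgM. Qed.

Lemma continuous_sqrf f x : continuous_at x f ->
  continuous_at x (fun y => f y ^+ 2).
Proof. by move=> cf; exact: (continuous_mulf cf cf). Qed.

Lemma continuous_cstf (c : R) x : continuous_at x (fun=> c).
Proof. exact: cvg_cst. Qed.

End ContinuityRules.

Section SpacetimeSlices.
Context {R : realType} (T : R).
Local Notation S := (@spacetime R T).
Implicit Types (g : R * vec3 R -> R).

Local Notation dt := (derive^~ (((1 : R), (0 : vec3 R)) : R * vec3 R)).

Lemma continuous_slice (X : topologicalType) (g : R * vec3 R -> X) t (x : vec3 R) :
  {for (t, x), continuous g} -> {for x, continuous (fun y => g (t, y))}.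
Proof.
move=> cg.
have ht : (fun=> t : R) @ x --> t by exact: cvg_cst.
have hx : id @ x --> x by exact: cvg_id.
exact: cvg_comp (cvg_pair ht hx) cg.
Qed.

Lemma smooth_on_slice g t x : smooth_on S g -> S (t, x) ->
  {for x, continuous (fun y => g (t, y))}.
Proof. by move=> sg Stx; apply/continuous_slice/(smooth_on_continuous sg). Qed.

Lemma is_derive_time g t x : smooth_on S g -> S (t, x) ->
  is_derive t 1 (fun s => g (s, x)) ('D_((1 : R), (0 : vec3 R)) g (t, x)).
Proof.
move=> sg Stx.
apply: (@is_derive_line _ _ _ g (fun s => (s, x)) t ((1 : R), (0 : vec3 R))).
  move=> h; transitivity (h * 1 + t, h *: (0 : vec3 R) + x) => //.
  by rewrite mulr1 scaler0 add0r.
exact/diff_derivable/(smooth_on_differentiable sg).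
Qed.

Lemma is_derive_coord1 g t x : smooth_on S g -> S (t, x) ->
  is_derive x.1.1 1 (fun s => g (t, (s, x.1.2, x.2))) ('D_((0 : R), e1 R) g (t, x)).
Proof.
move: x => [[a b] c] /= sg Stx.
apply: (@is_derive_line _ _ _ g (fun s => (t, (s, b, c))) a ((0 : R), e1 R)).
  move=> h; transitivity (h * 0 + t, (h * 1 + a, h * 0 + b, h * 0 + c)) => //.
  by rewrite !mulr0 mulr1 !add0r.
exact/diff_derivable/(smooth_on_differentiable sg).
Qed.

Lemma is_derive_coord2 g t x : smooth_on S g -> S (t, x) ->
  is_derive x.1.2 1 (fun s => g (t, (x.1.1, s, x.2))) ('D_((0 : R), e2 R) g (t, x)).
Proof.
move: x => [[a b] c] /= sg Stx.
apply: (@is_derive_line _ _ _ g (fun s => (t, (a, s, c))) b ((0 : R), e2 R)).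
  move=> h; transitivity (h * 0 + t, (h * 0 + a, h * 1 + b, h * 0 + c)) => //.
  by rewrite !mulr0 mulr1 !add0r.
exact/diff_derivable/(smooth_on_differentiable sg).
Qed.

Lemma is_derive_coord3 g t x : smooth_on S g -> S (t, x) ->
  is_derive x.2 1 (fun s => g (t, (x.1, s))) ('D_((0 : R), e3 R) g (t, x)).
Proof.
move: x => [[a b] c] /= sg Stx.
apply: (@is_derive_line _ _ _ g (fun s => (t, (a, b, s))) c ((0 : R), e3 R)).
  move=> h; transitivity (h * 0 + t, (h * 0 + a, h * 0 + b, h * 1 + c)) => //.
  by rewrite !mulr0 mulr1 !add0r.
exact/diff_derivable/(smooth_on_differentiable sg).
Qed.

(** Compactness of [a, b] times the cylinder, which stays away from time T. *)
Lemma spacetime_bounded g a b : 0 <= a -> b < T ->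
  (forall z, S z -> {for z, continuous g}) ->
  exists2 M, 0 <= M &
    forall t x, a <= t <= b -> cylinder x -> `|g (t, x)| <= M.
Proof.
move=> a0 bT cg.
have cK : compact ((`[a, b] : set R) `*` @cylinder R).
  by apply: compact_setX; [exact: segment_compact|exact: cylinder_compact].
have : bounded_set (g @` ((`[a, b] : set R) `*` @cylinder R)).
  apply: compact_bounded; apply: continuous_compact cK.
  apply/subspace_continuousP => -[t x] [/=]; rewrite in_itv/= => /andP[t1 t2] Dx.
  apply: cvg_within_filter; apply: cg; split=> //=.
  by rewrite in_itv/= (le_trans a0)// (le_lt_trans t2).
move=> [M [_ hM]]; exists (`|M| + 1); first by rewrite addr_ge0.
move=> t x tab Dx; apply: hM.
  by rewrite (le_lt_trans (ler_norm M))// ltrDl.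
by exists (t, x) => //; split=> //=; rewrite in_itv.
Qed.

End SpacetimeSlices.

(** * The energy estimate *)

Section Gronwall.
Context {R : realType}.

(** E t e^(-K t) is nonincreasing. The bound E t <= M t makes this
product arbitrarily small near 0 and so stands for the initial condition. *)
Lemma gronwall_eq0 (E : R -> R) (K M b : R) :
  (forall t, 0 < t < b -> derivable E t 1) ->
  (forall t, 0 < t < b -> derive1 E t <= K * E t) ->
  (forall t, 0 < t < b -> 0 <= E t <= M * t) ->
  forall t, 0 < t < b -> E t = 0.
Proof.
move=> dE leE bE t tb; have /andP[t0 tb'] := tb.
pose G s := E s * expR (- K * s).
have dG s : 0 < s < b -> is_derive s 1 G (derive1 E s * expR (- K * s) - E s * (K * expR (- K * s))).
  move=> sb; have dEs : is_derive s 1 E (derive1 E s).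
    by rewrite derive1E; apply/derivableP/dE.
  by rewrite /G; apply: is_derive_eq; rewrite /GRing.scale/=; ring.
have Gdec s : 0 < s -> s < t -> G t <= G s.
  move=> s0 st.
  have sub x : s <= x <= t -> 0 < x < b by move=> /andP[? ?]; apply/andP; split; lra.
  apply: (@ler0_derive1_nincr _ G s t) => //; last 1 [idtac] || idtac.
  - move=> x; rewrite in_itv/= => /andP[sx xt].
    by have [] := dG x (sub x ltac:(by rewrite !ltW)).
  - move=> x; rewrite in_itv/= => /andP[sx xt].
    have xb := sub x ltac:(by rewrite !ltW).
    have dGx := dG x xb.
    rewrite derive1E derive_val.
    have := leE x xb; have := expR_gt0 (- K * x); nra.
  - apply/derivable_within_continuous => x; rewrite in_itv/= => /sub xb.
    by have [] := dG x xb.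
  - exact: ltW.
have Gt0 : G t <= 0.
  apply/ler_addgt0Pl => e e0; rewrite addr0.
  pose C := `|M| * expR (`|K| * b) + 1.
  have C0 : 0 < C by rewrite ltr_wpDl// mulr_ge0// expR_ge0.
  (* C is a Lipschitz constant at 0 of the bound on G. *)
  pose s := Num.min (t / 2) (e / C).
  have s0 : 0 < s by rewrite lt_min !divr_gt0.
  have st : s < t by rewrite gt_min; apply/orP; left; lra.
  have sb : 0 < s < b by rewrite s0 /= (lt_trans st).
  apply: (le_trans (Gdec s s0 st)).
  have /andP[Es0 EsM] := bE s sb.
  have se : s * C <= e by rewrite -ler_pdivlMr// ge_min lexx orbT.
  apply: le_trans se; rewrite /G.
  have h1 : E s <= `|M| * s.
    by apply: (le_trans EsM); apply: ler_wpM2r; [exact: ltW|exact: ler_norm].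
  have h2 : expR (- K * s) <= expR (`|K| * b).
    rewrite ler_expR; apply: (@le_trans _ _ (`|K| * s)).
      by apply: ler_wpM2r; [exact: ltW|rewrite -normrN; exact: ler_norm].
    by rewrite ler_wpM2l// ltW//; move/andP: sb => [].
  apply: (@le_trans _ _ (`|M| * s * expR (`|K| * b))).
    by apply: ler_pM => //; exact: expR_ge0.
  by rewrite /C; nra.
apply/eqP; rewrite eq_le; have /andP[-> _] := bE t tb; rewrite andbT.
by move: Gt0; rewrite /G pmulr_lle0// expR_gt0.
Qed.

End Gronwall.

Ltac prove_smooth := repeat apply: smooth_on_derive; assumption.

(** Continuity of polynomial expressions in smooth functions on spacetime and
their derivatives, in space at a fixed time or jointly, at a point that a
hypothesis places in spacetime. *)
Ltac prove_continuous_at := cbv beta; lazymatch goal with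
  | |- continuous_at _ (fun y => @GRing.add _ _ _) =>
      refine (continuous_addf _ _); prove_continuous_at
  | |- continuous_at _ (fun y => @GRing.opp _ _) =>
      refine (continuous_oppf _); prove_continuous_at
  | |- continuous_at _ (fun y => @GRing.exp _ _ 2%N) =>
      refine (continuous_sqrf _); prove_continuous_at
  | |- continuous_at _ (fun y => @GRing.mul _ _ _) =>
      refine (continuous_mulf _ _); prove_continuous_at
  | |- continuous_at _ (fun y => @GRing.inv _ _) =>
      refine (@continuous_cstf _ _ _ _)
  | |- continuous_at _ (fun y => _ *+ _) =>
      refine (@continuous_cstf _ _ _ _)
  | H : @spacetime _ ?T _ |- continuous_at _ (fun y => @derive _ _ _ ?f (@?p y) ?e) =>
      first [ refine (@smooth_on_slice _ T (fun z => derive f z e) _ _ _ H)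
            | refine (@smooth_on_continuous _ _ _ _ (fun z => derive f z e) _ _ H) ];
      prove_smooth
  | H : @spacetime _ ?T _ |- continuous_at _ (fun y => ?f (@?p y)) =>
      refine (@smooth_on_slice _ T f _ _ _ H); prove_smooth
  | H : @spacetime _ ?T _ |- continuous_at _ ?f =>
      refine (@smooth_on_continuous _ _ _ _ f _ _ H); prove_smooth
  end.

Ltac prove_continuous :=
  match goal with |- {for ?x, continuous ?f} => change (continuous_at x f) end;
  prove_continuous_at.

Section Energy.
Context {R : realType} (T : R).
Local Notation S := (@spacetime R T).

Local Notation dt g := ('D_((1 : R), (0 : vec3 R)) g).
Local Notation d1 g := ('D_((0 : R), e1 R) g).
Local Notation d2 g := ('D_((0 : R), e2 R) g).
Local Notation d3 g := ('D_((0 : R), e3 R) g).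

(** Derivative along one axis of the energy flux in that direction. The letters
a, b are a component of w and its derivative, m and c the components of u and
w along the axis, q the pressure. *)
Lemma flux_is_derive (a1 a2 a3 b1 b2 b3 m q c : R -> R) (s A1 A2 A3 M Q C : R) :
  is_derive s 1 a1 (b1 s) -> is_derive s 1 a2 (b2 s) ->
  is_derive s 1 a3 (b3 s) ->
  is_derive s 1 b1 A1 -> is_derive s 1 b2 A2 -> is_derive s 1 b3 A3 ->
  is_derive s 1 m M -> is_derive s 1 q Q -> is_derive s 1 c C ->
  is_derive s 1 (fun s => a1 s * b1 s + a2 s * b2 s + a3 s * b3 s
      - m s * ((a1 s * a1 s + a2 s * a2 s + a3 s * a3 s) / 2) - q s * c s)
    (b1 s ^+ 2 + b2 s ^+ 2 + b3 s ^+ 2 + a1 s * A1 + a2 s * A2 + a3 s * A3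
      - M * ((a1 s ^+ 2 + a2 s ^+ 2 + a3 s ^+ 2) / 2)
      - m s * (a1 s * b1 s + a2 s * b2 s + a3 s * b3 s) - Q * c s - q s * C).
Proof.
move=> ? ? ? ? ? ? ? ? ?.
by apply: is_derive_eq; rewrite /GRing.scale/=; field.
Qed.

Lemma add3_eq0 (a b c : R) : a + b + c = 0 -> c = - a - b.
Proof. by lra. Qed.

(** The energy identity at one point, as an identity between numbers. The
letters stand for: p_i = w_i, m_i = u_i, q = pi, g_ij = d_j w_i,
h_ij = d_j d_j w_i, k_ij = d_j v_i, n_j = d_j u_j, q_j = d_j pi, z_i = d_t w_i.
Removing the derivatives of the three fluxes from w . d_t w leaves the
stretching of w by grad v and the dissipation - |grad w|^2. *)
Lemma energy_balance (p1 p2 p3 g11 g12 g13 g21 g22 g23 g31 g32 g33 h11 h12 h13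
    h21 h22 h23 h31 h32 h33 k11 k12 k13 k21 k22 k23 k31 k32 k33 m1 m2 m3
    n1 n2 n3 q q1 q2 q3 z1 z2 z3 : R) :
  z1 = h11 + h12 + h13 - (m1 * g11 + m2 * g12 + m3 * g13)
    - (p1 * k11 + p2 * k12 + p3 * k13) - q1 ->
  z2 = h21 + h22 + h23 - (m1 * g21 + m2 * g22 + m3 * g23)
    - (p1 * k21 + p2 * k22 + p3 * k23) - q2 ->
  z3 = h31 + h32 + h33 - (m1 * g31 + m2 * g32 + m3 * g33)
    - (p1 * k31 + p2 * k32 + p3 * k33) - q3 ->
  n1 + n2 + n3 = 0 -> g11 + g22 + g33 = 0 ->
  p1 * z1 + p2 * z2 + p3 * z3
  - (g11 ^+ 2 + g21 ^+ 2 + g31 ^+ 2 + p1 * h11 + p2 * h21 + p3 * h31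
    - n1 * ((p1 ^+ 2 + p2 ^+ 2 + p3 ^+ 2) / 2)
    - m1 * (p1 * g11 + p2 * g21 + p3 * g31) - q1 * p1 - q * g11)
  - (g12 ^+ 2 + g22 ^+ 2 + g32 ^+ 2 + p1 * h12 + p2 * h22 + p3 * h32
    - n2 * ((p1 ^+ 2 + p2 ^+ 2 + p3 ^+ 2) / 2)
    - m2 * (p1 * g12 + p2 * g22 + p3 * g32) - q2 * p2 - q * g22)
  - (g13 ^+ 2 + g23 ^+ 2 + g33 ^+ 2 + p1 * h13 + p2 * h23 + p3 * h33
    - n3 * ((p1 ^+ 2 + p2 ^+ 2 + p3 ^+ 2) / 2)
    - m3 * (p1 * g13 + p2 * g23 + p3 * g33) - q3 * p3 - q * g33) =
  - (p1 * p1 * k11) - (p1 * p2 * k12) - (p1 * p3 * k13)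
  - (p2 * p1 * k21) - (p2 * p2 * k22) - (p2 * p3 * k23)
  - (p3 * p1 * k31) - (p3 * p2 * k32) - (p3 * p3 * k33)
  - (g11 ^+ 2 + g21 ^+ 2 + g31 ^+ 2 + g12 ^+ 2 + g22 ^+ 2 + g32 ^+ 2
     + g13 ^+ 2 + g23 ^+ 2 + g33 ^+ 2).
Proof.
move=> -> -> -> /add3_eq0 -> /add3_eq0 ->.
by field.
Qed.

(** Young's inequality with a weight: (M - k) (p - r)^2 + (M + k) (p + r)^2 is
nonnegative. *)
Lemma mul3_le (M p r k : R) : `|k| <= M -> - (p * r * k) <= M * ((p * p + r * r) / 2).
Proof.
rewrite ler_norml => /andP[k1 k2].
have h1 : 0 <= (M - k) * (p - r) ^+ 2 by rewrite mulr_ge0 ?sqr_ge0 ?subr_ge0.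
have h2 : 0 <= (M + k) * (p + r) ^+ 2.
  by rewrite mulr_ge0 ?sqr_ge0// addrC -[M]opprK subr_ge0.
have h3 : M * ((p * p + r * r) / 2) + p * r * k =
    ((M - k) * (p - r) ^+ 2 + (M + k) * (p + r) ^+ 2) / 4 by field.
by rewrite -subr_ge0 opprK h3 divr_ge0// addr_ge0.
Qed.

Lemma stretching_le (p1 p2 p3 k11 k12 k13 k21 k22 k23 k31 k32 k33
    M11 M12 M13 M21 M22 M23 M31 M32 M33 : R) :
  `|k11| <= M11 -> `|k12| <= M12 -> `|k13| <= M13 ->
  `|k21| <= M21 -> `|k22| <= M22 -> `|k23| <= M23 ->
  `|k31| <= M31 -> `|k32| <= M32 -> `|k33| <= M33 ->
  - (p1 * p1 * k11) - p1 * p2 * k12 - p1 * p3 * k13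
  - p2 * p1 * k21 - p2 * p2 * k22 - p2 * p3 * k23
  - p3 * p1 * k31 - p3 * p2 * k32 - p3 * p3 * k33
  <= (M11 + M12 + M13 + M21 + M22 + M23 + M31 + M32 + M33)
     * (p1 * p1 + p2 * p2 + p3 * p3).
Proof.
move=> h11 h12 h13 h21 h22 h23 h31 h32 h33.
have wide (M k p r : R) : `|k| <= M -> p * p + r * r <= 2 * (p1 * p1 + p2 * p2 + p3 * p3) ->
    - (p * r * k) <= M * (p1 * p1 + p2 * p2 + p3 * p3).
  move=> kM h; apply: (le_trans (mul3_le p r kM)); apply: ler_wpM2l.
    exact: le_trans (normr_ge0 k) kM.
  by rewrite ler_pdivrMr// [leRHS]mulrC.
have n1 : 0 <= p1 * p1 by rewrite -expr2 sqr_ge0.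
have n2 : 0 <= p2 * p2 by rewrite -expr2 sqr_ge0.
have n3 : 0 <= p3 * p3 by rewrite -expr2 sqr_ge0.
rewrite !mulrDl; repeat apply: lerD; apply: wide => //.
all: rewrite mulr_natl mulr2n; lra.
Qed.

Variables (u1 u2 u3 v1 v2 v3 w1 w2 w3 pi : R * vec3 R -> R).
Hypotheses (su1 : smooth_on S u1) (su2 : smooth_on S u2) (su3 : smooth_on S u3).
Hypotheses (sv1 : smooth_on S v1) (sv2 : smooth_on S v2) (sv3 : smooth_on S v3).
Hypotheses (sw1 : smooth_on S w1) (sw2 : smooth_on S w2) (sw3 : smooth_on S w3).
Hypothesis spi : smooth_on S pi.

Hypothesis eq1 : forall z, S z ->
  dt w1 z = d1 (d1 w1) z + d2 (d2 w1) z + d3 (d3 w1) z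
    - (u1 z * d1 w1 z + u2 z * d2 w1 z + u3 z * d3 w1 z)
    - (w1 z * d1 v1 z + w2 z * d2 v1 z + w3 z * d3 v1 z) - d1 pi z.
Hypothesis eq2 : forall z, S z ->
  dt w2 z = d1 (d1 w2) z + d2 (d2 w2) z + d3 (d3 w2) z
    - (u1 z * d1 w2 z + u2 z * d2 w2 z + u3 z * d3 w2 z)
    - (w1 z * d1 v2 z + w2 z * d2 v2 z + w3 z * d3 v2 z) - d2 pi z.
Hypothesis eq3 : forall z, S z ->
  dt w3 z = d1 (d1 w3) z + d2 (d2 w3) z + d3 (d3 w3) z
    - (u1 z * d1 w3 z + u2 z * d2 w3 z + u3 z * d3 w3 z)
    - (w1 z * d1 v3 z + w2 z * d2 v3 z + w3 z * d3 v3 z) - d3 pi z.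
Hypothesis divu : forall z, S z -> d1 u1 z + d2 u2 z + d3 u3 z = 0.
Hypothesis divw : forall z, S z -> d1 w1 z + d2 w2 z + d3 w3 z = 0.
Hypothesis noslip : forall t x, 0 <= t < T -> vertical_boundary x ->
  [/\ w1 (t, x) = 0, w2 (t, x) = 0 & w3 (t, x) = 0].
Hypothesis slip : forall t x, 0 <= t < T -> horizontal_boundary x ->
  [/\ u3 (t, x) = 0, w3 (t, x) = 0, d3 w1 (t, x) = 0 & d3 w2 (t, x) = 0].
Hypothesis init : forall x, cylinder x ->
  [/\ w1 (0, x) = 0, w2 (0, x) = 0 & w3 (0, x) = 0].

Let nrm2 z := w1 z * w1 z + w2 z * w2 z + w3 z * w3 z.
Let power z := w1 z * dt w1 z + w2 z * dt w2 z + w3 z * dt w3 z.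

Let F1 z := w1 z * d1 w1 z + w2 z * d1 w2 z + w3 z * d1 w3 z
  - u1 z * ((w1 z * w1 z + w2 z * w2 z + w3 z * w3 z) / 2) - pi z * w1 z.
Let F2 z := w1 z * d2 w1 z + w2 z * d2 w2 z + w3 z * d2 w3 z
  - u2 z * ((w1 z * w1 z + w2 z * w2 z + w3 z * w3 z) / 2) - pi z * w2 z.
Let F3 z := w1 z * d3 w1 z + w2 z * d3 w2 z + w3 z * d3 w3 z
  - u3 z * ((w1 z * w1 z + w2 z * w2 z + w3 z * w3 z) / 2) - pi z * w3 z.

Let DF1 z := d1 w1 z ^+ 2 + d1 w2 z ^+ 2 + d1 w3 z ^+ 2
  + w1 z * d1 (d1 w1) z + w2 z * d1 (d1 w2) z + w3 z * d1 (d1 w3) z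
  - d1 u1 z * ((w1 z ^+ 2 + w2 z ^+ 2 + w3 z ^+ 2) / 2)
  - u1 z * (w1 z * d1 w1 z + w2 z * d1 w2 z + w3 z * d1 w3 z)
  - d1 pi z * w1 z - pi z * d1 w1 z.
Let DF2 z := d2 w1 z ^+ 2 + d2 w2 z ^+ 2 + d2 w3 z ^+ 2
  + w1 z * d2 (d2 w1) z + w2 z * d2 (d2 w2) z + w3 z * d2 (d2 w3) z
  - d2 u2 z * ((w1 z ^+ 2 + w2 z ^+ 2 + w3 z ^+ 2) / 2)
  - u2 z * (w1 z * d2 w1 z + w2 z * d2 w2 z + w3 z * d2 w3 z)
  - d2 pi z * w2 z - pi z * d2 w2 z.
Let DF3 z := d3 w1 z ^+ 2 + d3 w2 z ^+ 2 + d3 w3 z ^+ 2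
  + w1 z * d3 (d3 w1) z + w2 z * d3 (d3 w2) z + w3 z * d3 (d3 w3) z
  - d3 u3 z * ((w1 z ^+ 2 + w2 z ^+ 2 + w3 z ^+ 2) / 2)
  - u3 z * (w1 z * d3 w1 z + w2 z * d3 w2 z + w3 z * d3 w3 z)
  - d3 pi z * w3 z - pi z * d3 w3 z.

Let spacetimeP t x : S (t, x) <-> 0 <= t < T /\ cylinder x.
Proof. by rewrite /spacetime/=; split=> -[]; rewrite in_itv. Qed.

Let cDF1 t x : S (t, x) -> {for x, continuous (fun y => DF1 (t, y))}.
Proof. move=> Stx; rewrite /DF1; prove_continuous. Qed.

Let cDF2 t x : S (t, x) -> {for x, continuous (fun y => DF2 (t, y))}.
Proof. move=> Stx; rewrite /DF2; prove_continuous. Qed.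

Let cDF3 t x : S (t, x) -> {for x, continuous (fun y => DF3 (t, y))}.
Proof. move=> Stx; rewrite /DF3; prove_continuous. Qed.

Let cpower t x : S (t, x) -> {for x, continuous (fun y => power (t, y))}.
Proof. move=> Stx; rewrite /power; prove_continuous. Qed.

Let cpower_time z : S z -> {for z, continuous (fun y => power y)}.
Proof. move=> Sz; rewrite /power; prove_continuous. Qed.

Let cnrm2 t x : S (t, x) -> {for x, continuous (fun y => nrm2 (t, y))}.
Proof. move=> Stx; rewrite /nrm2; prove_continuous. Qed.

Let int_DF1 t : 0 <= t < T -> \int[leb3 R]_(x in @cylinder R) DF1 (t, x) = 0.
Proof.
move=> tT; apply: (@divergence_dir1 _ _ (fun x => F1 (t, x))).
- by move=> x Dx; apply: cDF1; apply/spacetimeP.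
- move=> x Dx; have Stx : S (t, x) by apply/spacetimeP.
  have := @flux_is_derive (fun s => w1 (t, (s, x.1.2, x.2)))
    (fun s => w2 (t, (s, x.1.2, x.2))) (fun s => w3 (t, (s, x.1.2, x.2)))
    (fun s => d1 w1 (t, (s, x.1.2, x.2))) (fun s => d1 w2 (t, (s, x.1.2, x.2)))
    (fun s => d1 w3 (t, (s, x.1.2, x.2)))
    (fun s => u1 (t, (s, x.1.2, x.2))) (fun s => pi (t, (s, x.1.2, x.2)))
    (fun s => w1 (t, (s, x.1.2, x.2))) x.1.1
    (d1 (d1 w1) (t, x)) (d1 (d1 w2) (t, x)) (d1 (d1 w3) (t, x))
    (d1 u1 (t, x)) (d1 pi (t, x)) (d1 w1 (t, x)).
  rewrite -!surjective_pairing; apply; apply: (@is_derive_coord1 _ T) => //.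
  + exact: smooth_on_derive.
  + exact: smooth_on_derive.
  + exact: smooth_on_derive.
- move=> x /(noslip tT)[h1 h2 h3].
  by rewrite /F1 h1 h2 h3; ring.
Qed.

Let int_DF2 t : 0 <= t < T -> \int[leb3 R]_(x in @cylinder R) DF2 (t, x) = 0.
Proof.
move=> tT; apply: (@divergence_dir2 _ _ (fun x => F2 (t, x))).
- by move=> x Dx; apply: cDF2; apply/spacetimeP.
- move=> x Dx; have Stx : S (t, x) by apply/spacetimeP.
  have := @flux_is_derive (fun s => w1 (t, (x.1.1, s, x.2)))
    (fun s => w2 (t, (x.1.1, s, x.2))) (fun s => w3 (t, (x.1.1, s, x.2)))
    (fun s => d2 w1 (t, (x.1.1, s, x.2))) (fun s => d2 w2 (t, (x.1.1, s, x.2)))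
    (fun s => d2 w3 (t, (x.1.1, s, x.2)))
    (fun s => u2 (t, (x.1.1, s, x.2))) (fun s => pi (t, (x.1.1, s, x.2)))
    (fun s => w2 (t, (x.1.1, s, x.2))) x.1.2
    (d2 (d2 w1) (t, x)) (d2 (d2 w2) (t, x)) (d2 (d2 w3) (t, x))
    (d2 u2 (t, x)) (d2 pi (t, x)) (d2 w2 (t, x)).
  rewrite -!surjective_pairing; apply; apply: (@is_derive_coord2 _ T) => //.
  + exact: smooth_on_derive.
  + exact: smooth_on_derive.
  + exact: smooth_on_derive.
- move=> x /(noslip tT)[h1 h2 h3].
  by rewrite /F2 h1 h2 h3; ring.
Qed.

Let int_DF3 t : 0 <= t < T -> \int[leb3 R]_(x in @cylinder R) DF3 (t, x) = 0.
Proof.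
move=> tT; apply: (@divergence_dir3 _ _ (fun x => F3 (t, x))).
- by move=> x Dx; apply: cDF3; apply/spacetimeP.
- move=> x Dx; have Stx : S (t, x) by apply/spacetimeP.
  have := @flux_is_derive (fun s => w1 (t, (x.1, s)))
    (fun s => w2 (t, (x.1, s))) (fun s => w3 (t, (x.1, s)))
    (fun s => d3 w1 (t, (x.1, s))) (fun s => d3 w2 (t, (x.1, s)))
    (fun s => d3 w3 (t, (x.1, s)))
    (fun s => u3 (t, (x.1, s))) (fun s => pi (t, (x.1, s)))
    (fun s => w3 (t, (x.1, s))) x.2
    (d3 (d3 w1) (t, x)) (d3 (d3 w2) (t, x)) (d3 (d3 w3) (t, x))
    (d3 u3 (t, x)) (d3 pi (t, x)) (d3 w3 (t, x)).
  rewrite -!surjective_pairing; apply; apply: (@is_derive_coord3 _ T) => //.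
  + exact: smooth_on_derive.
  + exact: smooth_on_derive.
  + exact: smooth_on_derive.
- move=> x /(slip tT)[h1 h2 h3 h4].
  by rewrite /F3 h1 h2 h3 h4; ring.
Qed.

(** On [0, b] with b < T the derivatives of v are bounded, hence so is the
stretching term relative to |w|^2; the dissipation has the right sign. *)
Let power_le b : b < T -> exists K, forall t x, 0 <= t <= b -> cylinder x ->
  power (t, x) - DF1 (t, x) - DF2 (t, x) - DF3 (t, x) <= K * nrm2 (t, x).
Proof.
move=> bT.
have bnd (g : R * vec3 R -> R) : smooth_on S g -> exists2 M : R, 0 <= M &
    forall (t : R) (x : vec3 R), 0 <= t <= b -> cylinder x -> `|g (t, x)| <= M.
  move=> sg; apply: (@spacetime_bounded _ T g 0 b (lexx 0) bT) => z Sz.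
  exact: smooth_on_continuous sg Sz.
have [M11 P11 h11] := bnd (d1 v1) ltac:(by apply: smooth_on_derive).
have [M12 P12 h12] := bnd (d2 v1) ltac:(by apply: smooth_on_derive).
have [M13 P13 h13] := bnd (d3 v1) ltac:(by apply: smooth_on_derive).
have [M21 P21 h21] := bnd (d1 v2) ltac:(by apply: smooth_on_derive).
have [M22 P22 h22] := bnd (d2 v2) ltac:(by apply: smooth_on_derive).
have [M23 P23 h23] := bnd (d3 v2) ltac:(by apply: smooth_on_derive).
have [M31 P31 h31] := bnd (d1 v3) ltac:(by apply: smooth_on_derive).
have [M32 P32 h32] := bnd (d2 v3) ltac:(by apply: smooth_on_derive).
have [M33 P33 h33] := bnd (d3 v3) ltac:(by apply: smooth_on_derive).
exists (M11 + M12 + M13 + M21 + M22 + M23 + M31 + M32 + M33) => t x tb Dx.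
have Stx : S (t, x).
  by apply/spacetimeP; split=> //; move/andP: tb => [-> /le_lt_trans]; exact.
rewrite /nrm2.
rewrite [leLHS](energy_balance (pi (t, x)) (eq1 Stx) (eq2 Stx) (eq3 Stx) (divu Stx) (divw Stx)).
rewrite lerBlDr; apply: ler_wpDr.
  by rewrite !addr_ge0// sqr_ge0.
exact: (stretching_le (w1 (t, x)) (w2 (t, x)) (w3 (t, x)) (h11 _ _ tb Dx) (h12 _ _ tb Dx) (h13 _ _ tb Dx)
  (h21 _ _ tb Dx) (h22 _ _ tb Dx) (h23 _ _ tb Dx)
  (h31 _ _ tb Dx) (h32 _ _ tb Dx) (h33 _ _ tb Dx)).
Qed.

Let energy t := \int[leb3 R]_(x in @cylinder R) nrm2 (t, x).

(** The three fluxes integrate to zero, by no slip for the first two and by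
total slip for the third. *)
Let int_power_le b : b < T -> exists K, forall t, 0 <= t <= b ->
  \int[leb3 R]_(x in @cylinder R) power (t, x) <= K * energy t.
Proof.
move=> bT; have [K hK] := power_le bT; exists K => t tb.
have tT : 0 <= t < T by move/andP: tb => [-> /le_lt_trans]; exact.
have St x : cylinder x -> S (t, x) by move=> Dx; apply/spacetimeP.
have mD := @measurable_cylinder R.
have iP := continuous_integrable (fun x Dx => cpower (St x Dx)).
have i1 := continuous_integrable (fun x Dx => cDF1 (St x Dx)).
have i2 := continuous_integrable (fun x Dx => cDF2 (St x Dx)).
have i3 := continuous_integrable (fun x Dx => cDF3 (St x Dx)).
have iN := continuous_integrable (fun x Dx => cnrm2 (St x Dx)).
have iP1 : (leb3 R).-integrable (@cylinder R)
    (EFin \o (fun x => power (t, x) - DF1 (t, x))).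
  by apply: continuous_integrable => x /St Sx; apply: continuous_addf;
    [exact: cpower|apply: continuous_oppf; exact: cDF1].
have iP2 : (leb3 R).-integrable (@cylinder R)
    (EFin \o (fun x => power (t, x) - DF1 (t, x) - DF2 (t, x))).
  apply: continuous_integrable => x /St Sx; apply: continuous_addf;
    [apply: continuous_addf; [exact: cpower|apply: continuous_oppf; exact: cDF1]
    |apply: continuous_oppf; exact: cDF2].
have iP3 : (leb3 R).-integrable (@cylinder R)
    (EFin \o (fun x => power (t, x) - DF1 (t, x) - DF2 (t, x) - DF3 (t, x))).
  apply: continuous_integrable => x /St Sx; apply: continuous_addf; last first.
    by apply: continuous_oppf; exact: cDF3.
  apply: continuous_addf;
    [apply: continuous_addf; [exact: cpower|apply: continuous_oppf; exact: cDF1]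
    |apply: continuous_oppf; exact: cDF2].
have -> : \int[leb3 R]_(x in @cylinder R) power (t, x) =
    \int[leb3 R]_(x in @cylinder R)
      (power (t, x) - DF1 (t, x) - DF2 (t, x) - DF3 (t, x)).
  rewrite RintegralB// RintegralB// RintegralB//.
  by rewrite (int_DF1 tT) (int_DF2 tT) (int_DF3 tT) !subr0.
rewrite -RintegralZl//; apply: le_Rintegral => //.
  apply: continuous_integrable => x /St Sx; apply: continuous_mulf;
    [exact: continuous_cstf|exact: cnrm2].
by move=> x Dx; exact: hK.
Qed.

Let is_derive_nrm2 t x : S (t, x) ->
  is_derive t 1 (fun s => nrm2 (s, x)) (2 * power (t, x)).
Proof.
move=> Stx.
have h1 := is_derive_time sw1 Stx; have h2 := is_derive_time sw2 Stx.
have h3 := is_derive_time sw3 Stx.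
by rewrite /nrm2 /power; apply: is_derive_eq; rewrite /GRing.scale/=; ring.
Qed.

(** Differentiation under the integral sign on a neighbourhood of t that keeps
away from 0 and T, where a constant dominates. *)
Let energy_derive t : 0 < t < T ->
  derivable energy t 1 /\
  derive1 energy t = 2 * \int[leb3 R]_(x in @cylinder R) power (t, x).
Proof.
move=> /andP[t0 tT].
pose a := t / 2; pose b := (t + T) / 2.
have ab s : `]a, b[%classic s -> 0 <= s < T.
  by rewrite /= in_itv/= /a /b => /andP[? ?]; apply/andP; split; lra.
have abt : `]a, b[%classic t by rewrite /= in_itv/= /a /b; apply/andP; split; lra.
have mD := @measurable_cylinder R.
have [M M0 hM] : exists2 M : R, 0 <= M & forall (s : R) (x : vec3 R), a <= s <= b -> cylinder x ->
    `|2 * power (s, x)| <= M.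
  have aa : 0 <= a by rewrite /a; lra.
  have bT : b < T by rewrite /b; lra.
  apply: (@spacetime_bounded _ T (fun z => 2 * power z) a b aa bT).
  by move=> z Sz; apply: continuous_mulf; [exact: continuous_cstf|exact: cpower_time].
have intf s : `]a, b[%classic s ->
    (leb3 R).-integrable (@cylinder R) (EFin \o (fun x => nrm2 (s, x))).
  move=> /ab sT; apply: continuous_integrable => x Dx.
  by apply: cnrm2; apply/spacetimeP.
have df s x : `]a, b[%classic s -> cylinder x ->
    derivable (fun r => nrm2 (r, x)) s 1.
  move=> /ab sT Dx; have Ssx : S (s, x) by apply/spacetimeP.
  by have [] := is_derive_nrm2 Ssx.
have iM : (leb3 R).-integrable (@cylinder R) (EFin \o (fun=> M)).
  by apply: continuous_integrable => x Dx; exact: continuous_cstf.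
have Gub s x : `]a, b[%classic s -> cylinder x ->
    `|partial1of2 (fun s x => nrm2 (s, x)) s x| <= M.
  move=> sab Dx; have Ssx : S (s, x) by apply/spacetimeP; split=> //; exact: ab.
  rewrite partial1of2E; have := is_derive_nrm2 Ssx => h; rewrite derive_val.
  by apply: hM => //; move: sab; rewrite /= in_itv/= => /andP[? ?]; rewrite !ltW.
split.
  exact: (@derivable_under_integral _ _ _ (leb3 R) (fun s x => nrm2 (s, x)) _ mD
    _ _ _ abt intf df (fun=> M) (fun=> M0) iM Gub).
have := (@differentiation_under_integral _ _ _ (leb3 R) (fun s x => nrm2 (s, x)) _ mD
    _ _ _ abt intf df (fun=> M) (fun=> M0) iM Gub).
rewrite /energy => ->.
have St x : cylinder x -> S (t, x).
  by move=> Dx; apply/spacetimeP; split=> //; exact: ab.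
rewrite -RintegralZl//; last first.
  by apply: continuous_integrable => x Dx; apply: cpower; exact: St.
apply: eq_Rintegral => x; rewrite inE => Dx.
by rewrite partial1of2E; have := is_derive_nrm2 (St x Dx) => h; rewrite derive_val.
Qed.

(** Mean value theorem in time at each point, starting from w = 0 at time 0. *)
Let energy_small b : 0 < b -> b < T -> exists M : R, forall t : R, 0 < t < b ->
  0 <= energy t <= M * t.
Proof.
move=> b0 bT.
have [M M0 hM] : exists2 M : R, 0 <= M & forall (s : R) (x : vec3 R), 0 <= s <= b -> cylinder x ->
    `|2 * power (s, x)| <= M.
  apply: (@spacetime_bounded _ T (fun z => 2 * power z) 0 b) => //.
  by move=> z Sz; apply: continuous_mulf; [exact: continuous_cstf|exact: cpower_time].
have mD := @measurable_cylinder R.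
exists (M * fine (leb3 R (@cylinder R))) => t /andP[t0 tb].
have bnd x : cylinder x -> nrm2 (t, x) <= M * t.
  move=> Dx.
  have [c] : exists2 c, c \in `[0, t]%R &
      nrm2 (t, x) - nrm2 (0, x) = 2 * power (c, x) * (t - 0).
    apply: (@MVT_segment _ (fun s => nrm2 (s, x)) (fun s => 2 * power (s, x))).
    - exact: ltW.
    - move=> s; rewrite in_itv/= => /andP[s0 st]; apply: is_derive_nrm2.
      by apply/spacetimeP; split=> //; apply/andP; split; lra.
    - apply: derivable_within_continuous => s; rewrite in_itv/= => /andP[s0 st].
      have Ssx : S (s, x) by apply/spacetimeP; split=> //; apply/andP; split; lra.
      by have [] := is_derive_nrm2 Ssx.
  rewrite in_itv/= => /andP[c0 ct].
  have [i1 i2 i3] := init Dx.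
  rewrite {2}/nrm2 i1 i2 i3 !mulr0 !addr0 !subr0 => ->.
  apply: ler_wpM2r; first exact: ltW.
  apply: le_trans (hM c x _ Dx); first exact: ler_norm.
  by apply/andP; split; lra.
have St x : cylinder x -> S (t, x).
  by move=> Dx; apply/spacetimeP; split=> //; apply/andP; split; lra.
apply/andP; split.
  apply: Rintegral_ge0 => x _; rewrite /nrm2.
  by rewrite -!expr2 !addr_ge0// sqr_ge0.
rewrite mulrAC -(Rintegral_cst _ mD); apply: le_Rintegral => //.
- by apply: continuous_integrable => x Dx; apply: cnrm2; exact: St.
- by apply: continuous_integrable => x Dx; exact: continuous_cstf.
Qed.

(** The energy vanishes by Gronwall's inequality, and its integrand is
continuous and nonnegative. *)
Lemma energy_uniqueness t x : S (t, x) ->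
  [/\ w1 (t, x) = 0, w2 (t, x) = 0 & w3 (t, x) = 0].
Proof.
move=> /spacetimeP[/andP[]]; rewrite le_eqVlt => /predU1P[<- _|t0 tT] Dx.
  exact: init.
pose b := (t + T) / 2.
have b0 : 0 < b by rewrite /b; lra.
have bT : b < T by rewrite /b; lra.
have tb : 0 < t < b by rewrite t0 /b; lra.
have [K hK] := int_power_le bT; have [M hM] := energy_small b0 bT.
have E0 : energy t = 0.
  apply: (@gronwall_eq0 _ energy (2 * K) M b) => // s /andP[s0 sb].
  - by apply: (energy_derive _).1; rewrite s0 (lt_trans sb).
  - rewrite (energy_derive _).2 ?s0 ?(lt_trans sb)// -mulrA; apply: ler_wpM2l => //.
    by apply: hK; rewrite !ltW.
have St y : cylinder y -> S (t, y).
  by move=> Dy; apply/spacetimeP; split=> //; rewrite tT ltW.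
have := integral_cylinder_eq0 (fun y Dy => cnrm2 (St y Dy)) _ E0 Dx.
have pos (r : R) : 0 <= r * r by rewrite -expr2 sqr_ge0.
move=> /(_ (fun y _ => addr_ge0 (addr_ge0 (pos _) (pos _)) (pos _))).
have p1 := pos (w1 (t, x)); have p2 := pos (w2 (t, x)); have p3 := pos (w3 (t, x)).
rewrite /nrm2 => h; split; apply/eqP; rewrite -[_ == 0]orbb -mulf_eq0; apply/eqP; lra.
Qed.

End Energy.

(** * Uniqueness of smooth solutions *)

Section Components.
Context {R : realType}.

Lemma derive_line_eq (V W : normedModType R) (f g : V -> W) (x e : V) :
  (forall h : R, f (h *: e + x) = g (h *: e + x)) -> 'D_e f x = 'D_e g x.
Proof.
move=> fg; have fgx : f x = g x by have := fg 0; rewrite scale0r add0r.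
by rewrite /derive fgx; under eq_fun do rewrite /= fg.
Qed.

Lemma derive_slice (V W : normedModType R) (g : R * V -> W) (t : R) (x e : V) :
  'D_e (fun y => g (t, y)) x = 'D_((0 : R), e) g (t, x).
Proof.
have line h : h *: ((0 : R), e) + (t, x) = (t, h *: e + x).
  by transitivity (h * 0 + t, h *: e + x) => //; rewrite mulr0 add0r.
by rewrite /derive; under [in RHS]eq_fun do rewrite /= line.
Qed.

Lemma is_derive_slice (V W : normedModType R) (g : R * V -> W) (t : R) (x e : V) :
  derivable g (t, x) ((0 : R), e) ->
  is_derive x e (fun y => g (t, y)) ('D_((0 : R), e) g (t, x)).
Proof.
move=> dg; apply: DeriveDef; last exact: derive_slice.
have line h : h *: ((0 : R), e) + (t, x) = (t, h *: e + x).
  by transitivity (h * 0 + t, h *: e + x) => //; rewrite mulr0 add0r.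
by move: dg; rewrite /derivable; under eq_fun do rewrite /= line.
Qed.

Lemma derive_time_slice (V W : normedModType R) (g : R * V -> W) (t : R) (x : V) :
  derive1 (fun s => g (s, x)) t = 'D_((1 : R), (0 : V)) g (t, x).
Proof.
have line h : h *: ((1 : R), (0 : V)) + (t, x) = (h + t, x).
  transitivity (h * 1 + t, h *: (0 : V) + x) => //.
  by rewrite scaler0 add0r mulr1.
by rewrite /derive1 /derive; under [in RHS]eq_fun do rewrite /= line.
Qed.

Lemma derive_linear_on (V W X : normedModType R) (A : set V) (L : {linear W -> X})
    (g : V -> W) (z a : V) :
  continuous L -> smooth_on A g -> A z -> 'D_a (L \o g) z = L ('D_a g z).
Proof.
move=> cL sg Az; apply: (derive_linear_comp _ _).2 => //.
exact/diff_derivable/(smooth_on_differentiable sg).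
Qed.

Lemma derive2_linear_on (V W X : normedModType R) (A : set V) (L : {linear W -> X})
    (g : V -> W) (z a b : V) :
  continuous L -> smooth_on A g -> A z ->
  'D_a ('D_b (L \o g)) z = L ('D_a ('D_b g) z).
Proof.
move=> cL sg Az; rewrite -(derive_linear_on _ cL (smooth_on_derive b sg) Az).
have [U [oU AU sU]] := sg.
apply: near_eq_derive.
apply: filterS (open_nbhs_nbhs (conj oU (AU _ Az))) => y Uy.
have sgU : smooth_on U g by exists U; split.
exact: (derive_linear_on b cL sgU Uy).
Qed.

Lemma derive_sub_on (V W : normedModType R) (A : set V) (g h : V -> W) (z a : V) :
  smooth_on A g -> smooth_on A h -> A z ->
  'D_a (fun y => g y - h y) z = 'D_a g z - 'D_a h z.
Proof.
move=> sg sh Az; apply: deriveB; apply: diff_derivable.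
  exact: smooth_on_differentiable sg Az.
exact: smooth_on_differentiable sh Az.
Qed.

Lemma derive2_sub_on (V W : normedModType R) (A : set V) (g h : V -> W)
    (z a b : V) :
  smooth_on A g -> smooth_on A h -> A z ->
  'D_a ('D_b (fun y => g y - h y)) z = 'D_a ('D_b g) z - 'D_a ('D_b h) z.
Proof.
move=> sg sh Az.
rewrite -(derive_sub_on _ (smooth_on_derive b sg) (smooth_on_derive b sh) Az).
have [U [oU AU sU]] := sg; have [U' [oU' AU' sU']] := sh.
apply: near_eq_derive.
have oUU : nbhs z (U `&` U').
  apply: open_nbhs_nbhs; split; first exact: openI.
  by split; [exact: AU|exact: AU'].
apply: filterS oUU => y [Uy U'y].
apply: deriveB; apply: diff_derivable.
  exact: (sU [::]).
exact: (sU' [::]).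
Qed.

Definition coord1 : {linear vec3 R -> R} := fst \o fst.
Definition coord2 : {linear vec3 R -> R} := snd \o fst.
Definition coord3 : {linear vec3 R -> R} := snd.

End Components.

Section Uniqueness.
Context {R : realType} (T : R).
Local Notation S := (@spacetime R T).
Local Notation dt g := ('D_((1 : R), (0 : vec3 R)) g).
Local Notation d1 g := ('D_((0 : R), e1 R) g).
Local Notation d2 g := ('D_((0 : R), e2 R) g).
Local Notation d3 g := ('D_((0 : R), e3 R) g).
Implicit Types (u v f : R -> vec3 R -> vec3 R) (P Q : R -> vec3 R -> R).

Lemma coord1C : continuous (@coord1 R).
Proof. by move=> x; exact: coord1_continuous. Qed.

Lemma coord2C : continuous (@coord2 R).
Proof. by move=> x; exact: coord2_continuous. Qed.

Lemma coord3C : continuous (@coord3 R).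
Proof. by move=> x; exact: coord3_continuous. Qed.

Lemma balance_coord (L : {linear vec3 R -> R})
    (A0 A0' B1 B2 B3 B1' B2' B3' C1 C2 C3 C1' C2' C3' G F : vec3 R)
    (a0 b1 b2 b3 c1 c2 c3 k1 k2 k3 : R) :
  a0 = L A0 -> b1 = L B1 -> b2 = L B2 -> b3 = L B3 ->
  c1 = L C1 -> c2 = L C2 -> c3 = L C3 ->
  A0' = A0 -> B1' = B1 -> B2' = B2 -> B3' = B3 ->
  C1' = C1 -> C2' = C2 -> C3' = C3 ->
  C1' + C2' + C3' - (k1 *: B1' + k2 *: B2' + k3 *: B3') - G - A0' = F ->
  a0 = c1 + c2 + c3 - (k1 * b1 + k2 * b2 + k3 * b3) - L G - L F.
Proof.
move=> -> -> -> -> -> -> -> -> -> -> -> -> -> -> <-.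
by rewrite !linearB !linearD !linearZ /=; ring.
Qed.

Lemma navier_stokes_coord (L : {linear vec3 R -> R}) f u P t x :
  continuous L -> smooth_on S (fun z => u z.1 z.2) ->
  navier_stokes T f u P -> S (t, x) ->
  let U z := u z.1 z.2 in let z := (t, x) in
  dt (L \o U) z = d1 (d1 (L \o U)) z + d2 (d2 (L \o U)) z + d3 (d3 (L \o U)) z
    - (coord1 (U z) * d1 (L \o U) z + coord2 (U z) * d2 (L \o U) z
       + coord3 (U z) * d3 (L \o U) z)
    - L (gradient (P t) x) - L (f t x).
Proof.
move=> cL sU ns Sz U z; have [eqf _] := ns t x Sz.
have sl (e : vec3 R) : 'D_e (u t) x = 'D_((0 : R), e) U z.
  exact: (derive_slice U).
have sl2 (e : vec3 R) : 'D_e ('D_e (u t)) x = 'D_((0 : R), e) ('D_((0 : R), e) U) z.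
  have -> : 'D_e (u t) = fun y => 'D_((0 : R), e) U (t, y).
    by apply/funext => y; exact: (derive_slice U).
  exact: (derive_slice ('D_((0 : R), e) U)).
have L1 a := derive_linear_on a cL sU Sz.
have L2 a := derive2_linear_on a a cL sU Sz.
exact: (balance_coord (L1 _) (L1 _) (L1 _) (L1 _) (L2 _) (L2 _) (L2 _)
  (derive_time_slice U t x) (sl _) (sl _) (sl _) (sl2 _) (sl2 _) (sl2 _) eqf).
Qed.

Lemma divergence_coord u t x : smooth_on S (fun z => u z.1 z.2) -> S (t, x) ->
  let U z := u z.1 z.2 in let z := (t, x) in
  divergence (u t) x =
  d1 (coord1 \o U) z + d2 (coord2 \o U) z + d3 (coord3 \o U) z.
Proof.
move=> sU Sz U z.
have sl (e : vec3 R) : 'D_e (u t) x = 'D_((0 : R), e) U z.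
  exact: (derive_slice U).
have E1 := derive_linear_on ((0 : R), e1 R) coord1C sU Sz.
have E2 := derive_linear_on ((0 : R), e2 R) coord2C sU Sz.
have E3 := derive_linear_on ((0 : R), e3 R) coord3C sU Sz.
rewrite /divergence; congr (_ + _ + _).
- exact: (eq_trans (congr1 coord1 (sl _)) (esym E1)).
- exact: (eq_trans (congr1 coord2 (sl _)) (esym E2)).
- exact: (eq_trans (congr1 coord3 (sl _)) (esym E3)).
Qed.

Lemma horizontal_boundary_cylinder (x : vec3 R) :
  horizontal_boundary x -> cylinder x.
Proof. by case=> r1 h; split=> //; case: h => ->; rewrite ?lexx ?ler01. Qed.

(** The radial and angular components are obtained from the first two
components by a rotation independent of x3, which can be inverted. *)
Lemma slip_off_axis u t x : smooth_on S (fun z => u z.1 z.2) -> 0 <= t < T ->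
  navier_total_slip (u t) -> horizontal_boundary x -> rad x != 0 ->
  let U z := u z.1 z.2 in
  d3 (coord1 \o U) (t, x) = 0 /\ d3 (coord2 \o U) (t, x) = 0.
Proof.
move=> sU tT slip Hx rx U; have [_ /(_ rx)[hr ha]] := slip x Hx.
have Sz : S (t, x).
  split=> /=; first by rewrite in_itv.
  exact: horizontal_boundary_cylinder.
have D1 : is_derive x (e3 R) (fun y => (coord1 \o U) (t, y)) (d3 (coord1 \o U) (t, x)).
  apply: is_derive_slice; apply/diff_derivable.
  exact: (smooth_on_differentiable (smooth_on_linear_comp coord1C sU) Sz).
have D2 : is_derive x (e3 R) (fun y => (coord2 \o U) (t, y)) (d3 (coord2 \o U) (t, x)).
  apply: is_derive_slice; apply/diff_derivable.
  exact: (smooth_on_differentiable (smooth_on_linear_comp coord2C sU) Sz).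
move: D1 D2 hr ha.
set A := d3 (coord1 \o U) (t, x); set B := d3 (coord2 \o U) (t, x).
move=> D1 D2.
have line (h : R) : h *: e3 R + x = (x.1.1, x.1.2, h + x.2).
  transitivity (h * 0 + x.1.1, h * 0 + x.1.2, h * 1 + x.2) => //.
  by rewrite mulr0 mulr1 !add0r.
have comb (c d : R) : 'D_(e3 R) (fun y => (coord1 \o U) (t, y) * c
    + (coord2 \o U) (t, y) * d) x = A * c + B * d.
  by rewrite derive_val /GRing.scale/=; ring.
have -> : 'D_(e3 R) (radial_comp (u t)) x =
    A * (x.1.1 / rad x) + B * (x.1.2 / rad x).
  rewrite -comb; apply: derive_line_eq => h; rewrite line.
  by rewrite /radial_comp /rad.
have -> : 'D_(e3 R) (angular_comp (u t)) x =
    A * (- x.1.2 / rad x) + B * (x.1.1 / rad x).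
  rewrite -comb; apply: derive_line_eq => h; rewrite line.
  by rewrite /angular_comp /rad.
move=> hr ha.
have r2 : rad x ^+ 2 = x.1.1 ^+ 2 + x.1.2 ^+ 2.
  by rewrite /rad sqr_sqrtr// addr_ge0// sqr_ge0.
have hA : A * rad x ^+ 2 = rad x * (x.1.1 * (A * (x.1.1 / rad x) + B * (x.1.2 / rad x))
    - x.1.2 * (A * (- x.1.2 / rad x) + B * (x.1.1 / rad x))).
  by rewrite r2; field.
have hB : B * rad x ^+ 2 = rad x * (x.1.2 * (A * (x.1.1 / rad x) + B * (x.1.2 / rad x))
    + x.1.1 * (A * (- x.1.2 / rad x) + B * (x.1.1 / rad x))).
  by rewrite r2; field.
move: hA hB; rewrite hr ha !mulr0 subrr addr0 mulr0.
by move=> /eqP; rewrite mulf_eq0 sqrf_eq0 (negbTE rx) orbF => /eqP ->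
  /eqP; rewrite mulf_eq0 sqrf_eq0 (negbTE rx) orbF => /eqP ->.
Qed.

Lemma continuous_eq0_right (g : R -> R) : {for 0, continuous g} ->
  (forall s, 0 < s <= 1 -> g s = 0) -> g 0 = 0.
Proof.
move=> cg g0; apply/eqP/negP => /negP n0.
have [e /= e0 he] := (nbhs_ballP _ _).1 (cvgr_neq0 _ cg n0).
pose s := Num.min 1 (e / 2).
have s0 : 0 < s by rewrite lt_min ltr01 divr_gt0.
have s1 : s <= 1 by rewrite ge_min lexx.
have se : s < e by rewrite gt_min; apply/orP; right; lra.
have : g s != 0 by apply: he; rewrite /ball/= sub0r normrN gtr0_norm.
by rewrite g0 ?eqxx// s0.
Qed.

(** On the axis the condition follows by continuity along a radius of the
face. *)
Lemma slip_coord u t x : smooth_on S (fun z => u z.1 z.2) -> 0 <= t < T ->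
  navier_total_slip (u t) -> horizontal_boundary x ->
  let U z := u z.1 z.2 in
  d3 (coord1 \o U) (t, x) = 0 /\ d3 (coord2 \o U) (t, x) = 0.
Proof.
move=> sU tT slip Hx U.
have [rx|] := eqVneq (rad x) 0; last exact: slip_off_axis.
have x12 : x.1.1 ^+ 2 + x.1.2 ^+ 2 = 0.
  have : rad x ^+ 2 = x.1.1 ^+ 2 + x.1.2 ^+ 2.
    by rewrite /rad sqr_sqrtr// addr_ge0// sqr_ge0.
  by rewrite rx expr0n.
have [x1 x2] : x.1.1 = 0 /\ x.1.2 = 0.
  have := sqr_ge0 x.1.1; have := sqr_ge0 x.1.2 => h1 h2.
  by split; apply/eqP; rewrite -sqrf_eq0; apply/eqP; lra.
have hs s : 0 < s <= 1 -> horizontal_boundary (s, 0 : R, x.2) /\ rad (s, 0 : R, x.2) != 0.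
  move=> /andP[s0 s1].
  have rs : rad (s, 0 : R, x.2) = s by rewrite /rad/= expr0n addr0 sqrtr_sqr gtr0_norm.
  by split; [split; [rewrite rs|case: Hx]|rewrite rs gt_eqF].
have xE : x = (0, 0, x.2) by move: x1 x2; case: (x) => [[? ?] ?] /= -> ->.
have Sz : S (t, x).
  split=> /=; first by rewrite in_itv.
  exact: horizontal_boundary_cylinder.
have axis (L : {linear vec3 R -> R}) : continuous L ->
    (forall s, 0 < s <= 1 -> d3 (L \o U) (t, (s, 0 : R, x.2)) = 0) ->
    d3 (L \o U) (t, x) = 0.
  move=> cL L0; rewrite xE.
  apply: (@continuous_eq0_right (fun s => d3 (L \o U) (t, (s, 0 : R, x.2)))) => //.
  have h0 := @line_continuous1 R 0 x.2 0.
  have h1 : {for (0 : R, 0 : R, x.2), continuous (fun y => d3 (L \o U) (t, y))}.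
    have sg := smooth_on_derive ((0 : R), e3 R) (smooth_on_linear_comp cL sU).
    by apply: (smooth_on_slice sg); rewrite -xE.
  exact: (cvg_comp _ _ h0 h1).
by split; apply: axis; [exact: coord1C| |exact: coord2C|];
  move=> s /hs[Hs rs]; have [] := slip_off_axis sU tT slip Hs rs.
Qed.

(** Subtraction of the equations of u and v, the difference of the convection
terms being split as (u . grad) w + (w . grad) v. *)
Lemma balance_sub (tu tv tw hu1 hu2 hu3 hv1 hv2 hv3 hw1 hw2 hw3
    gu1 gu2 gu3 gv1 gv2 gv3 gw1 gw2 gw3 u1 u2 u3 v1 v2 v3 qu qv qw f : R) :
  tu = hu1 + hu2 + hu3 - (u1 * gu1 + u2 * gu2 + u3 * gu3) - qu - f ->
  tv = hv1 + hv2 + hv3 - (v1 * gv1 + v2 * gv2 + v3 * gv3) - qv - f ->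
  tw = tu - tv -> hw1 = hu1 - hv1 -> hw2 = hu2 - hv2 -> hw3 = hu3 - hv3 ->
  gw1 = gu1 - gv1 -> gw2 = gu2 - gv2 -> gw3 = gu3 - gv3 -> qw = qu - qv ->
  tw = hw1 + hw2 + hw3 - (u1 * gw1 + u2 * gw2 + u3 * gw3)
    - ((u1 - v1) * gv1 + (u2 - v2) * gv2 + (u3 - v3) * gv3) - qw.
Proof. by move=> -> -> -> -> -> -> -> -> -> ->; ring. Qed.

(** The components of u - v and the difference of the pressures satisfy the
hypotheses of energy_uniqueness. *)
Lemma navier_stokes_unique f (v0 : vec3 R -> vec3 R) u v P Q :
  smooth_solution T f v0 u Q -> smooth_solution T f v0 v P ->
  forall t x, S (t, x) -> u t x = v t x.
Proof.
move=> [sU sQ nsu bcu iu] [sV sP nsv bcv iv] t x Stx.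
pose U z := u z.1 z.2; pose V z := v z.1 z.2.
pose w (L : {linear vec3 R -> R}) (z : R * vec3 R) := (L \o U) z - (L \o V) z.
pose pi (z : R * vec3 R) := Q z.1 z.2 - P z.1 z.2.
have sUc (L : {linear vec3 R -> R}) : continuous L -> smooth_on S (L \o U).
  by move=> cL; exact: smooth_on_linear_comp.
have sVc (L : {linear vec3 R -> R}) : continuous L -> smooth_on S (L \o V).
  by move=> cL; exact: smooth_on_linear_comp.
have swc (L : {linear vec3 R -> R}) : continuous L -> smooth_on S (w L).
  by move=> cL; apply: smooth_onB; [exact: sUc|exact: sVc].
have spi : smooth_on S pi by exact: (smooth_onB sQ sP).
have dw (L : {linear vec3 R -> R}) a z : continuous L -> S z ->
    'D_a (w L) z = 'D_a (L \o U) z - 'D_a (L \o V) z.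
  by move=> cL Sz; exact: (derive_sub_on a (sUc L cL) (sVc L cL) Sz).
have ddw (L : {linear vec3 R -> R}) a z : continuous L -> S z ->
    'D_a ('D_a (w L)) z = 'D_a ('D_a (L \o U)) z - 'D_a ('D_a (L \o V)) z.
  by move=> cL Sz; exact: (derive2_sub_on a a (sUc L cL) (sVc L cL) Sz).
have dpi (e : vec3 R) z : S z -> 'D_((0 : R), e) pi z =
    'D_e (Q z.1) z.2 - 'D_e (P z.1) z.2.
  case: z => s y Sz.
  have hQ := derive_slice (fun z => Q z.1 z.2) s y e.
  have hP := derive_slice (fun z => P z.1 z.2) s y e.
  have hQP := derive_sub_on ((0 : R), e) sQ sP Sz.
  exact: (eq_trans hQP (f_equal2 (fun a b => a - b) (esym hQ) (esym hP))).
have eqw (L : {linear vec3 R -> R}) e z : continuous L ->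
    (forall p : vec3 R -> R, L (gradient p z.2) = 'D_e p z.2) -> S z ->
    dt (w L) z = d1 (d1 (w L)) z + d2 (d2 (w L)) z + d3 (d3 (w L)) z
    - ((coord1 \o U) z * d1 (w L) z + (coord2 \o U) z * d2 (w L) z
       + (coord3 \o U) z * d3 (w L) z)
    - (w coord1 z * d1 (L \o V) z + w coord2 z * d2 (L \o V) z
       + w coord3 z * d3 (L \o V) z) - 'D_((0 : R), e) pi z.
  case: z => s y cL gradL Sz.
  have hu := navier_stokes_coord cL sU nsu Sz.
  have hv := navier_stokes_coord cL sV nsv Sz.
  rewrite /= gradL in hu; rewrite /= gradL in hv.
  exact: (balance_sub hu hv (dw _ _ _ cL Sz) (ddw _ _ _ cL Sz) (ddw _ _ _ cL Sz)
    (ddw _ _ _ cL Sz) (dw _ _ _ cL Sz) (dw _ _ _ cL Sz) (dw _ _ _ cL Sz)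
    (dpi _ _ Sz)).
have divU z : S z -> d1 (coord1 \o U) z + d2 (coord2 \o U) z + d3 (coord3 \o U) z = 0.
  case: z => s y Sz; rewrite -(divergence_coord sU Sz).
  by have [] := nsu s y Sz.
have divV z : S z -> d1 (coord1 \o V) z + d2 (coord2 \o V) z + d3 (coord3 \o V) z = 0.
  case: z => s y Sz; rewrite -(divergence_coord sV Sz).
  by have [] := nsv s y Sz.
have hS (s : R) (y : vec3 R) : 0 <= s < T -> cylinder y -> S (s, y).
  by move=> sT Dy; split=> //=; rewrite in_itv.
have [] := @energy_uniqueness R T (coord1 \o U) (coord2 \o U) (coord3 \o U)
  (coord1 \o V) (coord2 \o V) (coord3 \o V) (w coord1) (w coord2) (w coord3) pi
  (sUc _ coord1C) (sUc _ coord2C) (sUc _ coord3C)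
  (sVc _ coord1C) (sVc _ coord2C) (sVc _ coord3C)
  (swc _ coord1C) (swc _ coord2C) (swc _ coord3C) spi
  (fun z => eqw coord1 (e1 R) z coord1C (fun=> erefl))
  (fun z => eqw coord2 (e2 R) z coord2C (fun=> erefl))
  (fun z => eqw coord3 (e3 R) z coord3C (fun=> erefl))
  divU _ _ _ _ t x Stx.
- move=> z Sz; rewrite (dw _ _ _ coord1C Sz) (dw _ _ _ coord2C Sz) (dw _ _ _ coord3C Sz).
  have := divU z Sz; have := divV z Sz.
  move: (d1 _ z) (d2 _ z) (d3 _ z) (d1 _ z) (d2 _ z) (d3 _ z) => a b c a' b' c'.
  by lra.
- move=> s y sT Vy; have [nu _] := bcu s sT; have [nv _] := bcv s sT.
  by rewrite /w /U /V /= (nu y Vy) (nv y Vy) subrr.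
- move=> s y sT Hy; have [_ nu] := bcu s sT; have [_ nv] := bcv s sT.
  have Dy := horizontal_boundary_cylinder Hy.
  have Sz := hS s y sT Dy.
  have [U1 U2] := slip_coord sU sT nu Hy; have [V1 V2] := slip_coord sV sT nv Hy.
  rewrite (dw _ _ _ coord1C Sz) (dw _ _ _ coord2C Sz).
  have [u3 _] := nu y Hy; have [v3 _] := nv y Hy.
  have c3 : (coord3 \o U) (s, y) = 0 := u3.
  have c3' : (coord3 \o V) (s, y) = 0 := v3.
  by rewrite /w c3 c3' U1 U2 V1 V2 subrr.
- move=> y Dy; rewrite /w /U /V /= (iu y Dy) (iv y Dy).
  by rewrite !subrr.
rewrite /w /U /V /= => /eqP; rewrite subr_eq0 => /eqP h1 /eqP; rewrite subr_eq0 => /eqP h2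
  /eqP; rewrite subr_eq0 => /eqP h3.
move: h1 h2 h3; rewrite /coord1 /coord2 /coord3 /=.
by case: (u t x) => [[? ?] ?]; case: (v t x) => [[? ?] ?] /= -> -> ->.
Qed.

End Uniqueness.

(** * Mixed norms of concentrating fields *)

Section DerivativeRules.
Context {R : realType}.

Lemma is_derive_powR_comp (f : R -> R) (s a df : R) : 0 < f s ->
  is_derive s 1 f df ->
  is_derive s 1 (fun s => f s `^ a) (a * f s `^ (a - 1) * df).
Proof.
move=> fs dl.
have dp : is_derive (f s) 1 (@powR R ^~ a) (a * f s `^ (a - 1)).
  exact: is_derive1_powR.
have h := is_derive1_comp dp dl.
by apply: (is_derive_eq h); rewrite mulrC.
Qed.

Lemma is_derive_inv_comp (f : R -> R) (s df : R) : f s != 0 ->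
  is_derive s 1 f df ->
  is_derive s 1 (fun s => (f s)^-1) (- (f s) ^- 2 * df).
Proof.
move=> fs [d1 <-]; apply: DeriveDef; first exact: derivableV.
by rewrite deriveV.
Qed.

End DerivativeRules.

Section NonnegativeIntegrals.
Context d (X : measurableType d) (R : realType).
Variable mu : {measure set X -> \bar R}.
Local Open Scope ereal_scope.

(** Both integrals are suprema over the nonnegative simple functions below the
integrand, so monotonicity is an inclusion of index sets. *)
Lemma ge0_le_integralT (f g : X -> \bar R) : (forall x, 0 <= f x) ->
  (forall x, f x <= g x) -> \int[mu]_x f x <= \int[mu]_x g x.
Proof.
move=> f0 fg; have g0 x : 0 <= g x := le_trans (f0 x) (fg x).
rewrite !ge0_integralTE//; apply: le_ereal_sup => _ [h hf <-].
by exists h => // x; exact: le_trans (hf x) (fg x).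
Qed.

Lemma le_Lnorm (p : \bar R) (f g : X -> \bar R) : 1 <= p ->
  (forall x, `|f x| <= g x) -> 'N[mu]_p[f] <= 'N[mu]_p[g].
Proof.
move=> p1 fg; have fga x : `|f x| <= `|g x|.
  by rewrite (le_trans (fg x))// lee_abs.
rewrite unlock; case: p p1 => [r| |//] r1 /=; last first.
  case: ifP => // _; by apply: le_ess_sup; exact: nearW.
have r0 : (0 <= r)%R by move: r1; rewrite lee_fin => /(le_trans ler01).
apply: gt0_ler_poweR.
- by rewrite invr_ge0.
- by rewrite in_itv/= leey andbT; apply: integral_ge0 => x _; exact: poweR_ge0.
- by rewrite in_itv/= leey andbT; apply: integral_ge0 => x _; exact: poweR_ge0.
apply: ge0_le_integralT => x; first exact: poweR_ge0.
by apply: gt0_ler_poweR => //; rewrite in_itv/= leey andbT.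
Qed.

End NonnegativeIntegrals.

Section PowerIntegrals.
Context {R : realType}.
Local Notation lam := (@lebesgue_measure R).

Lemma affine_powR_measurable (m e a : R) (D : set R) :
  measurable_fun D (fun s => ((m + e * s) `^ a)%:E).
Proof.
apply/measurable_EFinP; apply: (measurableT_comp (measurable_powR _)).
by apply: measurable_funD => //; exact: measurable_funM.
Qed.

Lemma is_derive_affine_powR (m e a s : R) : 0 < m + e * s ->
  is_derive s 1 (fun s => (m + e * s) `^ a) (a * (m + e * s) `^ (a - 1) * e).
Proof.
move=> ms; have dl : is_derive s 1 (fun s => m + e * s) e.
  by apply: is_derive_eq; rewrite /GRing.scale/=; ring.
exact: (@is_derive_powR_comp R (fun s => m + e * s)).
Qed.

(** The slope e is 1 or -1. The antiderivative e (m + e s)^(1 - a) / (1 - a) has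
values between 0 and L^(1 - a) / (1 - a) up to the sign e. *)
Lemma affine_powR_integral_le (m e u v a L : R) : e ^+ 2 = 1 -> a < 1 -> u <= v ->
  (forall s, u <= s <= v -> 0 < m + e * s <= L) ->
  (\int[lam]_(s in `[u, v]) ((m + e * s) `^ (- a))%:E <=
    (L `^ (1 - a) / (1 - a))%:E)%E.
Proof.
move=> e2 a1 uv mL.
have a0 : 0 < 1 - a by rewrite subr_gt0.
have L0 : 0 <= L `^ (1 - a) / (1 - a) by rewrite divr_ge0 ?powR_ge0// ltW.
move: uv; rewrite le_eqVlt => /predU1P[<-|uv].
  by rewrite set_itv1 integral_set1 lee_fin.
pose F s := e * ((m + e * s) `^ (1 - a) / (1 - a)).
have dF s : u <= s <= v -> is_derive s 1 F ((m + e * s) `^ (- a)).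
  move=> /mL/andP[ms _].
  have dc := is_derive_affine_powR (1 - a) ms.
  rewrite /F; apply: is_derive_eq.
  rewrite /GRing.scale/= (_ : 1 - a - 1 = - a); last by ring.
  rewrite [RHS](_ : _ = e ^+ 2 * (m + e * s) `^ (- a)); last by rewrite e2 mul1r.
  by field; rewrite gt_eqF.
have cF s : u <= s <= v -> {for s, continuous F}.
  by move=> /dF [+ _]; move=> /derivable1_diffP/differentiable_continuous.
rewrite (@continuous_FTC2 _ _ F)//.
- rewrite -EFinB lee_fin /F.
  have /andP[mu1 mu2] : 0 < m + e * u <= L by apply: mL; rewrite lexx ltW.
  have /andP[mv1 mv2] : 0 < m + e * v <= L by apply: mL; rewrite lexx ltW.
  have hu : (m + e * u) `^ (1 - a) / (1 - a) <= L `^ (1 - a) / (1 - a).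
    apply: ler_wpM2r; first by rewrite invr_ge0 ltW.
    by apply: ge0_ler_powR => //; rewrite ?nnegrE; [exact: ltW|exact: ltW|exact/ltW/(lt_le_trans mu1)].
  have hv : (m + e * v) `^ (1 - a) / (1 - a) <= L `^ (1 - a) / (1 - a).
    apply: ler_wpM2r; first by rewrite invr_ge0 ltW.
    by apply: ge0_ler_powR => //; rewrite ?nnegrE; [exact: ltW|exact: ltW|exact/ltW/(lt_le_trans mv1)].
  have pu : 0 <= (m + e * u) `^ (1 - a) / (1 - a) by rewrite divr_ge0 ?powR_ge0// ltW.
  have pv : 0 <= (m + e * v) `^ (1 - a) / (1 - a) by rewrite divr_ge0 ?powR_ge0// ltW.
  have : (e - 1) * (e + 1) = 0 by rewrite -subr_sqr expr1n e2 subrr.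
  move: hu hv pu pv.
  set Xu := (m + e * u) `^ _ / _; set Xv := (m + e * v) `^ _ / _ => hu hv pu pv.
  clearbody Xu Xv.
  by move/eqP; rewrite mulf_eq0 subr_eq0 addr_eq0 => /orP[|] /eqP ->; lra.
- apply/subspace_continuousP => s /=; rewrite in_itv/= => /mL/andP[ms _].
  apply: cvg_within_filter.
  have [dc _] := is_derive_affine_powR (- a) ms.
  exact/differentiable_continuous/derivable1_diffP.
- split.
  + move=> s; rewrite in_itv/= => /andP[us sv].
    by have [] := dF s; rewrite ?ltW.
  + by apply: cvg_at_right_filter; apply: cF; rewrite lexx ltW.
  + by apply: cvg_at_left_filter; apply: cF; rewrite lexx ltW.
- move=> s; rewrite in_itv/= => /andP[us sv].
  by have h := dF s ltac:(by rewrite !ltW); rewrite derive1E derive_val.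
Qed.

(** The intervals [0, T - T / (n + 2)] exhaust [0, T[ and the integrals over
them are bounded uniformly. *)
Lemma time_powR_integral_lty (T a : R) : 0 < T -> a < 1 ->
  (\int[lam]_(s in `[0%R, T[) ((T - s) `^ (- a))%:E < +oo)%E.
Proof.
move=> T0 a1.
pose F n := `[0, T - T / n.+2%:R]%classic.
have nndF : nondecreasing_seq F.
  move=> m n mn; apply/subsetPset => s; rewrite /F/= !in_itv/= => /andP[-> /le_trans]; apply.
  apply: lerB => //; apply: ler_wpM2l; first exact: ltW.
  by rewrite lef_pV2 ?posrE// ler_nat !ltnS.
have UF : \bigcup_n F n = `[0, T[%classic.
  apply/seteqP; rewrite /F; split=> [s [n _]|s]; rewrite /= !in_itv/=.
    move=> /andP[-> /le_lt_trans]; apply.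
    by rewrite ltrBlDr ltrDl divr_gt0.
  move=> /andP[s0 sT].
  have Ts : 0 < T - s by rewrite subr_gt0.
  pose n := Num.bound (T / (T - s)).
  exists n => //=; rewrite in_itv/= s0 /= lerBrDr -lerBrDl ler_pdivrMr// mulrC.
  rewrite -ler_pdivrMr//.
  have : T / (T - s) <= n%:R by apply/ltW/archi_boundP; rewrite divr_ge0 ?ltW.
  by move=> /le_trans; apply; rewrite ler_nat; exact: leq_trans (leqnSn _) (leqnSn _).
have b n : (\int[lam]_(s in F n) ((T - s) `^ (- a))%:E <= (T `^ (1 - a) / (1 - a))%:E)%E.
  under eq_integral do rewrite -mulN1r.
  apply: affine_powR_integral_le => //.
  - by rewrite sqrrN expr1n.
  - by rewrite subr_ge0 ler_pdivrMr//; apply: ler_peMr; [exact: ltW|rewrite ler1n].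
  - move=> s /andP[s0 sT]; rewrite mulN1r; apply/andP; split; last by rewrite gerBl.
    by rewrite subr_gt0 (le_lt_trans sT)// ltrBlDr ltrDl divr_gt0.
have := @ge0_nondecreasing_set_cvg_integral _ (measurableTypeR R) R F
  (fun s => ((T - s) `^ (- a))%:E) lam nndF.
rewrite UF => /(_ (fun i => measurable_itv _)).
have mf i : measurable_fun (F i) (fun s => ((T - s) `^ (- a))%:E).
  by under eq_fun do rewrite -mulN1r; exact: affine_powR_measurable.
move=> /(_ mf) /(_ (fun i x _ => powR_ge0 _ _)) cvgF.
apply: (@le_lt_trans _ _ (T `^ (1 - a) / (1 - a))%:E); last exact: ltry.
rewrite -(cvg_lim _ cvgF)//; apply: lime_le; first exact/cvgP/cvgF.
by apply: nearW => n; exact: b.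
Qed.

Lemma tonelli3 (A B C : R -> R) :
  measurable_fun setT A -> measurable_fun setT B -> measurable_fun setT C ->
  (forall s, 0 <= A s) -> (forall s, 0 <= B s) -> (forall s, 0 <= C s) ->
  (\int[leb3 R]_x (A x.1.1 * B x.1.2 * C x.2)%:E =
  \int[lam]_s (A s)%:E * \int[lam]_s (B s)%:E * \int[lam]_s (C s)%:E)%E.
Proof.
move=> mA mB mC A0 B0 C0.
pose MV := (measurableTypeR R * measurableTypeR R * measurableTypeR R)%type.
pose MW := (measurableTypeR R * measurableTypeR R)%type.
have mAB : measurable_fun [set: MW] (fun y : MW => A y.1 * B y.2).
  apply: measurable_funM; [exact: measurableT_comp mA _|exact: measurableT_comp mB _].
have mABC : measurable_fun [set: MV] (fun x : MV => (A x.1.1 * B x.1.2 * C x.2)%:E).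
  apply/measurable_EFinP; apply: measurable_funM.
    exact: (measurableT_comp mAB (measurable_fst : measurable_fun [set: MV] fst)).
  exact: measurableT_comp mC _.
have IC0 : (0 <= \int[lam]_s (C s)%:E)%E by apply: integral_ge0 => s _; rewrite lee_fin.
have IB0 : (0 <= \int[lam]_s (B s)%:E)%E by apply: integral_ge0 => s _; rewrite lee_fin.
have h := @fubini_tonelli1 _ _ _ _ R (leb2 R) lam _ mABC.
rewrite [LHS]h; last by move=> x; rewrite lee_fin !mulr_ge0.
have h2 := @fubini_tonelli1 _ _ _ _ R lam lam (fun y : MW => (A y.1 * B y.2)%:E).
transitivity (\int[leb2 R]_y ((A y.1 * B y.2)%:E * \int[lam]_s (C s)%:E))%E.
  apply: eq_integral => y _; rewrite /fubini_F /=.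
  under eq_integral do rewrite EFinM.
  rewrite ge0_integralZl_EFin//.
  - by move=> s _; rewrite lee_fin.
  - exact/measurable_EFinP.
  - by rewrite mulr_ge0.
rewrite ge0_integralZr//; first last.
- by move=> y _; rewrite lee_fin mulr_ge0.
- exact/measurable_EFinP.
congr (_ * _)%E.
rewrite [LHS]h2; first last.
- by move=> y; rewrite lee_fin mulr_ge0.
- exact/measurable_EFinP.
transitivity (\int[lam]_s ((A s)%:E * \int[lam]_s (B s)%:E))%E.
  apply: eq_integral => y _; rewrite /fubini_F /=.
  under eq_integral do rewrite EFinM.
  rewrite ge0_integralZl_EFin//.
  - by move=> s _; rewrite lee_fin.
  - exact/measurable_EFinP.
rewrite ge0_integralZr//.
- exact/measurable_EFinP.
- by move=> s _; rewrite lee_fin.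
Qed.

End PowerIntegrals.

Section MixedNorm.
Context {R : realType}.
Local Notation lam := (@lebesgue_measure R).

(** A singularity |s|^(-c) smoothed at scale d and truncated to [-1, 1], the
range of the coordinates of the cylinder. *)
Definition pole (d c s : R) : R := ((fun s => (d + `|s|) `^ (- c)) \_ `[-1, 1]) s.

Lemma pole_ge0 d c s : 0 <= pole d c s.
Proof. by rewrite /pole patchE; case: ifP => // _; exact: powR_ge0. Qed.

Lemma pole_measurable d c : measurable_fun setT (pole d c).
Proof.
apply/(measurable_restrictT _ _).1 => //.
apply: (measurableT_comp (measurable_powR _)).
by apply: measurable_funD => //; apply: measurable_funTS; exact: normr_measurable.
Qed.

(** The bound is uniform in the scale d. *)
Lemma pole_integral_le (c d D : R) : c < 1 -> 0 < d <= D ->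
  (\int[lam]_s (pole d c s)%:E <= (2 * ((D + 1) `^ (1 - c) / (1 - c)))%:E)%E.
Proof.
move=> c1 /andP[d0 dD].
pose f (e s : R) := ((d + e * s) `^ (- c))%:E.
have f0 e s : (0 <= f e s)%E by rewrite lee_fin powR_ge0.
have mf e (A : set R) : measurable A -> measurable_fun setT (f e \_ A).
  move=> mA; have h : measurable_fun A (f e) := @affine_powR_measurable R d e (- c) A.
  exact: ((measurable_restrictT (f e) mA).1 h).
apply: (@le_trans _ _ (\int[lam]_s ((f (-1)%R \_ `[(-1)%R, 0%R]) s + (f 1%R \_ `[0%R, 1%R]) s))%E).
  apply: ge0_le_integralT => s; first by rewrite lee_fin pole_ge0.
  have r0 e (A : set R) : (0 <= (f e \_ A) s)%E by apply: erestrict_ge0 => y _.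
  rewrite /pole patchE; case: ifPn => [|_]; last by rewrite adde_ge0.
  rewrite inE/= in_itv/= => /andP[s1 s2].
  have [s0|s0] := leP 0 s.
    apply: (@le_trans _ _ ((f 1 \_ `[0, 1]) s)); last by rewrite leeDr.
    by rewrite patchE mem_set/= ?in_itv/= ?s0// /f mul1r ger0_norm.
  apply: (@le_trans _ _ ((f (-1) \_ `[-1, 0]) s)); last by rewrite leeDl.
  by rewrite patchE mem_set/= ?in_itv/= ?s1 ?(ltW s0)// /f mulN1r ltr0_norm.
rewrite ge0_integralD//; first last.
- exact: mf.
- by move=> s _; apply: erestrict_ge0 => y _.
- exact: mf.
- by move=> s _; apply: erestrict_ge0 => y _.
rewrite -!integral_mkcond mulr_natl mulr2n EFinD; apply: leeD.
  apply: affine_powR_integral_le => //; first by rewrite sqrrN expr1n.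
  by move=> s /andP[s1 s2]; apply/andP; split; lra.
apply: affine_powR_integral_le => //; first by rewrite expr1n.
by move=> s /andP[s1 s2]; apply/andP; split; lra.
Qed.

(** The number b is the part of the exponent of the concentration factor that is
converted into a power of time. It can be taken below 1/p, which keeps the
space integral bounded, and above s - 1/q, which makes the time integral
finite. *)
Lemma exponent_split (s p : R) (q : \bar R) : 0 <= s -> 1 <= p -> (1 <= q)%E ->
  exponent_condition (2 * s) p q ->
  exists b, [/\ 0 <= b <= 1, b * p < 1 &
    match q with
    | r%:E => (s - b) * r < 1
    | +oo%E => s <= b
    | -oo%E => False
    end].
Proof.
move=> s0 p1; have p0 : 0 < p by rewrite (lt_le_trans ltr01).
case: q => [r| |//] /= r1 h; last first.
  exists s; have sp : s * p < 1 by lra.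
  by split=> //; rewrite s0 /= (le_trans _ (ltW sp))// ler_peMr.
have {}r1 : 1 <= r by rewrite -lee_fin.
have r0 : 0 < r by rewrite (lt_le_trans ltr01).
have ip0 : 0 < p^-1 by rewrite invr_gt0.
have ip1 : p^-1 <= 1 by rewrite invf_le1.
have key : s - r^-1 < p^-1.
  rewrite ltrBlDr -(ltr_pM2r p0) mulrDl mulVf ?gt_eqF//.
  have [sp|sp] := ltP (s * p) 1.
    by apply: (lt_le_trans sp); rewrite lerDl mulr_ge0// ?invr_ge0 ltW.
  have h1 : (s * p - 1) * r < 1 by lra.
  have h2 : s * p - 1 < r^-1 by rewrite -[r^-1]mul1r ltr_pdivlMr.
  have h3 : r^-1 <= r^-1 * p by rewrite ler_peMr// invr_ge0 ltW.
  by lra.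
pose m := Num.max 0 (s - r^-1).
have m0 : 0 <= m by rewrite le_max lexx.
have m1 : s - r^-1 <= m by rewrite le_max lexx orbT.
have mp : m < p^-1 by rewrite gt_max ip0.
(* Any number strictly between m and 1/p would do. *)
clearbody m; exists ((m + p^-1) / 2); split.
- by apply/andP; split; lra.
- by rewrite -ltr_pdivlMr// mul1r; lra.
- by rewrite -ltr_pdivlMr// mul1r; lra.
Qed.

(** The plane concentration factor is bounded by a product of one-dimensional
ones, since (d + x) (d + y) <= 2 (d^2 + x^2 + y^2) for d, x, y >= 0. *)
Lemma concentration_le (e a b : R) : 0 < e ->
  e / (e + (a ^+ 2 + b ^+ 2)) <=
  2 * e / ((Num.sqrt e + `|a|) * (Num.sqrt e + `|b|)).
Proof.
move=> e0; have s0 : 0 < Num.sqrt e by rewrite sqrtr_gt0.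
have se : Num.sqrt e ^+ 2 = e by rewrite sqr_sqrtr// ltW.
have a0 := normr_ge0 a; have b0 := normr_ge0 b.
rewrite -(real_normK (num_real a)) -(real_normK (num_real b)).
rewrite ler_pdivrMr; last by rewrite ltr_wpDr// addr_ge0// sqr_ge0.
rewrite mulrAC ler_pdivlMr; last by rewrite mulr_gt0// ltr_wpDr.
rewrite -!mulrA [leRHS]mulrCA ler_pM2l//.
move: a0 b0 s0 se; move: (Num.sqrt e) (`|a|) (`|b|) => d x y x0 y0 d0 <-.
have := sqr_ge0 (d - x); have := sqr_ge0 (d - y); have := sqr_ge0 (x - y).
by nra.
Qed.

(** The factor r = e / (e + rho) is at most r^b because b <= 1. The L^p norm in
space of r^b is of order e^b, since r^(b p) is bounded by e^(b p) times a
product of two poles of exponent b p < 1. There remains e^(b - s), whose power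
q is integrable in time. *)
Lemma LqLp_concentrated (T C s p : R) (q : \bar R) (g : R -> vec3 R -> vec3 R) :
  0 < T -> 0 <= C -> 0 <= s -> 1 <= p -> (1 <= q)%E ->
  exponent_condition (2 * s) p q ->
  measurable_fun (`]0, T[ `*` @cylinder R) (fun z : R * vec3 R => g z.1 z.2) ->
  (forall t x, 0 < t < T -> cylinder x ->
    enorm (g t x) <= C * (T - t) `^ (- s) *
      ((T - t) / ((T - t) + (x.1.1 ^+ 2 + x.1.2 ^+ 2)))) ->
  LqLp T q p g.
Proof.
move=> T0 C0 s0 p1 q1 pq mg hg; split=> //.
have [b [/andP[b0 b1] bp bq]] := exponent_split s0 p1 q1 pq.
have p0 : 0 < p by rewrite (lt_le_trans ltr01).
have pn0 : p != 0 by rewrite gt_eqF.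
pose c := b * p.
have c1 : c < 1 by [].
have c0 : 0 <= c by rewrite mulr_ge0// ltW.
pose D := Num.sqrt T.
pose J := 2 * ((D + 1) `^ (1 - c) / (1 - c)).
have J0 : 0 <= J by rewrite mulr_ge0// divr_ge0 ?powR_ge0// subr_ge0 ltW.
pose K t := C * (T - t) `^ (- s) * (2 * (T - t)) `^ b.
have K0 t : 0 <= K t by rewrite !mulr_ge0// powR_ge0.
pose chi : R -> R := \1_(`[0, 1]%classic).
have chi0 y : 0 <= chi y by rewrite /chi indicE.
have mchi : measurable_fun setT chi by exact: measurable_indic.
have Ichi : (\int[lam]_y (chi y)%:E = 1)%E.
  rewrite integral_indic// setIT.
  apply: (eq_trans (lebesgue_measure_itv _)).
  by rewrite /= lte_fin ltr01 sube0.
have bound t : 0 < t < T ->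
    (Lp_cylinder p%:E (g t) <= (K t * (J * J) `^ p^-1)%:E)%E.
  move=> tT; have /andP[t0 t1] := tT.
  have e0 : 0 < T - t by rewrite subr_gt0.
  pose d := Num.sqrt (T - t).
  have d0 : 0 < d by rewrite sqrtr_gt0.
  have dD : d <= D by rewrite ler_sqrt; lra.
  rewrite /Lp_cylinder unlock.
  apply: (@le_trans _ _ (((K t) `^ p * (J * J))%:E `^ p^-1)%E); last first.
    rewrite poweR_EFin lee_fin powRM; [|exact: powR_ge0|exact: mulr_ge0].
    by rewrite -powRrM mulfV// powRr1.
  apply: gt0_ler_poweR.
  - by rewrite invr_ge0 ltW.
  - by rewrite in_itv/= leey andbT; apply: integral_ge0 => x _; exact: poweR_ge0.
  - by rewrite in_itv/= leey andbT lee_fin; apply: mulr_ge0; [exact: powR_ge0|exact: mulr_ge0].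
  apply: (@le_trans _ _ (\int[leb3 R]_x
    ((K t) `^ p * (pole d c x.1.1 * pole d c x.1.2 * chi x.2))%:E)%E).
    apply: ge0_le_integralT => x; first exact: poweR_ge0.
    rewrite patchE; case: ifPn => [|_]; last first.
      rewrite abse0 poweR0r// lee_fin !mulr_ge0 ?powR_ge0//; exact: pole_ge0.
    rewrite inE => Dx; have [/andP[x1 x1'] /andP[x2 x2'] x3] := cylinder_bounds Dx.
    have en0 : 0 <= enorm (g t x) by exact: sqrtr_ge0.
    rewrite abse_EFin ger0_norm// poweR_EFin lee_fin.
    rewrite /pole !patchE /chi indicE !mem_set/= ?in_itv/= ?x1 ?x2 ?x3 ?x1' ?x2'//.
    rewrite mulr1.
    have den : 0 < T - t + (x.1.1 ^+ 2 + x.1.2 ^+ 2).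
      by rewrite ltr_wpDr// addr_ge0// sqr_ge0.
    have hgx := hg t x tT Dx.
    pose r := (T - t) / (T - t + (x.1.1 ^+ 2 + x.1.2 ^+ 2)).
    have r0 : 0 < r by rewrite divr_gt0.
    have r1 : r <= 1 by rewrite ler_pdivrMr// mul1r lerDl addr_ge0// sqr_ge0.
    have rb : r <= r `^ b by apply: ger1_powR => //; rewrite r0.
    have A0 : 0 <= C * (T - t) `^ (- s) by rewrite mulr_ge0// powR_ge0.
    have h1 : enorm (g t x) <= C * (T - t) `^ (- s) * r `^ b.
      by apply: (le_trans hgx); apply: ler_wpM2l.
    have h2 : enorm (g t x) `^ p <= (C * (T - t) `^ (- s)) `^ p * r `^ c.
      rewrite /c powRrM -powRM ?powR_ge0//.
      apply: (ge0_ler_powR (ltW p0)) h1; rewrite nnegrE//.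
      by apply: mulr_ge0 => //; exact: powR_ge0.
    apply: (le_trans h2).
    have -> : K t `^ p = (C * (T - t) `^ (- s)) `^ p * (2 * (T - t)) `^ c.
      by rewrite /K powRM ?powR_ge0// -powRrM.
    rewrite -mulrA; apply: ler_wpM2l; first exact: powR_ge0.
    have pa : 0 < d + `|x.1.1| by rewrite ltr_wpDr.
    have pb : 0 < d + `|x.1.2| by rewrite ltr_wpDr.
    have h3 : r <= 2 * (T - t) * ((d + `|x.1.1|)^-1 * (d + `|x.1.2|)^-1).
      by apply: (le_trans (concentration_le _ _ e0)); rewrite -invfM.
    have h4 : r `^ c <= (2 * (T - t) * ((d + `|x.1.1|)^-1 * (d + `|x.1.2|)^-1)) `^ c.
      apply: ge0_ler_powR => //; rewrite ?nnegrE; first exact: ltW.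
      by rewrite !mulr_ge0 ?invr_ge0 ?(ltW e0) ?(ltW pa) ?(ltW pb).
    apply: (le_trans h4).
    rewrite !powRM ?mulr_ge0 ?invr_ge0 ?(ltW e0) ?(ltW pa) ?(ltW pb)//.
    rewrite -!powR_inv1 ?(ltW pa) ?(ltW pb)// -!powRrM !mulN1r.
    by [].
  under eq_integral do rewrite EFinM.
  have mprod : measurable_fun setT (fun x : (measurableTypeR R * measurableTypeR R * measurableTypeR R)%type =>
      (pole d c x.1.1 * pole d c x.1.2 * chi x.2)%:E).
    apply/measurable_EFinP; apply: measurable_funM; last first.
      exact: (measurableT_comp mchi measurable_snd).
    apply: measurable_funM.
      exact: (measurableT_comp (pole_measurable d c)
        (measurableT_comp measurable_fst measurable_fst)).
    exact: (measurableT_comp (pole_measurable d c)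
      (measurableT_comp measurable_snd measurable_fst)).
  rewrite ge0_integralZl_EFin ?powR_ge0//; last first.
    by move=> x _; rewrite lee_fin !mulr_ge0// pole_ge0.
  rewrite tonelli3 ?Ichi ?mule1//; last first.
  - by move=> y; exact: pole_ge0.
  - by move=> y; exact: pole_ge0.
  - exact: pole_measurable.
  - exact: pole_measurable.
  rewrite EFinM; apply: lee_pmul => //; first by rewrite lee_fin powR_ge0.
    by rewrite mule_ge0//; apply: integral_ge0 => y _; rewrite lee_fin pole_ge0.
  have Ip : (\int[lam]_y (pole d c y)%:E <= J%:E)%E.
    by apply: pole_integral_le => //; rewrite d0.
  rewrite EFinM; apply: lee_pmul => //;
    by apply: integral_ge0 => y _; rewrite lee_fin pole_ge0.
pose M := C * 2 `^ b * (J * J) `^ p^-1.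
have M0 : 0 <= M by rewrite !mulr_ge0 ?powR_ge0.
pose k : R -> \bar R := (fun t => (M * (T - t) `^ (- (s - b)))%:E) \_ `[0, T[.
have k0 t : (0 <= k t)%E.
  by apply: erestrict_ge0 => y _; rewrite lee_fin mulr_ge0 ?powR_ge0.
apply: (@le_lt_trans _ _ ('N[lam]_q[k])%E).
  apply: le_Lnorm => // t; rewrite patchE; case: ifPn => [|_]; last by rewrite abse0.
  rewrite inE/= in_itv/= => /andP[t0 t1].
  rewrite gee0_abs; last exact: Lnorm_ge0.
  rewrite /k patchE mem_set/= ?in_itv/= ?t1 ?(ltW t0)//.
  apply: (le_trans (bound t _)); first by rewrite t0.
  have e0 : 0 < T - t by rewrite subr_gt0.
  rewrite lee_fin /K /M powRM ?(ltW e0)// opprB powRD; last first.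
    by apply/implyP => _; rewrite gt_eqF.
  by rewrite le_eqVlt; apply/orP; left; apply/eqP; ring.
rewrite unlock; case: q q1 pq bq => [r| |//] /= q1 pq bq.
  have r1 : 1 <= r by rewrite -lee_fin.
  have r0 : 0 < r by rewrite (lt_le_trans ltr01).
  apply: poweR_lty.
  pose S0 : set R := `[0, T[%classic; pose m := M `^ r.
  pose h (t : R) := (T - t) `^ (- ((s - b) * r)).
  apply: (@le_lt_trans _ _ (\int[lam]_y ((fun t => m%:E * (h t)%:E) \_ S0) y)%E).
    apply: ge0_le_integralT => t; first exact: poweR_ge0.
    rewrite /k !patchE; case: ifPn => _; last by rewrite abse0 poweR0r ?gt_eqF.
    rewrite abse_EFin ger0_norm ?mulr_ge0 ?powR_ge0// poweR_EFin.
    by rewrite powRM ?powR_ge0// -powRrM mulNr EFinM.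
  rewrite -integral_mkcond ge0_integralZl_EFin ?powR_ge0//; first last.
  - rewrite /h; under eq_fun do rewrite -mulN1r; exact: affine_powR_measurable.
  - by move=> t _; rewrite lee_fin powR_ge0.
  - exact: measurable_itv.
  apply: lte_mul_pinfty.
  - by rewrite lee_fin powR_ge0.
  - by [].
  - exact: time_powR_integral_lty.
case: ifPn => // _; apply: (@le_lt_trans _ _ (M * T `^ (b - s))%:E); last exact: ltry.
apply/ess_supP; apply: nearW => t /=.
rewrite gee0_abs// /k patchE; case: ifPn => [|_]; last by rewrite lee_fin mulr_ge0 ?powR_ge0.
rewrite inE/= in_itv/= => /andP[t0 t1]; rewrite lee_fin opprB.
apply: ler_wpM2l => //; apply: ge0_ler_powR;
  rewrite ?nnegrE ?subr_ge0 ?(ltW T0) ?(ltW t1)// gerBl ?t0//.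
Qed.

End MixedNorm.

(** * Elementary functions *)

Section Pairs.
Context {R : realType}.

Lemma is_derive_pair (V W X : normedModType R) (f : V -> W) (g : V -> X) (x e : V) df dg :
  is_derive x e f df -> is_derive x e g dg ->
  is_derive x e (fun y => (f y, g y)) (df, dg).
Proof.
move=> [df1 <-] [dg1 <-].
have h : (fun h : R => h^-1 *: ((f (h *: e + x), g (h *: e + x)) - (f x, g x))) @ 0^'
    --> ('D_e f x, 'D_e g x).
  exact: (cvg_pair df1 dg1).
apply: DeriveDef; first by apply/cvg_ex; exists ('D_e f x, 'D_e g x).
exact/cvg_lim.
Qed.

(** A derivative in direction e is a derivative of one variable along a line,
where the rules of calculus apply to explicit formulas. *)
Lemma derive_line (V W : normedModType R) (g : V -> W) (c : R -> V) (s : R) e d :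
  (forall h, c (h + s) = h *: e + c s) ->
  is_derive s 1 (fun s => g (c s)) d -> 'D_e g (c s) = d.
Proof.
move=> ce [_ <-]; rewrite /derive; under [in RHS]eq_fun => h.
  rewrite /= /GRing.scale/= mulr1 ce; over.
by [].
Qed.

Lemma derive_coord1 (W : normedModType R) (g : vec3 R -> W) (x : vec3 R) d :
  is_derive x.1.1 1 (fun s => g (s, x.1.2, x.2)) d -> 'D_(e1 R) g x = d.
Proof.
case: x => [[a b] c] /= dg.
apply: (@derive_line _ _ g (fun s => (s, b, c)) a (e1 R)) dg => h.
transitivity (h * 1 + a, h * 0 + b, h * 0 + c) => //.
by rewrite !mulr0 mulr1 !add0r.
Qed.

Lemma derive_coord2 (W : normedModType R) (g : vec3 R -> W) (x : vec3 R) d :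
  is_derive x.1.2 1 (fun s => g (x.1.1, s, x.2)) d -> 'D_(e2 R) g x = d.
Proof.
case: x => [[a b] c] /= dg.
apply: (@derive_line _ _ g (fun s => (a, s, c)) b (e2 R)) dg => h.
transitivity (h * 0 + a, h * 1 + b, h * 0 + c) => //.
by rewrite !mulr0 mulr1 !add0r.
Qed.

Lemma derive_coord3 (W : normedModType R) (g : vec3 R -> W) (x : vec3 R) d :
  is_derive x.2 1 (fun s => g (x.1, s)) d -> 'D_(e3 R) g x = d.
Proof.
case: x => [[a b] c] /= dg.
apply: (@derive_line _ _ g (fun s => (a, b, s)) c (e3 R)) dg => h.
transitivity (h * 0 + a, h * 0 + b, h * 1 + c) => //.
by rewrite !mulr0 mulr1 !add0r.
Qed.

End Pairs.

Lemma derive_coord3_cst {R : realType} (W : normedModType R) (g : vec3 R -> W)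
    (x : vec3 R) : (forall s, g (x.1, s) = g x) -> 'D_(e3 R) g x = 0.
Proof.
move=> gx; apply: derive_coord3; under eq_fun do rewrite gx.
exact: is_derive_cst.
Qed.

Section Elementary.
Context {R : realType} {V : normedModType R}.

(** Functions built from continuous linear forms by the field operations and
real powers, every base being positive on U. This class is stable under
directional derivatives, hence consists of smooth functions. *)
Inductive elementary (U : set V) : (V -> R) -> Prop :=
| elementary_cst c : elementary U (fun=> c)
| elementary_linear (L : {linear V -> R}) : continuous L -> elementary U L
| elementary_add f g : elementary U f -> elementary U g ->
    elementary U (fun z => f z + g z)
| elementary_mul f g : elementary U f -> elementary U g ->
    elementary U (fun z => f z * g z)
| elementary_inv f : elementary U f -> (forall z, U z -> 0 < f z) ->
    elementary U (fun z => (f z)^-1)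
| elementary_powR f a : elementary U f -> (forall z, U z -> 0 < f z) ->
    elementary U (fun z => f z `^ a).

Lemma elementary_differentiable (U : set V) f : elementary U f ->
  forall z, U z -> differentiable f z.
Proof.
elim=> [c|L cL|{}f g _ IHf _ IHg|{}f g _ IHf _ IHg|{}f _ IHf f0|{}f a _ IHf f0] z Uz.
- exact: differentiable_cst.
- exact: linear_differentiable.
- exact: (differentiableD (IHf z Uz) (IHg z Uz)).
- exact: (differentiableM (IHf z Uz) (IHg z Uz)).
- by apply: (differentiableV (IHf z Uz)); rewrite gt_eqF// f0.
- apply: (@differentiable_comp _ _ _ _ f (@powR R ^~ a)); first exact: IHf.
  have [dp _] := is_derive1_powR a (f0 z Uz).
  exact/derivable1_diffP.
Qed.

Lemma derive_powR_comp (f : V -> R) (z e : V) (a : R) : differentiable f z ->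
  0 < f z -> 'D_e (fun z => f z `^ a) z = a * f z `^ (a - 1) * 'D_e f z.
Proof.
move=> df fz; pose c (s : R) := s *: e + z.
have c0 : c 0 = z by rewrite /c scale0r add0r.
have ce h : c (h + 0) = h *: e + c 0 by rewrite addr0 c0.
rewrite -{1}c0; apply: (derive_line ce).
have dfc : is_derive (0 : R) (1 : R) (f \o c) ('D_e f z).
  by have := @is_derive_line _ _ _ f c 0 e ce; rewrite c0; apply; exact: diff_derivable.
have := @is_derive_powR_comp _ (f \o c) 0 a ('D_e f z).
by rewrite /= c0; apply.
Qed.

Lemma elementary_derive (U : set V) f (e : V) : elementary U f ->
  exists2 h, elementary U h & forall z, U z -> 'D_e f z = h z.
Proof.
move=> ef; have := ef.
elim=> [c|L cL|{ef}f g ef [df edf dfE] eg [dg edg dgE]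
  |{ef}f g ef [df edf dfE] eg [dg edg dgE]|{ef}f ef [df edf dfE] f0
  |{ef}f a ef [df edf dfE] f0].
- exists (fun=> 0); first exact: elementary_cst.
  by move=> z _; exact: derive_cst.
- exists (fun=> L e); first exact: elementary_cst.
  move=> z _; rewrite deriveE; last exact: linear_differentiable.
  by rewrite diff_lin.
- exists (fun z => df z + dg z); first exact: elementary_add.
  move=> z Uz; rewrite -dfE// -dgE//.
  by apply: deriveD; exact/diff_derivable/(elementary_differentiable _ Uz).
- exists (fun z => f z * dg z + g z * df z).
    by apply: elementary_add; apply: elementary_mul.
  move=> z Uz; rewrite -dfE// -dgE//.
  by apply: deriveM; exact/diff_derivable/(elementary_differentiable _ Uz).
- exists (fun z => (-1) * ((f z)^-1 * (f z)^-1) * df z).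
    apply: elementary_mul => //; apply: elementary_mul; first exact: elementary_cst.
    by apply: elementary_mul; exact: elementary_inv.
  move=> z Uz; rewrite -dfE// deriveV ?gt_eqF ?f0//; last first.
    exact/diff_derivable/(elementary_differentiable ef Uz).
  by rewrite /GRing.scale/= expr2 invfM mulN1r.
- exists (fun z => a * f z `^ (a - 1) * df z).
    apply: elementary_mul => //; apply: elementary_mul; first exact: elementary_cst.
    exact: elementary_powR.
  move=> z Uz; rewrite -dfE//; apply: derive_powR_comp; last exact: f0.
  exact: (elementary_differentiable ef Uz).
Qed.

Lemma elementary_smooth (U : set V) f : open U -> elementary U f ->
  smooth_open U f.
Proof.
move=> oU; apply: (smooth_open_class oU) => [g eg z|g e eg].
  exact: elementary_differentiable.
exact: elementary_derive.
Qed.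

Lemma elementary_smooth_vec3 (U : set V) f1 f2 f3 : open U ->
  elementary U f1 -> elementary U f2 -> elementary U f3 ->
  smooth_open U (fun z => (f1 z, f2 z, f3 z) : vec3 R).
Proof.
move=> oU e1 e2 e3.
apply: (@smooth_open_class _ _ _ U (fun g => exists f1 f2 f3,
  [/\ elementary U f1, elementary U f2, elementary U f3 &
      g = fun z => (f1 z, f2 z, f3 z)])) => //.
- move=> _ [g1 [g2 [g3 [h1 h2 h3 ->]]]] z Uz.
  apply: differentiable_pair; last exact: elementary_differentiable Uz.
  by apply: differentiable_pair; exact: elementary_differentiable Uz.
- move=> _ e [g1 [g2 [g3 [h1 h2 h3 ->]]]].
  have [k1 ek1 k1E] := elementary_derive e h1.
  have [k2 ek2 k2E] := elementary_derive e h2.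
  have [k3 ek3 k3E] := elementary_derive e h3.
  exists (fun z => (k1 z, k2 z, k3 z)); first by exists k1, k2, k3.
  move=> z Uz; rewrite -k1E// -k2E// -k3E//.
  have D (g : V -> R) : elementary U g -> is_derive z e g ('D_e g z).
    by move=> eg; exact/derivableP/diff_derivable/(elementary_differentiable eg Uz).
  by have [] := is_derive_pair (is_derive_pair (D _ h1) (D _ h2)) (D _ h3).
- by exists f1, f2, f3.
Qed.

End Elementary.

Section ElementaryRules.
Context {R : realType} {V : normedModType R} (U : set V).

Lemma elementary_opp f : elementary U f -> elementary U (fun z => - f z).
Proof.
move=> ef; rewrite (_ : (fun z => - f z) = fun z => (-1) * f z).
  by apply: elementary_mul => //; exact: elementary_cst.
by apply/funext => z; rewrite mulN1r.
Qed.

Lemma elementary_exp f n : elementary U f -> elementary U (fun z => f z ^+ n).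
Proof.
move=> ef; elim: n => [|n IH].
  by under eq_fun do rewrite expr0; exact: elementary_cst.
by under eq_fun do rewrite exprS; exact: elementary_mul.
Qed.

End ElementaryRules.

Ltac prove_elementary :=
  first [refine (elementary_cst _ _)|
  lazymatch goal with
  | |- elementary ?U (fun z => @?f z + @?g z) =>
      apply: (@elementary_add _ _ U f g); prove_elementary
  | |- elementary ?U (fun z => - @?f z) =>
      apply: (@elementary_opp _ _ U f); prove_elementary
  | |- elementary ?U (fun z => @?f z * @?g z) =>
      apply: (@elementary_mul _ _ U f g); prove_elementary
  | |- elementary ?U (fun z => @?f z ^+ ?n) =>
      apply: (@elementary_exp _ _ U f n); prove_elementary
  | |- elementary ?U (fun z => (@?f z)^-1) =>
      apply: (@elementary_inv _ _ U f); [prove_elementary|]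
  | |- elementary ?U (fun z => (@?f z) `^ ?a) =>
      apply: (@elementary_powR _ _ U f a); [prove_elementary|]
  | |- _ => idtac
  end].

(** * The swirl and its spatial derivatives *)

Lemma vec3_addE {R : realType} (a b c a' b' c' : R) :
  (a, b, c) + (a', b', c') = (a + a', b + b', c + c') :> vec3 R.
Proof. by []. Qed.

Lemma vec3_scaleE {R : realType} (k a b c : R) :
  k *: ((a, b, c) : vec3 R) = (k * a, k * b, k * c).
Proof. by []. Qed.

Lemma add3_congr (V : nmodType) (a b c a' b' c' : V) :
  a = a' -> b = b' -> c = c' -> a + b + c = a' + b' + c'.
Proof. by move=> -> -> ->. Qed.

Section Swirl.
Context {R : realType} (A K e : R) (e_gt0 : 0 < e).

(** The denominator that concentrates the swirl in a core of radius sqrt e. *)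
Definition core (a b : R) : R := e + (a ^+ 2 + b ^+ 2).

Lemma core_gt0 a b : 0 < core a b.
Proof. by rewrite /core ltr_wpDr// addr_ge0 ?sqr_ge0. Qed.

Lemma core_sym a b : core a b = core b a.
Proof. by rewrite /core (addrC (a ^+ 2)). Qed.

Lemma is_derive_core (a b : R) n :
  is_derive a 1 (fun s => (core s b)^-1 ^+ n.+1)
    (- (2 * n.+1%:R) * a * (core a b)^-1 ^+ n.+2).
Proof.
have c0 := core_gt0 a b.
have h : is_derive a 1 (fun s => core s b) (2 * a).
  by apply: is_derive_eq; rewrite /GRing.scale/=; ring.
have h' : is_derive a 1 (fun s => (core s b)^-1) (- (core a b) ^- 2 * (2 * a)).
  by apply: is_derive_inv_comp => //; rewrite gt_eqF.
rewrite -(exprfctE (fun s => (core s b)^-1)).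
apply: is_derive_eq; rewrite /GRing.scale/= -exprVn !exprS; ring.
Qed.

Lemma is_derive_core_sym (a b : R) n :
  is_derive b 1 (fun s => (core a s)^-1 ^+ n.+1)
    (- (2 * n.+1%:R) * b * (core a b)^-1 ^+ n.+2).
Proof.
rewrite core_sym; under eq_fun do rewrite core_sym.
exact: is_derive_core.
Qed.

Definition swirl (x : vec3 R) : vec3 R :=
  (- (x.1.2 * (A * ((core x.1.1 x.1.2)^-1 ^+ 2 - K))),
   x.1.1 * (A * ((core x.1.1 x.1.2)^-1 ^+ 2 - K)), 0).

Definition swirl1 (x : vec3 R) : vec3 R :=
  (4 * A * x.1.1 * x.1.2 * (core x.1.1 x.1.2)^-1 ^+ 3,
   A * ((core x.1.1 x.1.2)^-1 ^+ 2 - K - 4 * x.1.1 ^+ 2 * (core x.1.1 x.1.2)^-1 ^+ 3), 0).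

Definition swirl2 (x : vec3 R) : vec3 R :=
  (- (A * ((core x.1.1 x.1.2)^-1 ^+ 2 - K - 4 * x.1.2 ^+ 2 * (core x.1.1 x.1.2)^-1 ^+ 3)),
   - (4 * A * x.1.1 * x.1.2 * (core x.1.1 x.1.2)^-1 ^+ 3), 0).

Lemma derive_swirl1 : 'D_(e1 R) swirl = swirl1.
Proof.
apply/funext => -[[a b] c]; apply: derive_coord1; rewrite /swirl/swirl1/=.
have h2 := is_derive_core a b 1.
apply: is_derive_pair; first apply: is_derive_pair.
- by apply: is_derive_eq; rewrite /GRing.scale/=; ring.
- by apply: is_derive_eq; rewrite /GRing.scale/=; ring.
Qed.

Lemma derive_swirl2 : 'D_(e2 R) swirl = swirl2.
Proof.
apply/funext => -[[a b] c]; apply: derive_coord2; rewrite /swirl/swirl2/=.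
have h2 := is_derive_core_sym a b 1.
apply: is_derive_pair; first apply: is_derive_pair.
- by apply: is_derive_eq; rewrite /GRing.scale/=; ring.
- by apply: is_derive_eq; rewrite /GRing.scale/=; ring.
Qed.

Lemma derive_swirl3 : 'D_(e3 R) swirl = fun=> 0.
Proof.
by apply/funext => -[[a b] c]; exact: derive_coord3_cst.
Qed.

Lemma derive_swirl11 x : 'D_(e1 R) swirl1 x =
  (4 * A * x.1.2 * (core x.1.1 x.1.2)^-1 ^+ 3
     - 24 * A * x.1.1 ^+ 2 * x.1.2 * (core x.1.1 x.1.2)^-1 ^+ 4,
   - (12 * A * x.1.1 * (core x.1.1 x.1.2)^-1 ^+ 3)
     + 24 * A * x.1.1 ^+ 3 * (core x.1.1 x.1.2)^-1 ^+ 4, 0).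
Proof.
case: x => -[a b] c; apply: derive_coord1; rewrite /swirl1/=.
have h2 := is_derive_core a b 1; have h3 := is_derive_core a b 2.
apply: is_derive_pair; first apply: is_derive_pair.
- by apply: is_derive_eq; rewrite /GRing.scale/=; ring.
- by apply: is_derive_eq; rewrite /GRing.scale/=; ring.
Qed.

Lemma derive_swirl22 x : 'D_(e2 R) swirl2 x =
  (12 * A * x.1.2 * (core x.1.1 x.1.2)^-1 ^+ 3
     - 24 * A * x.1.2 ^+ 3 * (core x.1.1 x.1.2)^-1 ^+ 4,
   - (4 * A * x.1.1 * (core x.1.1 x.1.2)^-1 ^+ 3)
     + 24 * A * x.1.1 * x.1.2 ^+ 2 * (core x.1.1 x.1.2)^-1 ^+ 4, 0).
Proof.
case: x => -[a b] c; apply: derive_coord2; rewrite /swirl2/=.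
have h2 := is_derive_core_sym a b 1; have h3 := is_derive_core_sym a b 2.
apply: is_derive_pair; first apply: is_derive_pair.
- by apply: is_derive_eq; rewrite /GRing.scale/=; ring.
- by apply: is_derive_eq; rewrite /GRing.scale/=; ring.
Qed.

Lemma laplacian_swirl x : laplacian swirl x =
  (- (x.1.2 * (A * (- 16 * (core x.1.1 x.1.2)^-1 ^+ 3
        + 24 * (x.1.1 ^+ 2 + x.1.2 ^+ 2) * (core x.1.1 x.1.2)^-1 ^+ 4))),
   x.1.1 * (A * (- 16 * (core x.1.1 x.1.2)^-1 ^+ 3
        + 24 * (x.1.1 ^+ 2 + x.1.2 ^+ 2) * (core x.1.1 x.1.2)^-1 ^+ 4)), 0).
Proof.
have E1 := etrans (congr1 (fun g => 'D_(e1 R) g x) derive_swirl1) (derive_swirl11 x).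
have E2 := etrans (congr1 (fun g => 'D_(e2 R) g x) derive_swirl2) (derive_swirl22 x).
have E3 : 'D_(e3 R) ('D_(e3 R) swirl) x = 0.
  by rewrite derive_swirl3; exact: derive_cst.
apply: (etrans (add3_congr E1 E2 E3)).
by rewrite addr0 vec3_addE; congr (_, _, _); ring.
Qed.

(** The antiderivative, in the squared distance to the axis, of half the square
of the angular speed A (core^-2 - K). *)
Definition swirl_pressure (x : vec3 R) : R :=
  A ^+ 2 / 2 * (- (core x.1.1 x.1.2)^-1 ^+ 3 / 3
    + 2 * K * (core x.1.1 x.1.2)^-1 ^+ 1 + K ^+ 2 * (x.1.1 ^+ 2 + x.1.2 ^+ 2)).

Lemma gradient_swirl_pressure x : gradient swirl_pressure x =
  (x.1.1 * (A ^+ 2 * ((core x.1.1 x.1.2)^-1 ^+ 2 - K) ^+ 2),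
   x.1.2 * (A ^+ 2 * ((core x.1.1 x.1.2)^-1 ^+ 2 - K) ^+ 2), 0).
Proof.
case: x => -[a b] c; rewrite /gradient/=; congr (_, _, _).
- apply: derive_coord1; rewrite /swirl_pressure/=.
  have h1 := is_derive_core a b 0; have h3 := is_derive_core a b 2.
  apply: is_derive_eq; rewrite /GRing.scale/=; field.
  by rewrite gt_eqF// core_gt0.
- apply: derive_coord2; rewrite /swirl_pressure/=.
  have h1 := is_derive_core_sym a b 0; have h3 := is_derive_core_sym a b 2.
  apply: is_derive_eq; rewrite /GRing.scale/=; field.
  by rewrite gt_eqF// core_gt0.
- by exact: derive_coord3_cst.
Qed.

(** Particles move on circles around the axis: the convection term is the
centripetal acceleration, which is radial. *)
Lemma convection_swirl x : convection swirl x = - gradient swirl_pressure x.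
Proof.
rewrite gradient_swirl_pressure.
have E1 := congr1 (fun g => (swirl x).1.1 *: g x) derive_swirl1.
have E2 := congr1 (fun g => (swirl x).1.2 *: g x) derive_swirl2.
have E3 := congr1 (fun g => (swirl x).2 *: g x) derive_swirl3.
apply: (etrans (add3_congr E1 E2 E3)); rewrite scaler0 addr0.
case: x {E1 E2 E3} => -[a b] c; rewrite /swirl1/swirl2/swirl !vec3_scaleE vec3_addE.
transitivity (- (a * (A ^+ 2 * ((core a b)^-1 ^+ 2 - K) ^+ 2)),
  - (b * (A ^+ 2 * ((core a b)^-1 ^+ 2 - K) ^+ 2)), - (0 : R)) => //.
by congr (_, _, _); rewrite /=; ring.
Qed.

Lemma divergence_swirl x : divergence swirl x = 0.
Proof.
have E1 := congr1 (fun g => (g x).1.1) derive_swirl1.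
have E2 := congr1 (fun g => (g x).1.2) derive_swirl2.
have E3 := congr1 (fun g => (g x).2) derive_swirl3.
apply: (etrans (add3_congr E1 E2 E3)); rewrite /swirl1/swirl2/=; ring.
Qed.

Lemma swirl_total_slip : navier_total_slip swirl.
Proof.
move=> x _; split=> // _; split.
  by exact: derive_coord3_cst.
by exact: derive_coord3_cst.
Qed.

Lemma swirl_no_slip : K = ((e + 1)^-1) ^+ 2 -> no_slip swirl.
Proof.
move=> KE x [x1 _].
have rho : x.1.1 ^+ 2 + x.1.2 ^+ 2 = 1.
  by rewrite -[LHS]sqr_sqrtr ?addr_ge0 ?sqr_ge0// -/(rad x) x1 expr1n.
by rewrite /swirl /core rho -KE subrr !mulr0 oppr0.
Qed.

End Swirl.

Section SwirlSize.
Context {R : realType}.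

Lemma enorm_swirl (a b B : R) :
  enorm (- (b * B), a * B, 0) = `|B| * Num.sqrt (a ^+ 2 + b ^+ 2).
Proof.
rewrite /enorm/= -sqrtr_sqr -sqrtrM ?sqr_ge0//; congr Num.sqrt; ring.
Qed.

(** The weight sqrt e absorbs the distance sqrt rho to the axis, as
sqrt e sqrt rho <= e + rho. *)
Lemma enorm_swirl_le (M e a b B : R) : 0 < e -> 0 <= M ->
  `|B| <= M * Num.sqrt e * (core e a b)^-1 ^+ 2 ->
  enorm (- (b * B), a * B, 0) <= M * (core e a b)^-1.
Proof.
move=> e0 M0 hB; rewrite enorm_swirl.
have c0 := core_gt0 e0 a b.
have q0 : 0 < (core e a b)^-1 by rewrite invr_gt0.
set w := Num.sqrt (a ^+ 2 + b ^+ 2); set u := Num.sqrt e.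
have w0 : 0 <= w by exact: sqrtr_ge0.
have u0 : 0 <= u by exact: sqrtr_ge0.
have uw : u * w <= core e a b.
  rewrite /core -[e]sqr_sqrtr ?(ltW e0)// -/u.
  rewrite -[X in _ <= _ + X]sqr_sqrtr ?addr_ge0 ?sqr_ge0// -/w.
  by have := sqr_ge0 (u - w); nra.
apply: (le_trans (ler_wpM2r w0 hB)).
have -> : M * u * (core e a b)^-1 ^+ 2 * w =
    M * (core e a b)^-1 * (u * w * (core e a b)^-1) by ring.
by rewrite ler_piMr ?mulr_ge0 ?(ltW q0)// ler_pdivrMr// mul1r.
Qed.

Lemma powR_split (e s : R) : 0 < e ->
  e `^ (2^-1 - s) = e `^ (- s) * Num.sqrt e /\
  e `^ (3 / 2 - s) = e `^ (2^-1 - s) * e /\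
  e `^ (- (s + 1)) = e `^ (- s) * e^-1.
Proof.
move=> e0; split; [|split].
- by rewrite addrC powRD ?powR12_sqrt ?(ltW e0)// (gt_eqF e0) implybT.
- have -> : 3 / 2 - s = 2^-1 - s + 1 by field.
  by rewrite powRD ?powRr1 ?(ltW e0)// (gt_eqF e0) implybT.
- have -> : - (s + 1) = - s + -1 by ring.
  by rewrite powRD ?powR_inv1 ?(ltW e0)// (gt_eqF e0) implybT.
Qed.

End SwirlSize.

(** * The forced solution *)

Section BlowUp.
Context {R : realType} (T s : R).

(** The exponent is fixed by the speed wanted where rho = e: there it is of
order sqrt e e^(3/2 - s) e^(-2) = e^(-s). *)
Definition amplitude (t : R) : R := (T - t) `^ (3 / 2 - s).
(** The value of core^-2 on the lateral surface, whose subtraction gives the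
no slip condition. *)
Definition boundary_value (t : R) : R := ((T - t + 1)^-1) ^+ 2.
Definition velocity (t : R) : vec3 R -> vec3 R :=
  swirl (amplitude t) (boundary_value t) (T - t).
Definition pressure (t : R) : vec3 R -> R :=
  swirl_pressure (amplitude t) (boundary_value t) (T - t).

Definition angular_speed_dt (t : R) (x : vec3 R) : R :=
  - ((3 / 2 - s) * (T - t) `^ (2^-1 - s))
    * ((core (T - t) x.1.1 x.1.2)^-1 ^+ 2 - boundary_value t)
  + amplitude t * (2 * (core (T - t) x.1.1 x.1.2)^-1 ^+ 3
                   - 2 * (T - t + 1)^-1 ^+ 3).
Definition angular_force (t : R) (x : vec3 R) : R :=
  amplitude t * (- 16 * (core (T - t) x.1.1 x.1.2)^-1 ^+ 3
    + 24 * (x.1.1 ^+ 2 + x.1.2 ^+ 2) * (core (T - t) x.1.1 x.1.2)^-1 ^+ 4)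
  - angular_speed_dt t x.
Definition force (t : R) (x : vec3 R) : vec3 R :=
  (- (x.1.2 * angular_force t x), x.1.1 * angular_force t x, 0).

Lemma is_derive_inv_sqr_backward (t c : R) : 0 < T - t + c ->
  is_derive t 1 (fun t => (T - t + c)^-1 ^+ 2) (2 * (T - t + c)^-1 ^+ 3).
Proof.
move=> c0.
have h : is_derive t 1 (fun t => T - t + c) (-1).
  by apply: is_derive_eq; ring.
have h' : is_derive t 1 (fun t => (T - t + c)^-1) (- (T - t + c) ^- 2 * -1).
  by apply: is_derive_inv_comp => //; rewrite gt_eqF.
rewrite -(exprfctE (fun t => (T - t + c)^-1)).
by apply: is_derive_eq; rewrite /GRing.scale/= -exprVn; ring.
Qed.

Lemma is_derive_amplitude (t : R) : t < T ->
  is_derive t 1 amplitude (- ((3 / 2 - s) * (T - t) `^ (2^-1 - s))).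
Proof.
move=> tT; have h : is_derive t 1 (fun t => T - t) (-1).
  by apply: is_derive_eq; ring.
have e0 : 0 < T - t by rewrite subr_gt0.
have h' := @is_derive_powR_comp R (fun t => T - t) t (3 / 2 - s) _ e0 h.
by apply: (is_derive_eq h'); rewrite mulrN1; congr (- (_ * _ `^ _)); field.
Qed.

Lemma velocity_dt (t : R) (x : vec3 R) : t < T ->
  derive1 (fun t => velocity t x) t =
  (- (x.1.2 * angular_speed_dt t x), x.1.1 * angular_speed_dt t x, 0).
Proof.
case: x => -[a b] c tT; rewrite derive1E /velocity/swirl/=.
have hA := is_derive_amplitude tT.
have hq : is_derive t 1 (fun t => (core (T - t) a b)^-1 ^+ 2)
    (2 * (core (T - t) a b)^-1 ^+ 3).
  apply: is_derive_inv_sqr_backward.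
  by apply: core_gt0; rewrite subr_gt0.
have hK : is_derive t 1 boundary_value (2 * (T - t + 1)^-1 ^+ 3).
  by apply: is_derive_inv_sqr_backward; lra.
rewrite /angular_speed_dt/=.
suff h : is_derive t 1 (fun t =>
    (- (b * (amplitude t * ((core (T - t) a b)^-1 ^+ 2 - boundary_value t))),
     a * (amplitude t * ((core (T - t) a b)^-1 ^+ 2 - boundary_value t)), 0 : R) : vec3 R)
  (- (b *
    (- ((3 / 2 - s) * (T - t) `^ (2^-1 - s)) *
     ((core (T - t) a b)^-1 ^+ 2 - boundary_value t) +
     amplitude t * (2 * (core (T - t) a b)^-1 ^+ 3 - 2 * (T - t + 1)^-1 ^+ 3))),
   a *
   (- ((3 / 2 - s) * (T - t) `^ (2^-1 - s)) *
    ((core (T - t) a b)^-1 ^+ 2 - boundary_value t) +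
    amplitude t * (2 * (core (T - t) a b)^-1 ^+ 3 - 2 * (T - t + 1)^-1 ^+ 3)), 0).
  by have [_] := h.
apply: is_derive_pair; first apply: is_derive_pair.
- by apply: is_derive_eq; rewrite /GRing.scale/=; ring.
- by apply: is_derive_eq; rewrite /GRing.scale/=; ring.
Qed.

(** Pressure and convection cancel, and the force is by definition the
Laplacian minus the time derivative. *)
Lemma velocity_navier_stokes : navier_stokes T force velocity pressure.
Proof.
move=> t x [/= + _]; rewrite in_itv/= => /andP[_ tT].
have e0 : 0 < T - t by rewrite subr_gt0.
split; last exact: divergence_swirl.
have -> : convection (velocity t) x = - gradient (pressure t) x.
  exact: convection_swirl.
have -> : laplacian (velocity t) x = _ := laplacian_swirl _ _ e0 x.
rewrite opprK addrK (velocity_dt x tT) /force /angular_force.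
move: (angular_speed_dt t x) => d.
case: x => -[a b] c.
set l := amplitude t * _.
transitivity (- (b * l) - - (b * d), a * l - a * d, (0 : R) - 0) => //.
by congr (_, _, _); rewrite /=; ring.
Qed.

Definition before : set (R * vec3 R) := [set z | z.1 < T].

Lemma open_before : open before.
Proof.
have -> : before = fst @^-1` [set t | t < T] by [].
by apply: open_comp; [move=> z _; exact: cvg_fst|exact: open_lt].
Qed.

Lemma spacetime_before : spacetime T `<=` before.
Proof. by move=> -[t x] [/=]; rewrite in_itv/= => /andP[_]. Qed.

Definition time_form : {linear (R * vec3 R)%type -> R} := fst.
Definition coord1_form : {linear (R * vec3 R)%type -> R} := @coord1 R \o snd.
Definition coord2_form : {linear (R * vec3 R)%type -> R} := @coord2 R \o snd.

Lemma elementary_time : elementary before (fun z : R * vec3 R => z.1).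
Proof. by apply: (@elementary_linear _ _ _ time_form) => z; exact: cvg_fst. Qed.

Lemma elementary_coord1 : elementary before (fun z : R * vec3 R => z.2.1.1).
Proof.
apply: (@elementary_linear _ _ _ coord1_form) => z.
have h : (fun w : R * vec3 R => w.2) @ z --> z.2 by exact: cvg_snd.
exact: (cvg_comp _ _ h (@coord1C R z.2)).
Qed.

Lemma elementary_coord2 : elementary before (fun z : R * vec3 R => z.2.1.2).
Proof.
apply: (@elementary_linear _ _ _ coord2_form) => z.
have h : (fun w : R * vec3 R => w.2) @ z --> z.2 by exact: cvg_snd.
exact: (cvg_comp _ _ h (@coord2C R z.2)).
Qed.

End BlowUp.

Lemma before_gt0 {R : realType} (T : R) (z : R * vec3 R) : before T z -> 0 < T - z.1.
Proof. by rewrite /before/= subr_gt0. Qed.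

Lemma before_core_gt0 {R : realType} (T : R) (z : R * vec3 R) : before T z ->
  0 < T - z.1 + (z.2.1.1 ^+ 2 + z.2.1.2 ^+ 2).
Proof. by move=> /before_gt0 e0; exact: core_gt0. Qed.

Lemma before_shift_gt0 {R : realType} (T : R) (z : R * vec3 R) : before T z ->
  0 < T - z.1 + 1.
Proof. by move=> /before_gt0 e0; rewrite addr_gt0. Qed.

Ltac prove_before_elementary :=
  prove_elementary;
  first [exact: elementary_time | exact: elementary_coord1
        | exact: elementary_coord2 | exact: before_gt0
        | exact: before_core_gt0 | exact: before_shift_gt0].

Section Regularity.
Context {R : realType} (T s : R).
Local Notation U := (@before R T).

Lemma velocity_smooth :
  smooth_on (spacetime T) (fun z => velocity T s z.1 z.2).
Proof.
exists U; split; [exact: open_before|exact: spacetime_before|].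
rewrite /velocity/swirl/amplitude/boundary_value/core.
by apply: elementary_smooth_vec3; [exact: open_before|..]; prove_before_elementary.
Qed.

Lemma force_smooth :
  smooth_on (spacetime T) (fun z => force T s z.1 z.2).
Proof.
exists U; split; [exact: open_before|exact: spacetime_before|].
rewrite /force/angular_force/angular_speed_dt/amplitude/boundary_value/core.
by apply: elementary_smooth_vec3; [exact: open_before|..]; prove_before_elementary.
Qed.

Lemma pressure_smooth :
  smooth_on (spacetime T) (fun z => pressure T s z.1 z.2).
Proof.
exists U; split; [exact: open_before|exact: spacetime_before|].
rewrite /pressure/swirl_pressure/amplitude/boundary_value/core.
by apply: elementary_smooth; [exact: open_before|]; prove_before_elementary.
Qed.

Lemma smooth_measurable (g : R -> vec3 R -> vec3 R) :
  smooth_on (spacetime T) (fun z => g z.1 z.2) ->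
  measurable_fun (`]0, T[ `*` @cylinder R) (fun z : R * vec3 R => g z.1 z.2).
Proof.
move=> sg.
have mD : measurable (`]0, T[ `*` @cylinder R : set (R * vec3 R)).
  by apply: measurableX => //; exact: measurable_cylinder.
have m (L : {linear vec3 R -> R}) : continuous L ->
    measurable_fun (`]0, T[ `*` @cylinder R) (fun z : R * vec3 R => L (g z.1 z.2)).
  move=> cL; apply: continuous_measurable_time_vec3 => // z [/= z1 z2].
  have Sz : spacetime T z.
    by split=> //=; move: z1; rewrite !in_itv/= => /andP[/ltW -> ->].
  exact: (smooth_on_continuous (smooth_on_linear_comp cL sg) Sz).
have h1 := m (@coord1 R) (@coord1C R).
have h2 := m (@coord2 R) (@coord2C R).
have h3 := m (@coord3 R) (@coord3C R).
have h := measurable_fun_pair_on (measurable_fun_pair_on h1 h2) h3.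
apply: (eq_measurable_fun _ _ h) => z _ /=.
by rewrite /coord1/coord2/coord3/=; case: (g z.1 z.2) => -[].
Qed.

End Regularity.

Section Size.
Context {R : realType} (T s : R) (s_ge0 : 0 <= s) (s_le : s <= 1 / 2).

Lemma inv_core_bounds (e a b : R) : 0 < e -> a ^+ 2 + b ^+ 2 <= 1 ->
  let q := (core e a b)^-1 in
  [/\ 0 < q, 0 < (e + 1)^-1 <= q, 0 <= e * q <= 1 & 0 <= (a ^+ 2 + b ^+ 2) * q <= 1].
Proof.
move=> e0 ab q.
have ab0 : 0 <= a ^+ 2 + b ^+ 2 by rewrite addr_ge0 ?sqr_ge0.
have c0 := core_gt0 e0 a b.
have q0 : 0 < q by rewrite invr_gt0.
split=> //.
- by rewrite invr_gt0 lef_pV2 ?posrE// ?addr_gt0// /core lerD2l ab andbT.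
- by rewrite mulr_ge0 ?(ltW q0) ?(ltW e0)//= ler_pdivrMr// mul1r /core lerDl.
- by rewrite mulr_ge0 ?(ltW q0)//= ler_pdivrMr// mul1r /core lerDr ltW.
Qed.

Lemma cylinder_sqr (x : vec3 R) : cylinder x -> x.1.1 ^+ 2 + x.1.2 ^+ 2 <= 1.
Proof. by case; rewrite rad_le1. Qed.

Lemma velocity_size t x : 0 < t < T -> cylinder x ->
  enorm (velocity T s t x) <= 1 * (T - t) `^ (- s) *
    ((T - t) / ((T - t) + (x.1.1 ^+ 2 + x.1.2 ^+ 2))).
Proof.
case: x => -[a b] c /andP[_ tT] /cylinder_sqr/= ab.
have e0 : 0 < T - t by rewrite subr_gt0.
have [h1 [h2 _]] := powR_split s e0.
have [q0 /andP[k0 kq] _ _] := inv_core_bounds e0 ab.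
rewrite mul1r mulrA; apply: enorm_swirl_le => //.
  by rewrite mulr_ge0 ?powR_ge0 ?ltW.
rewrite /amplitude h2 h1 normrM ger0_norm; last first.
  by rewrite !mulr_ge0 ?powR_ge0 ?sqrtr_ge0 ?ltW.
have -> : (T - t) `^ (- s) * (T - t) * Num.sqrt (T - t) =
  (T - t) `^ (- s) * Num.sqrt (T - t) * (T - t) by ring.
apply: ler_wpM2l; first by rewrite !mulr_ge0 ?powR_ge0 ?sqrtr_ge0 ?ltW.
rewrite /boundary_value ger0_norm; first by rewrite gerBl sqr_ge0.
by rewrite subr_ge0 ler_sqr ?nnegrE ?(ltW k0) ?(ltW q0).
Qed.

(** Here q is the inverse of the core and k its value at rho = 1. Everything is
written with e q, rho q and e k, which lie in [0, 1]; the constant 46 is the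
sum 16 + 24 + 2 + 2 + 2 of the bounds on the coefficients. *)
Lemma angular_force_size (E e q k rho g : R) : 0 <= E -> 0 < q -> 0 < k <= q ->
  0 <= e * q <= 1 -> 0 <= rho * q <= 1 -> 0 <= e -> 0 <= g <= 2 ->
  `|E * e * (- 16 * q ^+ 3 + 24 * rho * q ^+ 4)
    - (- (g * E) * (q ^+ 2 - k ^+ 2) + E * e * (2 * q ^+ 3 - 2 * k ^+ 3))|
  <= 46 * (E * q ^+ 2).
Proof.
move=> E0 q0 /andP[k0 kq] /andP[x0 x1] /andP[y0 y1] e0 /andP[g0 g2].
have kk : k ^+ 2 <= q ^+ 2 by rewrite ler_sqr ?nnegrE ?(ltW k0) ?(ltW q0).
have -> : E * e * (- 16 * q ^+ 3 + 24 * rho * q ^+ 4)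
    - (- (g * E) * (q ^+ 2 - k ^+ 2) + E * e * (2 * q ^+ 3 - 2 * k ^+ 3)) =
  E * (- 18 * (e * q * q ^+ 2) + 24 * (e * q * (rho * q) * q ^+ 2)
       + g * (q ^+ 2 - k ^+ 2) + 2 * (e * k * k ^+ 2)) by ring.
rewrite normrM ger0_norm// [leRHS]mulrCA; apply: ler_wpM2l => //.
have damp (z Q : R) : 0 <= z <= 1 -> 0 <= Q -> 0 <= z * Q <= Q.
  by move=> /andP[z0 z1] Q0; rewrite mulr_ge0//= ler_piMl.
have x2 : 0 <= e * q * q ^+ 2 <= q ^+ 2 by rewrite damp ?sqr_ge0 ?x0.
have xy : 0 <= e * q * (rho * q) * q ^+ 2 <= q ^+ 2.
  by rewrite damp ?sqr_ge0// mulr_ge0//= mulr_ile1.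
have gd : 0 <= g * (q ^+ 2 - k ^+ 2) <= 2 * q ^+ 2.
  rewrite mulr_ge0 ?subr_ge0//= ler_pM ?subr_ge0//.
  by rewrite gerBl sqr_ge0.
have ek2 : 0 <= e * k * k ^+ 2 <= q ^+ 2.
  have ek : 0 <= e * k <= 1.
    rewrite mulr_ge0 ?(ltW k0)//=; apply: le_trans x1; exact: ler_wpM2l.
  by have /andP[-> h] := damp _ _ ek (sqr_ge0 k); exact: le_trans h kk.
move: x2 xy gd ek2; clear.
set X := _ * q ^+ 2; set Y := _ * _ * q ^+ 2; set G := g * _; set N := e * k * _.
move: X Y G N (q ^+ 2) => X Y G N Q /andP[? ?] /andP[? ?] /andP[? ?] /andP[? ?].
by rewrite ler_norml; apply/andP; split; lra.
Qed.

Lemma force_size t x : 0 < t < T -> cylinder x ->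
  enorm (force T s t x) <= 46 * (T - t) `^ (- (s + 1)) *
    ((T - t) / ((T - t) + (x.1.1 ^+ 2 + x.1.2 ^+ 2))).
Proof.
case: x => -[a b] c /andP[_ tT] /cylinder_sqr/= ab.
have e0 : 0 < T - t by rewrite subr_gt0.
have [h1 [h2 h3]] := powR_split s e0.
have [q0 k0 eq rq] := inv_core_bounds e0 ab.
have -> : 46 * (T - t) `^ (- (s + 1)) * ((T - t) / (T - t + (a ^+ 2 + b ^+ 2))) =
    46 * (T - t) `^ (- s) * (core (T - t) a b)^-1.
  rewrite h3 /core; field.
  by rewrite (gt_eqF e0)/= gt_eqF// (core_gt0 e0).
apply: enorm_swirl_le => //; first by rewrite mulr_ge0 ?powR_ge0.
rewrite /angular_force/angular_speed_dt/amplitude/boundary_value/=.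
have -> : 46 * (T - t) `^ (- s) * Num.sqrt (T - t) * (core (T - t) a b)^-1 ^+ 2 =
    46 * ((T - t) `^ (2^-1 - s) * (core (T - t) a b)^-1 ^+ 2) by rewrite h1; ring.
rewrite h2; apply: angular_force_size => //; rewrite ?powR_ge0 ?(ltW e0)//.
by move: s_ge0 s_le => *; apply/andP; split; lra.
Qed.

End Size.

(** * Blow up *)

Section Conclusion.
Context {R : realType} (T : R).
Implicit Types (t s : R).

Lemma enorm_continuous (X : topologicalType) (g : X -> vec3 R) x :
  {for x, continuous g} -> {for x, continuous (fun y => enorm (g y))}.
Proof.
move=> cg.
have c1 : {for x, continuous (fun y => (g y).1.1)} := cvg_comp _ _ cg (@coord1C R (g x)).
have c2 : {for x, continuous (fun y => (g y).1.2)} := cvg_comp _ _ cg (@coord2C R (g x)).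
have c3 : {for x, continuous (fun y => (g y).2)} := cvg_comp _ _ cg (@coord3C R (g x)).
have c : {for x, continuous (fun y => (g y).1.1 ^+ 2 + (g y).1.2 ^+ 2 + (g y).2 ^+ 2)}.
  by apply: continuous_addf; [apply: continuous_addf|]; exact: continuous_sqrf.
exact: (cvg_comp _ _ c (@sqrt_continuous R _)).
Qed.

(** At distance sqrt e from the axis the core equals 2 e, so that the speed is
e^(-s) (1/4 - e^2 (e + 1)^-2), and the second term is at most 1/16. *)
Lemma velocity_large s t : 0 <= t < T -> T - t <= 1 / 4 ->
  (((T - t) `^ (- s) / 8)%:E <= Lp_cylinder +oo (velocity T s t))%E.
Proof.
move=> /andP[t0 tT] e4; have e0 : 0 < T - t by rewrite subr_gt0.
pose x : vec3 R := (Num.sqrt (T - t), 0, 1 / 2).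
have xx : Num.sqrt (T - t) ^+ 2 = T - t by rewrite sqr_sqrtr ?ltW.
have Dx : cylinder x.
  split; last by rewrite /x/=; apply/andP; split; lra.
  by rewrite rad_le1 /x/= xx expr0n addr0; lra.
have cu : {for x, continuous (fun y => enorm (velocity T s t y))}.
  apply: enorm_continuous.
  apply: (continuous_slice (smooth_on_continuous (velocity_smooth T s) _)).
  by split=> //=; rewrite in_itv/= t0.
apply: le_trans (le_Lp_cylinder_oo Dx cu); rewrite lee_fin.
have [h1 [h2 _]] := powR_split s e0.
rewrite /velocity/swirl enorm_swirl.
rewrite /x/= /core xx expr0n/= addr0 /amplitude h2 h1 /boundary_value.
set A := _ `^ (- s); have A0 : 0 <= A by exact: powR_ge0.
have k1 : (T - t + 1)^-1 ^+ 2 <= 1.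
  by rewrite exprn_ile1 ?invr_ge0 ?invf_le1; lra.
have k0 : 0 <= (T - t + 1)^-1 ^+ 2 by exact: sqr_ge0.
rewrite -mulrA; set K := _ ^+ 2 in k1 k0 *.
set e := T - t in e0 e4 xx *; clearbody e A K.
apply: (@le_trans _ _ (A * (Num.sqrt e * e * ((e + e)^-1 ^+ 2 - K) * Num.sqrt e))).
  rewrite ler_wpM2l//.
  have -> : Num.sqrt e * e * ((e + e)^-1 ^+ 2 - K) * Num.sqrt e =
    Num.sqrt e ^+ 2 * e * ((e + e)^-1 ^+ 2 - K) by ring.
  rewrite xx.
  have -> : e * e * ((e + e)^-1 ^+ 2 - K) = 1 / 4 - e ^+ 2 * K.
    by field; rewrite ?gt_eqF ?addr_gt0.
  nra.
rewrite !mulrA ler_wpM2r ?sqrtr_ge0//; apply: le_trans (ler_norm _).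
by rewrite le_eqVlt; apply/orP; left; apply/eqP; ring.
Qed.

Lemma velocity_blow_up s : 0 < T -> 0 < s ->
  Lp_cylinder +oo%E (velocity T s t) @[t --> T^'-] --> +oo%E.
Proof.
move=> T0 s0; apply/cvgeyPge => M.
pose N := 8 * `|M| + 1.
have N0 : 0 < N by rewrite /N; have := normr_ge0 M; lra.
(* The time left at which e^(-s) = N. *)
pose d := N `^ (- s^-1).
have d0 : 0 < d by exact: powR_gt0.
near=> t.
have tT : t < T by near: t; exact: nbhs_left_lt.
have t0 : 0 <= t by near: t; exact: nbhs_left_ge.
have td : T - t < d by near: t; exact: nbhs_left_ltBl.
have t4 : T - t < 1 / 4 by near: t; apply: nbhs_left_ltBl.
apply: (le_trans _ (velocity_large s _ (ltW t4))); last by rewrite t0.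
have e0 : 0 < T - t by rewrite subr_gt0.
have : N <= (T - t) `^ (- s).
  have -> : N = d `^ (- s).
    rewrite /d -powRrM mulrNN mulVf ?powRr1 ?(ltW N0)//.
    by rewrite gt_eqF.
  rewrite !powRN lef_pV2 ?posrE ?powR_gt0//.
  by apply: ge0_ler_powR; rewrite ?nnegrE ?ltW.
rewrite lee_fin /N; have := ler_norm M; lra.
Unshelve. all: by end_near. Qed.

End Conclusion.

Theorem corollary4p2 (R : realType) (T : R) (T_gt0 : 0 < T)
    (alpha : R) (alpha_ge0 : 0 <= alpha) (alpha_lt1 : alpha < 1)
    (q : \bar R) (q_ge1 : (1%:E <= q)%E) (p : R) (p_ge1 : 1 <= p)
    (pq : exponent_condition (3 - alpha) p q) :
  exists (f : R -> vec3 R -> vec3 R) (v0 : vec3 R -> vec3 R)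
         (v : R -> vec3 R -> vec3 R) (P : R -> vec3 R -> R),
    [/\ LqLp T q p f,
        smooth_on (spacetime T) (fun z => f z.1 z.2),
        smooth_solution T f v0 v P
        /\ (forall (u : R -> vec3 R -> vec3 R) (Q : R -> vec3 R -> R),
              smooth_solution T f v0 u Q ->
              forall t x, spacetime T (t, x) -> u t x = v t x),
        Lp_cylinder +oo%E (v t) @[t --> T^'-] --> +oo%E &
        forall (pt : R) (qt : \bar R), 1 <= pt -> (1%:E <= qt)%E ->
          exponent_condition (1 - alpha) pt qt -> LqLp T qt pt v].
Proof.
pose s := (1 - alpha) / 2.
have s0 : 0 < s by rewrite /s; lra.
have s1 : s <= 1 / 2 by rewrite /s; lra.
have fS := force_smooth T s; have vS := velocity_smooth T s.
have sol : smooth_solution T (force T s) (velocity T s 0) (velocity T s) (pressure T s).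
  split=> //; first exact: pressure_smooth.
  - exact: velocity_navier_stokes.
  - move=> t /andP[_ tT]; split; last exact: swirl_total_slip.
    exact: swirl_no_slip.
exists (force T s), (velocity T s 0), (velocity T s), (pressure T s); split=> //.
- apply: (@LqLp_concentrated _ T 46 (s + 1) p q) => //; first lra.
  + by have -> : 2 * (s + 1) = 3 - alpha by rewrite /s; field.
  + exact: smooth_measurable.
  + by move=> t x; apply: force_size => //; exact: ltW.
- split=> // u Q uS; exact: navier_stokes_unique uS sol.
- exact: velocity_blow_up.
- move=> pt qt pt1 qt1 pqt.
  apply: (@LqLp_concentrated _ T 1 s pt qt) => //; first exact: ltW.
  + by have -> : 2 * s = 1 - alpha by rewrite /s; field.
  + exact: smooth_measurable.
  + exact: velocity_size.
Qed.
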